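(* Let $K$ be a discretely valued Henselian field with algebraically closed residue field of characteristic $p$. Let $q$ be a prime not equal to $p$, and let $n_1,\ldots,n_\ell$ be positive integers. Then there exists a superelliptic curve $C/K$ of degree $q$ such that $$\mathcal{D}(C/K)=q\mathbb{N}\cup n_1\mathbb{N}\cup\cdots\cup n_\ell\mathbb{N}.$$
   Context: $\mathbb{N}$ denotes the positive integers and $k\mathbb{N}=\{kn:n\in\mathbb{N}\}$. The value group of $K$ is $\mathbb{Z}$. A curve is a smooth, projective, geometrically integral scheme of dimension 1 over a field. A superelliptic curve $C/K$ of degree $q$ is the normalization of the projective closure of an affine curve $y^q=F(x)$, where $F(x)\in K[x]$ is nonconstant and not divisible by the $q$-th power of a nonconstant polynomial. The degree set is $\mathcal{D}(C/K)=\{\deg_K(P): P\in C\text{ closed point}\}$, where $\deg_K(P)$ is the degree over $K$ of the residue field of $P$. *)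

(* Defs.v *)
From HB Require Import structures.
From mathcomp Require Import all_boot all_order all_algebra.

Set Implicit Arguments.
Unset Strict Implicit.
Unset Printing Implicit Defensive.

Import Order.TTheory GRing.Theory Num.Theory.
Local Open Scope ring_scope.

(* A ring morphism out of a subring A of L is encoded by a total function on L
   that is constrained only on A; its values outside A are irrelevant. *)
Definition ring_hom_on (L S : nzRingType) (A : L -> Prop) (f : L -> S) : Prop :=
  [/\ f 1 = 1,
      forall a b, A a -> A b -> f (a + b) = f a + f b
    & forall a b, A a -> A b -> f (a * b) = f a * f b].

(* [dval v] is only meaningful on nonzero elements (the value of 0 is +oo). *)
Record discrete_valuation (K : fieldType) := DiscreteValuation {
  dval :> K -> int;
  dvalM : forall a b, a != 0 -> b != 0 -> dval (a * b) = dval a + dval b;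
  dvalD : forall a b, a != 0 -> b != 0 -> a + b != 0 ->
    Num.min (dval a) (dval b) <= dval (a + b);
  dval_onto : forall n : int, exists2 a, a != 0 & dval a = n }.

Definition val_ring (K : fieldType) (v : discrete_valuation K) : pred K :=
  fun a => (a == 0) || (0 <= v a).

Definition val_max (K : fieldType) (v : discrete_valuation K) : pred K :=
  fun a => (a == 0) || (0 < v a).

Definition henselian (K : fieldType) (v : discrete_valuation K) : Prop :=
  forall (f : {poly K}) (a : K),
    f \is monic -> (forall i, val_ring v f`_i) -> val_ring v a ->
    val_max v f.[a] -> ~~ val_max v f^`().[a] ->
  exists b, [/\ val_ring v b, root f b & val_max v (b - a)].

(* [r] identifies k with the residue field of v. *)
Definition is_residue_map (K : fieldType) (v : discrete_valuation K)
    (k : fieldType) (r : K -> k) : Prop :=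
  [/\ ring_hom_on (val_ring v) r,
      forall z : k, exists2 a, val_ring v a & r a = z
    & forall a, val_ring v a -> (r a == 0) = val_max v a].

(* p is the nonnegative generator of the kernel of Z -> k; p = 0 is allowed. *)
Definition has_characteristic (k : fieldType) (p : nat) : Prop :=
  forall n : nat, (n%:R == 0 :> k) = (p %| n)%N.

Definition ext_degree (K E : nzRingType) (j : K -> E) (d : nat) : Prop :=
  exists e : 'I_d -> E, forall z : E,
    exists! c : {ffun 'I_d -> K}, z = \sum_(i < d) j (c i) * e i.

Definition eval2 (K L : nzRingType) (iota : K -> L) (a b : L)
    (P : {poly {poly K}}) : L :=
  (map_poly (map_poly iota) P).[a, b].

(* The integral affine curve y^q = F(x), given through its function field L:
   [aff_rel] and [aff_gen] say that L is the fraction field of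
   K[X, Y] / (Y^q - F(X)), with x and y the classes of X and Y. *)
Record affine_model (K : fieldType) (q : nat) := AffineModel {
  aff_F : {poly K};
  aff_F_nonconst : (1 < size aff_F)%N;
  aff_F_powfree : forall G H : {poly K}, (1 < size G)%N -> aff_F != G ^+ q * H;
  funfield : fieldType;
  iota : {rmorphism K -> funfield};
  aff_x : funfield;
  aff_y : funfield;
  aff_rel : forall P : {poly {poly K}},
    eval2 iota aff_x aff_y P = 0 <->
    exists Q : {poly {poly K}}, P = Q * ('Y ^+ q - aff_F^:P);
  aff_gen : forall z : funfield, exists P Q : {poly {poly K}},
    eval2 iota aff_x aff_y Q != 0 /\
    z = eval2 iota aff_x aff_y P / eval2 iota aff_x aff_y Q }.

Section Curve.
Variables (K : fieldType) (q : nat) (C : affine_model K q).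
Local Notation L := (funfield C).
Local Notation x := (aff_x C).
Local Notation y := (aff_y C).
Local Notation io := (@iota K q C).

(* The closure in P^2, with x = X/Z and y = Y/Z, is covered by its intersections
   with the three standard affine opens Z != 0, X != 0, Y != 0; these have
   coordinate rings K[x, y], K[1/x, y/x], K[x/y, 1/y] inside L. *)
Definition charts : seq (L * L) := [:: (x, y); (x^-1, y / x); (x / y, y^-1)].

(* Coordinate rings of the corresponding affine opens of the normalization. *)
Definition normal_chart (ab : L * L) : L -> Prop :=
  fun z => integralOver (eval2 io ab.1 ab.2) z.

(* A (scheme-theoretic) point of Spec A is a morphism ev from A to a field
   kappa generated as a field by the image: kappa is then the residue field. *)
Definition is_point (A : L -> Prop) (kappa : fieldType) (ev : L -> kappa) :=
  ring_hom_on A ev /\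
  forall z : kappa, exists a b, [/\ A a, A b, ev b != 0 & z = ev a / ev b].

(* The point is closed when the kernel is maximal, i.e. ev is onto. *)
Definition is_closed_point (A : L -> Prop) (kappa : fieldType)
    (ev : L -> kappa) :=
  ring_hom_on A ev /\ forall z : kappa, exists2 a, A a & ev a = z.

Definition degree_set (d : nat) : Prop :=
  exists2 ab, ab \in charts &
  exists (kappa : fieldType) (ev : L -> kappa),
    is_closed_point (normal_chart ab) ev /\ ext_degree (ev \o io) d.

Definition is_derivation (A : L -> Prop) (kappa : fieldType)
    (ev : L -> kappa) (D : L -> kappa) : Prop :=
  [/\ forall a b, A a -> A b -> D (a + b) = D a + D b,
      forall a b, A a -> A b -> D (a * b) = ev a * D b + ev b * D a
    & forall c : K, D (io c) = 0].

(* Smoothness of relative dimension 1 over K: at every point P, the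
   kappa(P)-space Omega_{C/K} (x) kappa(P) has dimension 1. Its dual is the space
   of K-derivations from the coordinate ring of a chart to kappa(P). Flatness
   over K and having dimension 1 are automatic here. *)
Definition smooth_curve : Prop :=
  forall ab, ab \in charts ->
  forall (kappa : fieldType) (ev : L -> kappa),
    is_point (normal_chart ab) ev ->
  exists D0 : L -> kappa,
    [/\ is_derivation (normal_chart ab) ev D0,
        exists2 a, normal_chart ab a & D0 a != 0
      & forall D, is_derivation (normal_chart ab) ev D ->
          exists c : kappa, forall a, normal_chart ab a -> D a = c * D0 a].

(* For every field extension K'/K, the ring L (x)_K K' is a domain; equivalently
   the base change of the integral scheme C to K' is integral. The tensor product
   is expressed through an injective map L (x)_K K' -> T into a domain T,
   i.e. two K-morphisms i : L -> T and j : K' -> T that are linearly disjoint. *)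
Definition geometrically_integral : Prop :=
  forall (K' : fieldType) (s : {rmorphism K -> K'}),
  exists (T : idomainType) (i : {rmorphism L -> T}) (j : {rmorphism K' -> T}),
    (forall c, i (io c) = j (s c)) /\
    forall (n : nat) (u : 'I_n -> L),
      (forall a : 'I_n -> K,
         \sum_(m < n) io (a m) * u m = 0 -> forall m, a m = 0) ->
      forall b : 'I_n -> K',
        \sum_(m < n) i (u m) * j (b m) = 0 -> forall m, b m = 0.

End Curve.

Record superelliptic_curve (K : fieldType) (q : nat) := SuperellipticCurve {
  se_model :> affine_model K q;
  se_smooth : smooth_curve se_model;
  se_geomint : geometrically_integral se_model }.

Definition pos_multiple (k d : nat) : Prop := exists2 m : nat, (0 < m)%N & d = (k * m)%N.

(* Main.v *)
(* Let pi be a uniformizer, f = (X^(q t) - pi) (X^(n_1) - pi) ... (X^(n_l) - pi)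
   and F = pi f^q + pi^(q s), where t is 1 or 2, so that deg f does not vanish
   in K, and s is larger than the number of factors of f.  The curve is
   y^q = F(X); for a suitable s, F is separable.

   The valuation extends to a residue field kappa of degree d over K, as a map w
   with w(pi) = d.  If w(pi f(x)^q) <= w(pi^(q s)) at a point (x, y), then the two
   sides of y^q = F(x) show that q divides d; otherwise one of the factors satisfies
   w(x^n - pi) > w(pi), so n w(x) = d.  At infinity the equation becomes z^q = pi,
   and q divides d.  Conversely every element of kappa congruent to 1 is a q-th power,
   so F(x) is a q-th power as soon as pi^(q s) dominates it, or pi f(x)^q dominates it
   and is a q-th power.  The first case gives the degrees n m, through the roots of
   (X^n - pi)^m - pi^(m s) X (of X^n - pi if m = 1); the second one gives q m, through
   the roots of X^(q m) - 1/pi.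

   The valuation of kappa is that of the norm.  Both its ultrametric inequality and
   the q-th roots of 1-units rest on lifting coprime factorizations, which is deduced
   from the lifting of simple roots by symmetric functions of subsets of roots. *)
Require Import Defs.
From HB Require Import structures.
From mathcomp Require Import all_boot all_order all_algebra all_fingroup all_field.
From mathcomp Require Import mpoly ring zify.
From Stdlib Require Import ClassicalEpsilon.

Set Implicit Arguments.
Unset Strict Implicit.
Unset Printing Implicit Defensive.

Import Order.TTheory GRing.Theory Num.Theory.
Local Open Scope ring_scope.

(** * Splitting fields and irreducible binomials *)

(** The factor X^(q t) - pi contributes only multiples of q, and it keeps f nonconstant when no n_i
    is given. The bound on s excludes stray degrees: if no factor of f has value above w(pi), then
    w(f(x)) <= (s - 1) w(pi), and w(pi f(x)^q) stays below w(pi^(q s)). That the equation defines a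
    curve is a separate matter, since the normalization is known only through integral closures in
    three plane charts. As F is separable of degree q m, the rings K[x, y] and K[u, z], with u = 1/x
    and z = y/x^m, satisfy the Jacobian criterion. They are also integrally closed, by averaging
    over the q-th roots of unity, which Hensel's lemma puts in K. Each point of the three charts is
    matched with a point of one of these two rings, with the same local ring; smoothness and the
    equation satisfied at closed points are read there. Irreducibility of y^q = F follows from
    separability, which survives every field extension, whence geometric integrality. *)

Lemma adjoin_root (F : fieldType) (p : {poly F}) : irreducible_poly p ->
  exists (L : fieldType) (i : {rmorphism F -> L}) (z : L),
    root (map_poly i p) z /\ forall w, exists P : {poly F}, w = (map_poly i P).[z].
Proof.
move=> irr_p; have [L _ [z pz0 genL]] := irredp_FAdjoin irr_p.
exists L, (in_alg L : {rmorphism F -> L}), z; split=> // w.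
have: w \in <<1; z>>%VS by rewrite genL memvf.
by case/Fadjoin_polyP=> P /polyOver1P[P0 ->] ->; exists P0.
Qed.

Lemma irreducible_factor (F : fieldType) (p : {poly F}) : (1 < size p)%N ->
  exists2 g, irreducible_poly g & g %| p.
Proof.
have [n] := ubnP (size p); elim: n p => // n IHn p lepn p_gt1.
have [irr_p | nirr_p] := classic (irreducible_poly p).
  by exists p.
have [g [g1 gp ngp]] : exists g : {poly F}, [/\ size g != 1%N, g %| p & ~~ (g %= p)].
  apply: NNPP => noG; apply: nirr_p; split=> // g g1 gp.
  by apply/negPn/negP=> ngp; apply: noG; exists g.
have p0 : p != 0 by rewrite -size_poly_gt0 ltnW.
have g0 : g != 0 by apply: contraNneq p0 => g0; rewrite -dvd0p -g0.
have ltgp : (size g < size p)%N.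
  by rewrite ltn_neqAle dvdp_leq // andbT (dvdp_size_eqp gp).
have g_gt1 : (1 < size g)%N by rewrite ltn_neqAle eq_sym g1 size_poly_gt0.
have [h irr_h hg] := IHn g (leq_trans ltgp lepn) g_gt1.
by exists h => //; apply: dvdp_trans gp.
Qed.

Lemma splitting_field_exists (F : fieldType) (p : {poly F}) : p \is monic ->
  exists (L : fieldType) (i : {rmorphism F -> L}) (rs : seq L),
    map_poly i p = \prod_(c <- rs) ('X - c%:P).
Proof.
have [n] := ubnP (size p); elim: n F p => // n IHn F p lepn mon_p.
have [p_le1 | p_gt1] := leqP (size p) 1.
  exists F, (idfun : {rmorphism F -> F}), [::].
  rewrite big_nil map_poly_id //; move: mon_p.
  rewrite (size1_polyC p_le1) monicE lead_coefC => /eqP-> //.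
have [g irr_g gp] := irreducible_factor p_gt1.
have [L [i [z [gz0 _]]]] := adjoin_root irr_g.
have /factor_theorem[p1 Dp] : root (map_poly i p) z.
  by apply: root_dvdp gz0; rewrite dvdp_map.
have mon_p1 : p1 \is monic by rewrite -(monicMr p1 (monicXsubC z)) -Dp map_monic.
have ltp1 : (size p1 < n)%N.
  rewrite -ltnS (leq_trans _ lepn) // ltnS -(size_map_poly i) Dp.
  by rewrite size_Mmonic ?monicXsubC ?monic_neq0 // size_XsubC addn2.
have [L' [i' [rs Dp1]]] := IHn L p1 ltp1 mon_p1.
exists L', (i' \o i : {rmorphism F -> L'}), (i' z :: rs).
rewrite map_poly_comp Dp rmorphM /= Dp1 big_cons mulrC rmorphB /=.
by rewrite map_polyX map_polyC.
Qed.

(* The determinant c of the companion matrix of a degree-i factor satisfies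
   c^q = a^i, with i invertible modulo q. *)
Lemma irreducible_Xn_sub (F : fieldType) (q : nat) (a : F) : prime q ->
  (forall b, b ^+ q != a) -> irreducible_poly ('X^q - a%:P).
Proof.
move=> q_pr nqa; have q_gt0 := prime_gt0 q_pr.
have szq : size ('X^q - a%:P) = q.+1 by rewrite size_XnsubC.
split=> [|g0 g0_1 g0_dvd]; first by rewrite szq ltnS.
have g0_nz : g0 != 0.
  by apply: dvdpN0 g0_dvd _; rewrite -size_poly_gt0 szq.
pose g := (lead_coef g0)^-1 *: g0.
have eq_g : g %= g0 by rewrite eqp_scale // invr_eq0 lead_coef_eq0.
have mon_g : g \is monic by rewrite monicE lead_coefZ mulVf // lead_coef_eq0.
rewrite -(eqp_ltrans eq_g) -dvdp_size_eqp; last by rewrite (eqp_dvdl _ eq_g).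
have g_dvd : g %| 'X^q - a%:P by rewrite (eqp_dvdl _ eq_g).
have szg : size g = (size g).-1.+1 by rewrite prednK // size_poly_gt0 monic_neq0.
have g_le : ((size g).-1 <= q)%N.
  by rewrite -ltnS -szg -szq dvdp_leq // -size_poly_gt0 szq.
have g_gt0 : (0 < (size g).-1)%N.
  rewrite -ltnS -szg ltn_neqAle eq_sym (eqp_size eq_g) g0_1.
  by rewrite size_poly_gt0.
rewrite szq szg eqSS eqn_leq g_le leqNgt; apply/negP=> ltgq.
have chA := companionmxK mon_g; set A := companionmx g in chA.
move: A chA ltgq g_gt0; move: (size g).-1 => [//|i] A chA ltiq _.
have: horner_mx A ('X^q - a%:P) = 0.
  have /dvdpP[h ->] := g_dvd; rewrite rmorphM /= -[in X in _ * X]chA.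
  by rewrite Cayley_Hamilton mulr0.
rewrite rmorphB rmorphXn /= horner_mx_X horner_mx_C => /subr0_eq DAq.
have Dd : (\det A) ^+ q = a ^+ i.+1.
  rewrite -[RHS](det_scalar i.+1) -DAq.
  by elim: (q) => [|m IH]; rewrite ?expr0 ?det1 // !exprS IH -det_mulmx.
have a_nz : a != 0.
  by apply: contraNneq (nqa 0) => ->; rewrite expr0n gtn_eqF.
have co_iq : coprime i.+1 q.
  by rewrite coprime_sym prime_coprime // gtnNdvd.
case: (egcdnP q (ltn0Sn i)) => u w Duw _.
move: Duw; rewrite (eqP co_iq) => Duw.
apply: (negP (nqa ((\det A) ^+ u / a ^+ w))); apply/eqP.
rewrite expr_div_n -!exprM mulnC exprM Dd -exprM mulnC Duw exprD expr1.
by rewrite mulrAC divff ?mul1r // expf_neq0.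
Qed.

(** * Lifting coprime factorizations *)

Lemma mmap_comp_mpoly (R A : comNzRingType) (n m : nat) (f : {rmorphism R -> A})
    (h : 'I_m -> A) (T : {mpoly R[n]}) (S : n.-tuple {mpoly R[m]}) :
  mmap f h (T \mPo S) = mmap f (fun i => mmap f h (tnth S i)) T.
Proof.
rewrite comp_mpolyEX raddf_sum; apply: eq_bigr => /= m' _.
rewrite mmapZ comp_mpolyX rmorph_prod; congr (_ * _).
by apply: eq_bigr => i _; rewrite rmorphXn.
Qed.

(** The point is uniformity: by the fundamental theorem on symmetric polynomials the value is a
    polynomial in the coefficients of [g], so one [c] serves both for the roots in [k] and for those
    in a splitting field over [K]. *)
Lemma symmetric_value (R : comNzRingType) (n : nat) (p : {mpoly R[n]}) (g : {poly R}) :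
    p \is symmetric ->
  exists c : R, forall (A : idomainType) (f : {rmorphism R -> A}) (t : n.-tuple A),
    map_poly f g = \prod_(x <- t) ('X - x%:P) -> mmap f (tnth t) p = f c.
Proof.
case/sym_fundamental=> T [<- _].
exists (T.@[fun i => (-1) ^+ i.+1 * g`_(n - i.+1)]) => A f t Dg.
rewrite mmap_comp_mpoly mevalE rmorph_sum; apply: eq_bigr => /= m _.
rewrite rmorphM rmorph_prod; congr (_ * _); apply: eq_bigr => i _.
rewrite rmorphXn; congr (_ ^+ _).
have := mroots_coeff t (lift ord0 i); rewrite -Dg coef_map /= => Dc.
rewrite rmorphM rmorphXn rmorphN rmorph1 /= Dc mulrA -exprMn mulrNN mulr1.
rewrite expr1n mul1r tnth_mktuple /mesym !raddf_sum /=; apply: eq_bigr => S _.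
rewrite !rmorph_prod; apply: eq_bigr => j _.
by rewrite /= mmapX mmap1U mevalXU.
Qed.

Section SubsetFamilies.
Variables (R : comNzRingType) (n e : nat).
Implicit Types (A B : {set 'I_n} -> {mpoly R[n]}) (S : {set 'I_n}) (s : 'S_n).

(** Compatibility with permutations makes sums and products over all subsets of a given size
    symmetric in the variables. *)
Definition equivariant A := forall s S, msym s (A S) = A (s @: S).

Lemma imset_perm_bij s : bijective (fun S => s @: S).
Proof. exact/injF_bij/imset_inj/perm_inj. Qed.

Lemma equivariant_prod A : equivariant A ->
  \prod_(S : {set 'I_n} | #|S| == e) A S \is symmetric.
Proof.
move=> eqA; apply/issymP=> s; rewrite rmorph_prod.
rewrite [RHS](reindex (fun S => s @: S)) /=; last exact/onW_bij/imset_perm_bij.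
by apply: eq_big => [S | S _]; rewrite ?eqA // card_imset //; apply: perm_inj.
Qed.

Lemma equivariant_sum A : equivariant A ->
  \sum_(S : {set 'I_n} | #|S| == e) A S \is symmetric.
Proof.
move=> eqA; apply/issymP=> s; rewrite rmorph_sum.
rewrite [RHS](reindex (fun S => s @: S)) /=; last exact/onW_bij/imset_perm_bij.
by apply: eq_big => [S | S _]; rewrite ?eqA // card_imset //; apply: perm_inj.
Qed.

Lemma equivariant_lagrange A B : equivariant A -> equivariant B ->
  equivariant (fun S => A S * \prod_(S' : {set 'I_n} | (#|S'| == e) && (S' != S)) B S').
Proof.
move=> eqA eqB s S; rewrite rmorphM rmorph_prod /= eqA; congr (_ * _).
rewrite [RHS](reindex (fun S => s @: S)) /=; last exact/onW_bij/imset_perm_bij.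
apply: eq_big => [S' | S' _]; last exact: eqB.
by rewrite card_imset ?(inj_eq (imset_inj _)) //; apply: perm_inj.
Qed.

Lemma equivariant_big_prod (h : 'I_n -> {mpoly R[n]}) :
  (forall s i, msym s (h i) = h (s i)) -> equivariant (fun S => \prod_(i in S) h i).
Proof.
move=> eqh s S; rewrite rmorph_prod big_imset /=; last by move=> i j _ _ /perm_inj.
by apply: eq_bigr => i _; rewrite eqh.
Qed.

End SubsetFamilies.

Lemma msymXU (R : comNzRingType) (n : nat) (s : 'S_n) (i : 'I_n) :
  msym s ('X_i : {mpoly R[n]}) = 'X_(s i).
Proof. by rewrite /msym mmapX mmap1U. Qed.

Lemma msymC (R : comNzRingType) (n : nat) (s : 'S_n) (c : R) :
  msym s (c%:MP_[n]) = c%:MP_[n].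
Proof. by rewrite /msym mmapC. Qed.

Section SubsetProducts.
Variables (R : comNzRingType) (n : nat).

Definition subset_value (A : comNzRingType) (f : {rmorphism R -> A}) (t : 'I_n -> A)
    (h : {poly R}) (S : {set 'I_n}) : A :=
  \prod_(i in S) (map_poly f h).[t i].

(** The scalars are [{poly R}] because the resolvent and the interpolation formula involve an extra
    variable ['X] that permutations leave fixed. *)
Definition subset_mpoly (h : {poly R}) : {set 'I_n} -> {mpoly {poly R}[n]} :=
  fun S => \prod_(i in S) (map_poly (@mpolyC n _ \o polyC) h).['X_i].

Lemma subset_mpoly_equivariant h : equivariant (subset_mpoly h).
Proof.
apply: equivariant_big_prod => s i.
rewrite -horner_map /= msymXU -map_poly_comp; congr (_.[_]).
by apply: eq_map_poly => c /=; rewrite msymC.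
Qed.

Lemma mmap_subset_mpoly (A : comNzRingType) (f : {rmorphism R -> A}) (t : n.-tuple A) h S :
  mmap (map_poly f) (tnth (map_tuple polyC t)) (subset_mpoly h S)
  = (subset_value f (tnth t) h S)%:P.
Proof.
rewrite /subset_mpoly /subset_value !rmorph_prod; apply: eq_bigr => i _ /=.
rewrite -horner_map /= mmapX mmap1U tnth_map -map_poly_comp.
rewrite (_ : map_poly _ h = map_poly polyC (map_poly f h)) ?horner_map //.
rewrite -map_poly_comp; apply: eq_map_poly => c /=.
by rewrite mmapC; apply: map_polyC.
Qed.

(* The polynomial whose roots are the values of S |-> prod_(i in S) h(x_i) on
   the e-subsets S of the roots x_i of g is defined over R. *)
Lemma subset_resolvent (g h : {poly R}) (e : nat) :
  exists Phi : {poly R}, forall (A : idomainType) (f : {rmorphism R -> A}) (t : n.-tuple A),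
    map_poly f g = \prod_(x <- t) ('X - x%:P) ->
    map_poly f Phi = \prod_(S : {set 'I_n} | #|S| == e)
                        ('X - (subset_value f (tnth t) h S)%:P).
Proof.
pose p : {mpoly {poly R}[n]} :=
  \prod_(S : {set 'I_n} | #|S| == e) ('X%:MP_[n] - subset_mpoly h S).
have p_sym : p \is symmetric.
  apply: equivariant_prod => s S; rewrite rmorphB /= msymC.
  by rewrite subset_mpoly_equivariant.
have [Phi DPhi] := symmetric_value (map_poly polyC g) p_sym.
exists Phi => A f t Dg; rewrite -(DPhi _ _ (map_tuple polyC t)) /=; last first.
  rewrite -map_poly_comp big_map.
  transitivity (map_poly polyC (map_poly f g)).
    by rewrite -map_poly_comp; apply: eq_map_poly => c /=; rewrite map_polyC.
  rewrite Dg rmorph_prod; apply: eq_bigr => x _.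
  by rewrite rmorphB /= map_polyX map_polyC.
rewrite rmorph_prod; apply: eq_bigr => S _.
rewrite rmorphB /= mmapC mmap_subset_mpoly; congr (_ - _).
exact: map_polyX.
Qed.

(* Lagrange interpolation over the e-subsets: evaluated at t, only the subset
   whose value is b contributes. *)
Lemma subset_lagrange (g h : {poly R}) (e : nat) (b : R) :
  exists c : {poly R}, forall (A : idomainType) (f : {rmorphism R -> A}) (t : n.-tuple A),
    map_poly f g = \prod_(x <- t) ('X - x%:P) ->
    map_poly f c = \sum_(S : {set 'I_n} | #|S| == e)
      (\prod_(i in S) ('X - (tnth t i)%:P)) *
      \prod_(S' : {set 'I_n} | (#|S'| == e) && (S' != S))
        (f b - subset_value f (tnth t) h S')%:P.
Proof.
pose p : {mpoly {poly R}[n]} :=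
  \sum_(S : {set 'I_n} | #|S| == e)
     (\prod_(i in S) ('X%:MP_[n] - 'X_i)) *
      \prod_(S' : {set 'I_n} | (#|S'| == e) && (S' != S)) (b%:P%:MP_[n] - subset_mpoly h S').
have p_sym : p \is symmetric.
  apply: equivariant_sum; apply: equivariant_lagrange.
    apply: equivariant_big_prod => s i.
    by rewrite rmorphB /= msymC msymXU.
  by move=> s S; rewrite rmorphB /= msymC subset_mpoly_equivariant.
have [c Dc] := symmetric_value (map_poly polyC g) p_sym.
exists c => A f t Dg; rewrite -(Dc _ _ (map_tuple polyC t)) /=; last first.
  rewrite -map_poly_comp big_map.
  transitivity (map_poly polyC (map_poly f g)).
    by rewrite -map_poly_comp; apply: eq_map_poly => a /=; rewrite map_polyC.
  rewrite Dg rmorph_prod; apply: eq_bigr => x _.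
  by rewrite rmorphB /= map_polyX map_polyC.
rewrite rmorph_sum; apply: eq_bigr => S _; rewrite rmorphM !rmorph_prod; congr (_ * _).
  apply: eq_bigr => i _.
  rewrite rmorphB /= mmapC mmapX mmap1U tnth_map; congr (_ - _).
  exact: map_polyX.
apply: eq_bigr => S' _.
rewrite rmorphB /= mmapC mmap_subset_mpoly polyCB; congr (_ - _).
exact: map_polyC.
Qed.

End SubsetProducts.

(** * From simple roots to coprime factors *)

Section HenselFactor.
Variables (R : comNzRingType) (K k : fieldType).
Variables (iR : {rmorphism R -> K}) (rho : {rmorphism R -> k}).
Hypothesis iR_inj : injective iR.
Hypothesis rho_surj : forall z, exists a, rho a = z.
Hypothesis simple_root_lift : forall (f : {poly R}) (a : R), f \is monic ->
  rho f.[a] = 0 -> rho f^`().[a] != 0 -> exists2 b, root f b & rho b = rho a.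

Lemma lift_poly (p : {poly k}) : exists P : {poly R}, map_poly rho P = p.
Proof.
elim/poly_ind: p => [|p c [P <-]]; first by exists 0; rewrite map_poly0.
have [a <-] := rho_surj c; exists (P * 'X + a%:P).
by rewrite rmorphD rmorphM /= map_polyX map_polyC.
Qed.

(* The resolvent of the e-subsets S of roots, for a polynomial h that is 1 at alpha
   and 0 at the other roots, has 1 as a simple root in k; its lift singles out a
   subset of roots over K. *)
Lemma hensel_factor (g : {poly R}) (rs : seq k) (alpha : k) : g \is monic ->
    map_poly rho g = \prod_(x <- rs) ('X - x%:P) ->
  exists g1 g2 : {poly K}, [/\ map_poly iR g = g1 * g2, coprimep g1 g2
    & size g1 = (count_mem alpha rs).+1].
Proof.
move=> mon_g; set n := size rs; pose t : n.-tuple k := in_tuple rs.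
rewrite -[rs]/(tval t) => Drg; set e := count_mem _ _.
pose S0 := [set i | tnth t i == alpha].
have cS0 : #|S0| = e.
  by rewrite /e -sum1_count big_tuple -sum1dep_card; apply: eq_bigl => i.
have [h [h1 h0]] : exists h : {poly R},
    (map_poly rho h).[alpha] = 1 /\ forall i, i \notin S0 -> (map_poly rho h).[tnth t i] = 0.
  pose h0 := \prod_(i | i \notin S0) ('X - (tnth t i)%:P).
  have h0a : h0.[alpha] != 0.
    rewrite horner_prod; apply/prodf_neq0 => i; rewrite inE => ni.
    by rewrite hornerXsubC subr_eq0 eq_sym.
  have [h Dh] := lift_poly (h0.[alpha]^-1 *: h0); exists h; rewrite Dh.
  split=> [|i iS]; rewrite hornerZ ?mulVf //.
  by rewrite [X in _ * X]horner_prod (bigD1 i) //= hornerXsubC subrr mul0r mulr0.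
have lam_k (S : {set 'I_n}) : #|S| == e ->
    subset_value rho (tnth t) h S = (S == S0)%:R.
  move=> /eqP cS; have [-> | neS] := eqVneq S S0.
    by apply: big1 => i; rewrite inE => /eqP->.
  have [i iS iS0] : exists2 i, i \in S & i \notin S0.
    apply/subsetPn; apply: contra neS => sSS0.
    by rewrite eqEcard sSS0 cS0 cS /=.
  by rewrite /subset_value (bigD1 i) //= h0 // mul0r.
have [Phi DPhi] := subset_resolvent n g h e.
have DPk := DPhi _ rho t Drg.
pose N := \prod_(S : {set 'I_n} | (#|S| == e) && (S != S0)) ('X - (0%:P : {poly k})).
have DPk1 : map_poly rho Phi = ('X - 1%:P) * N.
  rewrite DPk (bigD1 S0) ?cS0 //= lam_k ?cS0 // eqxx; congr (_ * _).
  by apply: eq_bigr => S /andP[cS /negPf neS]; rewrite lam_k // neS.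
have [L [i [rs' DrsL]]] := splitting_field_exists (monic_map iR mon_g).
have szrs' : size rs' == n.
  rewrite -eqSS -(size_prod_XsubC rs' id) -DrsL size_map_poly.
  rewrite size_map_inj_poly ?rmorph0 //.
  have g1 : rho (lead_coef g) != 0 by rewrite (monicP mon_g) rmorph1 oner_neq0.
  by rewrite -(size_map_poly_id0 g1) Drg size_prod_XsubC.
pose t' : n.-tuple L := Tuple szrs'; rewrite -[rs']/(tval t') in DrsL.
pose f : {rmorphism R -> L} := i \o iR.
have f_inj : injective f by move=> x y /fmorph_inj/iR_inj.
have DfL : map_poly f g = \prod_(x <- t') ('X - x%:P) by rewrite -DrsL map_poly_comp.
have DPL := DPhi _ f t' DfL.
have mon_Phi : Phi \is monic.
  rewrite monicE -(inj_eq f_inj) rmorph1 -lead_coef_map_inj ?rmorph0 // DPL.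
  by apply/eqP/monicP/monic_prod => S _; apply: monicXsubC.
have Phi1 : rho Phi.[1] = 0.
  by rewrite -horner_map rmorph1 DPk1 hornerM hornerXsubC subrr mul0r.
have dPhi1 : (map_poly rho Phi)^`().[1] != 0.
  rewrite DPk1 derivM hornerD !hornerM derivXsubC hornerXsubC subrr mul0r addr0.
  rewrite hornerC mul1r horner_prod; apply/prodf_neq0 => S _.
  by rewrite hornerXsubC subr0 oner_neq0.
have [|b Pb rb] := simple_root_lift mon_Phi Phi1.
  by rewrite -horner_map rmorph1 -deriv_map.
have [S1 /andP[cS1 lamS1]] : exists S1 : {set 'I_n},
    (#|S1| == e) && (f b - subset_value f (tnth t') h S1 == 0).
  have /eqP := congr1 f (rootP Pb); rewrite rmorph0 -horner_map DPL horner_prod.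
  by case/prodf_eq0 => S cS; rewrite hornerXsubC => lamS; exists S; rewrite cS.
(* The image under [f] of the derivative of [Phi] at its simple root [b], hence nonzero. *)
pose delta := \prod_(S : {set 'I_n} | (#|S| == e) && (S != S1))
                (f b - subset_value f (tnth t') h S).
have delta_nz : delta != 0.
  have : f Phi^`().[b] != 0.
    rewrite -(rmorph0 f) (inj_eq f_inj); apply/eqP=> Pb0.
    move/eqP: dPhi1; rewrite deriv_map -[X in _.[X]](rmorph1 rho) -rb.
    by rewrite horner_map Pb0 rmorph0 => /eqP; rewrite eqxx.
  rewrite -horner_map -deriv_map DPL (bigD1 S1) //= derivM derivXsubC hornerD !hornerM.
  rewrite hornerXsubC (eqP lamS1) mul0r addr0 hornerC mul1r horner_prod.
  by congr (_ != 0); apply: eq_bigr => S _; rewrite hornerXsubC.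
have [c Dc] := subset_lagrange n (map_poly iR g) (map_poly iR h) e (iR b).
have lamE S : subset_value i (tnth t') (map_poly iR h) S = subset_value f (tnth t') h S.
  by apply: eq_bigr => j _; rewrite -map_poly_comp.
(* Interpolation at [b] kills every subset except [S1], so [delta] times the factor with roots in
   [S1] descends to [K]. *)
have {}Dc : map_poly i c = \prod_(j in S1) ('X - (tnth t' j)%:P) * delta%:P.
  rewrite (Dc _ i t' DrsL) (bigD1 S1) //= [X in _ + X]big1 ?addr0 => [|S /andP[cS neS]].
    by rewrite rmorph_prod; congr (_ * _); apply: eq_bigr => S _; rewrite lamE.
  rewrite (bigD1 S1) /=; last by rewrite cS1 eq_sym.
  by rewrite lamE (eqP lamS1) mul0r mulr0.
have DgS : map_poly i (map_poly iR g) =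
    \prod_(j in S1) ('X - (tnth t' j)%:P) * \prod_(j in ~: S1) ('X - (tnth t' j)%:P).
  rewrite DrsL big_tuple (bigID (mem S1)) /=; congr (_ * _).
  by apply: eq_bigl => j; rewrite inE.
have c_nz : c != 0.
  rewrite -(map_poly_eq0 i) Dc mulf_neq0 ?polyC_eq0 //.
  by apply/prodf_neq0 => j _; rewrite polyXsubC_eq0.
have c_dvd : c %| map_poly iR g.
  rewrite -(dvdp_map i) DgS Dc dvdp_mul // -[_%:P]mulr1 mul_polyC dvdpZl //.
  exact: dvd1p.
exists c, (map_poly iR g %/ c); rewrite mulrC divpK //; split=> //; last first.
  rewrite -(size_map_poly i) Dc mulrC mul_polyC size_scale //.
  by rewrite -big_enum size_prod_XsubC -cardE (eqP cS1).
set g2 := _ %/ _.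
have Dg2 : map_poly i g2 * delta%:P = \prod_(j in ~: S1) ('X - (tnth t' j)%:P).
  have S1_nz : \prod_(j in S1) ('X - (tnth t' j)%:P) != 0.
    by apply/prodf_neq0 => j _; rewrite polyXsubC_eq0.
  apply: (mulfI S1_nz); rewrite -DgS -(divpK c_dvd) -/g2 rmorphM /= Dc.
  by rewrite mulrCA mulrC.
rewrite -(coprimep_map i) Dc mulrC mul_polyC coprimepZl // coprimep_sym.
elim/big_rec: _ => [|j p jS1 cop]; first exact: coprimep1.
rewrite coprimepMr cop andbT coprimep_XsubC; apply/negP => rt.
have : root (\prod_(j in ~: S1) ('X - (tnth t' j)%:P)) (tnth t' j).
  by rewrite -Dg2 rootM rt.
rewrite rootE horner_prod => /prodf_eq0[l]; rewrite inE => lS1.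
rewrite hornerXsubC subr_eq0 => /eqP tjl.
(* If a root occurred both inside and outside [S1], exchanging [j] and [l] would give another
   [e]-subset with the same value, and [delta] would vanish. *)
pose S2 := l |: (S1 :\ j).
have cS2 : #|S2| == e.
  by rewrite cardsU1 !inE (negPf lS1) andbF add1n -(eqP cS1) (cardsD1 j S1) jS1.
have neS : S2 != S1.
  by apply: contraNneq lS1 => <-; rewrite !inE eqxx.
move/prodf_neq0: delta_nz => /(_ S2); rewrite cS2 neS => /(_ isT).
rewrite -(eqP lamS1) -subr_eq0 => /eqP[]; rewrite opprB addrC subrKA; apply/eqP.
rewrite subr_eq0 /subset_value (bigD1 j jS1) /= (big_setU1 _ _) /=; last first.
  by rewrite !inE (negPf lS1) andbF.
rewrite tjl; apply/eqP; congr (_ * _); apply: eq_bigl => m.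
by rewrite !inE andbC.
Qed.

End HenselFactor.

(** * The valuation of a finite extension *)

Section ValuationRing.
Variables (K : fieldType) (v : discrete_valuation K).

Lemma dval1 : v 1 = 0.
Proof.
have := dvalM v (oner_neq0 K) (oner_neq0 K).
by rewrite mulr1 => /eqP; rewrite -subr_eq subrr eq_sym => /eqP.
Qed.

Lemma dvalV a : a != 0 -> v a^-1 = - v a.
Proof.
move=> a0; apply/eqP; rewrite -subr_eq0 opprK addrC.
by rewrite -dvalM ?invr_eq0 // divff // dval1.
Qed.

Lemma dvalX a n : a != 0 -> v (a ^+ n) = v a *+ n.
Proof.
move=> a0; elim: n => [|n IHn]; first by rewrite expr0 dval1.
by rewrite exprS dvalM ?expf_neq0 // IHn mulrS.
Qed.

Lemma dvalN a : v (- a) = v a.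
Proof.
have [->|a0] := eqVneq a 0; first by rewrite oppr0.
have N1 : (-1 : K) != 0 by rewrite oppr_eq0 oner_neq0.
have vN1 : v (-1) = 0.
  apply/eqP; have := dvalX 2 N1; rewrite sqrrN expr1n dval1 => /esym/eqP.
  by rewrite mulrn_eq0.
by rewrite -mulN1r dvalM // vN1 add0r.
Qed.

Fact val_ring_subring : subring_closed (val_ring v).
Proof.
split=> [|a b|a b]; rewrite !unfold_in /val_ring ?oner_eq0 ?dval1 ?orbT //.
  have [->|a0] := eqVneq a 0; first by rewrite sub0r oppr_eq0 dvalN.
  have [->|b0] := eqVneq b 0; first by rewrite subr0 (negPf a0).
  move=> /= va vb; have [//|ab0] := eqVneq (a - b) 0.
  apply: le_trans (dvalD v a0 _ ab0); rewrite ?oppr_eq0 // dvalN.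
  by rewrite le_min va.
have [->|a0] := eqVneq a 0; first by rewrite mul0r eqxx.
have [->|b0] := eqVneq b 0; first by rewrite mulr0 eqxx.
by move=> /= va vb; rewrite dvalM // addr_ge0 // orbT.
Qed.
HB.instance Definition _ := GRing.isSubringClosed.Build K (val_ring v) val_ring_subring.

Record int_elt := IntElt { int_val : K; _ : int_val \in val_ring v }.
HB.instance Definition _ := [isSub for int_val].
HB.instance Definition _ := [Choice of int_elt by <:].
HB.instance Definition _ := [SubChoice_isSubComNzRing of int_elt by <:].

End ValuationRing.

(** For maps obtained by choice or by restriction, whose morphism laws are proved afterwards. *)
Lemma rmorphism_of (R S : nzRingType) (f : R -> S) : f 1 = 1 ->
    (forall a b, f (a + b) = f a + f b) -> (forall a b, f (a * b) = f a * f b) ->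
  exists g : {rmorphism R -> S}, g =1 f.
Proof.
move=> f1 fD fM.
have f0 : f 0 = 0 by apply/(addrI (f 0)); rewrite -fD !addr0.
have fB : zmod_morphism f.
  by move=> a b; apply/(addIr (f b)); rewrite -fD !subrK.
have fm : monoid_morphism f by split.
pose A := GRing.isZmodMorphism.Build R S f fB.
pose B := GRing.isMonoidMorphism.Build R S f fm.
by exists (HB.pack_for {rmorphism R -> S} f A B).
Qed.

Section ResidueField.
Variables (K : fieldType) (v : discrete_valuation K) (k : fieldType) (r : K -> k).
Hypotheses (hens : henselian v) (res : is_residue_map v r).

Lemma residue_morphism : exists rho : {rmorphism int_elt v -> k}, forall a, rho a = r (val a).
Proof.
have [[r1 rD rM] _ _] := res.
have iP (a : int_elt v) : val_ring v (val a) by exact: (valP a).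
have [|a b|a b|rho rhoE] := @rmorphism_of (int_elt v) k (fun a => r (val a)).
- exact: r1.
- by apply: rD.
- by apply: rM.
by exists rho.
Qed.

Lemma residue_surj (rho : {rmorphism int_elt v -> k}) : (forall a, rho a = r (val a)) ->
  forall z, exists a, rho a = z.
Proof.
move=> rhoE z; have [_ /(_ z)[a va <-] _] := res.
by exists (IntElt va); rewrite rhoE.
Qed.

Lemma residue_eq0 (rho : {rmorphism int_elt v -> k}) : (forall a, rho a = r (val a)) ->
  forall a, (rho a == 0) = val_max v (val a).
Proof.
move=> rhoE a; have [_ _ r0] := res.
by rewrite rhoE r0 //; apply: (valP a).
Qed.

Lemma residue_simple_root_lift (rho : {rmorphism int_elt v -> k}) :
  (forall a, rho a = r (val a)) ->
  forall (f : {poly int_elt v}) a, f \is monic ->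
  rho f.[a] = 0 -> rho f^`().[a] != 0 -> exists2 b, root f b & rho b = rho a.
Proof.
move=> rhoE f a mon_f fa dfa; have r0 := residue_eq0 rhoE.
have [||||| b [vb fb mb]] := hens (f := map_poly val f) (a := val a).
- exact: monic_map.
- by move=> i; rewrite coef_map; apply: (valP f`_i).
- exact: (valP a).
- by rewrite horner_map -r0 fa.
- by rewrite deriv_map horner_map -r0.
exists (IntElt vb).
  by rewrite rootE -(inj_eq val_inj) -horner_map rmorph0 /= -rootE.
by apply/eqP; rewrite -subr_eq0 -rmorphB r0.
Qed.

End ResidueField.

Lemma closed_splits (k : closedFieldType) (p : {poly k}) : p \is monic ->
  exists rs : seq k, p = \prod_(x <- rs) ('X - x%:P).
Proof.
by move=> mon_p; have [rs] := closed_field_poly_normal p; rewrite (monicP mon_p) scale1r; exists rs.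
Qed.

(** The regular representation: determinants then play the part of the norm, and the Cayley-Hamilton
    theorem provides an equation for each element of [kappa]. *)
Lemma ext_degree_mx (K kappa : fieldType) (j : {rmorphism K -> kappa}) (d : nat) :
    ext_degree j d ->
  exists (d' : nat) (M : {rmorphism kappa -> 'M[K]_d'.+1}),
    d = d'.+1 /\ forall c, M (j c) = c%:M.
Proof.
case=> e e_basis.
have [co coP] : exists co : kappa -> {ffun 'I_d -> K},
    forall z, z = \sum_(i < d) j (co z i) * e i.
  have coE z : exists c : {ffun 'I_d -> K}, z == \sum_(i < d) j (c i) * e i.
    by have [c [Dz _]] := e_basis z; exists c; apply/eqP.
  by exists (fun z => xchoose (coE z)) => z; apply/eqP/(xchooseP (coE z)).
have coU z (c : 'I_d -> K) : z = \sum_(i < d) j (c i) * e i -> forall i, co z i = c i.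
  move=> Dz i; have [c0 [_ c0U]] := e_basis z.
  rewrite -(c0U (co z) (coP z)) (c0U [ffun i => c i]) ?ffunE //.
  by rewrite Dz; apply: eq_bigr => l _; rewrite ffunE.
pose M0 z := \matrix_(a, b < d) co (z * e a) b.
have M01 : M0 1 = 1%:M.
  apply/matrixP=> a b; rewrite !mxE; apply: (coU _ (fun b => (a == b)%:R)).
  rewrite mul1r (bigD1 a) //= eqxx.
  rewrite rmorph1 mul1r big1 ?addr0 // => i /negPf; rewrite eq_sym => ->.
  by rewrite rmorph0 mul0r.
have M0D z w : M0 (z + w) = M0 z + M0 w.
  apply/matrixP=> a b; rewrite !mxE.
  apply: (coU _ (fun b => co (z * e a) b + co (w * e a) b)).
  rewrite mulrDl {1}(coP (z * e a)) {1}(coP (w * e a)) -big_split.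
  by apply: eq_bigr => i _; rewrite rmorphD mulrDl.
have M0M z w : M0 (z * w) = M0 z *m M0 w.
  (* Row [a] holds the coordinates of [z * e a], which reverses products; commutativity of [kappa]
     restores the order. *)
  rewrite mulrC; apply/matrixP=> a b; rewrite !mxE.
  apply: (coU _ (fun b => \sum_c M0 z a c * M0 w c b)).
  rewrite -mulrA {1}(coP (z * e a)) mulr_sumr.
  under eq_bigr => i _ do rewrite mulrCA {1}(coP (w * e i)) mulr_sumr.
  rewrite exchange_big; apply: eq_bigr => i _ /=; rewrite rmorph_sum mulr_suml.
  by apply: eq_bigr => l _; rewrite !mxE rmorphM mulrA.
have M0C c : M0 (j c) = c%:M.
  apply/matrixP=> a b; rewrite !mxE; apply: (coU _ (fun b => c *+ (a == b))).
  rewrite (bigD1 a) //= eqxx mulr1n.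
  rewrite big1 ?addr0 // => i /negPf; rewrite eq_sym => ->.
  by rewrite mulr0n rmorph0 mul0r.
have d_gt0 : (0 < d)%N.
  rewrite lt0n; apply: contraNneq (oner_neq0 kappa) => d0; apply/eqP.
  by rewrite (coP 1) big1 // => i; suff: (i < 0)%N by []; rewrite -[X in (_ < X)%N]d0.
case: d d_gt0 e {e_basis co coP coU} M0 M01 M0D M0M M0C => // d _ e M M1 MD MM MC.
have [M' M'E] := rmorphism_of M1 MD MM.
by exists d, M'; split=> // c; rewrite M'E MC.
Qed.

Section MultiplicationMatrix.
Variables (K kappa : fieldType) (j : {rmorphism K -> kappa}) (d : nat).
Variable M : {rmorphism kappa -> 'M[K]_d.+1}.
Hypothesis MC : forall c, M (j c) = c%:M.

Lemma char_poly_mult_horner z c : (char_poly (M z)).[c] = \det (M (j c - z)).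
Proof.
rewrite -horner_evalE -det_map_mx; congr (\det _).
rewrite [in RHS]rmorphB MC; apply/matrixP=> a b; rewrite !mxE.
by rewrite /= horner_evalE hornerD hornerN hornerC hornerMn hornerX.
Qed.

Lemma horner_mx_mult z (p : {poly K}) : horner_mx (M z) p = M (map_poly j p).[z].
Proof.
rewrite -horner_map -map_poly_comp /= /horner_mx /horner_morph; congr (_.[_]).
by apply: eq_map_poly => c; rewrite /= MC.
Qed.

(* Since kappa is a field, the characteristic polynomial of z is a power of an
   irreducible polynomial. *)
Lemma char_poly_mult_primary z (g1 g2 : {poly K}) :
  char_poly (M z) = g1 * g2 -> coprimep g1 g2 ->
  (size g1 <= 1)%N \/ (size g2 <= 1)%N.
Proof.
(* When [g] kills [M z], every root of the characteristic polynomial in an extension is a root of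
   the minimal polynomial, hence of [g]; a divisor [h] coprime to [g] then has no root at all. *)
have main g h : horner_mx (M z) g = 0 -> h %| char_poly (M z) -> coprimep g h -> (size h <= 1)%N.
  move=> gz hch cop; rewrite leqNgt; apply/negP => h_gt1.
  have [h1 irr_h h1h] := irreducible_factor h_gt1.
  have [L [i [t [h1t _]]]] := adjoin_root irr_h.
  have ht : root (map_poly i h) t by apply: root_dvdp h1t; rewrite dvdp_map.
  have : root (map_poly i g) t.
    have: map_poly i (mxminpoly (M z)) %| map_poly i g by rewrite dvdp_map mxminpoly_min.
    move/root_dvdp; apply; rewrite -mxminpoly_map root_mxminpoly -map_char_poly.
    by apply: root_dvdp ht; rewrite dvdp_map.
  by apply/negP; apply: coprimep_root ht; rewrite coprimep_sym coprimep_map.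
move=> Dch cop.
have : M ((map_poly j g1).[z] * (map_poly j g2).[z]) = 0.
  by rewrite -hornerM -rmorphM -Dch -horner_mx_mult Cayley_Hamilton.
move/eqP; rewrite fmorph_eq0 mulf_eq0 => /orP[] /eqP g0; [right|left].
  by apply: (main g1); rewrite ?horner_mx_mult ?g0 ?rmorph0 // Dch dvdp_mull.
apply: (main g2); rewrite ?horner_mx_mult ?g0 ?rmorph0 // ?Dch ?dvdp_mulr //.
by rewrite coprimep_sym.
Qed.

Lemma det_mult_eq0 z : (\det (M z) == 0) = (z == 0).
Proof.
have [-> | z0] := eqVneq z 0; first by rewrite rmorph0 det0 eqxx.
apply: contraTF isT => /eqP Mz; have /eqP : \det (M (z * z^-1)) = 0.
  by rewrite rmorphM det_mulmx Mz mul0r.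
by rewrite divff // rmorph1 det1 oner_eq0.
Qed.

Lemma det_multM z t : \det (M (z * t)) = \det (M z) * \det (M t).
Proof. by rewrite rmorphM det_mulmx. Qed.

Lemma det_multC c : \det (M (j c)) = c ^+ d.+1.
Proof. by rewrite MC det_scalar. Qed.

End MultiplicationMatrix.

Lemma map_XaddC (R S : nzRingType) (f : {rmorphism R -> S}) (b : R) :
  map_poly f ('X + b%:P) = 'X + (f b)%:P.
Proof. by rewrite rmorphD /= map_polyX map_polyC. Qed.

Lemma horner_reverse (F : fieldType) (n : nat) (H : {poly F}) (c t : F) :
  (size H <= n.+1)%N -> t != 0 ->
  (\poly_(i < n.+1) (c * H`_(n - i))).[t] = c * t ^+ n * H.[t^-1].
Proof.
move=> szH t0; rewrite horner_poly (horner_coef_wide _ szH) mulr_sumr.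
rewrite (reindex_inj rev_ord_inj) /=; apply: eq_bigr => i _.
have le_in : (i <= n)%N by rewrite -ltnS.
rewrite subSS subKn // exprVn -!mulrA; congr (_ * _).
by rewrite mulrCA -expfB_cond ?(negPf t0) //.
Qed.

Section UniqueExtension.
Variables (K : fieldType) (v : discrete_valuation K) (k : closedFieldType) (r : K -> k).
Hypotheses (hens : henselian v) (res : is_residue_map v r).
Variable rho : {rmorphism int_elt v -> k}.
Hypothesis rhoE : forall a, rho a = r (val a).

(** [K] is infinite, the powers of an element of valuation 1 being distinct. Leaving out 0 allows
    identities that involve [t^-1]. *)
Lemma poly_eq_off0 (p q : {poly K}) : (forall t, t != 0 -> p.[t] = q.[t]) -> p = q.
Proof.
move=> eq_pq; apply/eqP; rewrite -subr_eq0; apply/negPn/negP => pq0.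
have [pi pi0 vpi] := dval_onto v 1.
pose rs := [seq pi ^+ i | i <- seq.iota 0 (size (p - q))].
have := max_poly_roots (rs := rs) pq0; rewrite size_map size_iota ltnn => rsP.
suff: false by []; apply: rsP.
  by apply/allP => _ /mapP[i _ ->]; rewrite rootE hornerD hornerN eq_pq ?subrr // expf_neq0.
rewrite map_inj_uniq ?iota_uniq // => i l /(congr1 v).
by rewrite !dvalX // vpi !natz => -[].
Qed.

Lemma lift_int_poly (p : {poly K}) : (forall i, val_ring v p`_i) ->
  exists P : {poly int_elt v}, map_poly val P = p.
Proof.
move=> intp; exists (\poly_(i < size p) IntElt (intp i)).
apply/polyP=> i; rewrite coef_map coef_poly; case: ltnP => //= le_i.
by rewrite nth_default.
Qed.

(** Lifting splits off a coprime factor whose degree is the multiplicity of a root [alpha] of the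
    reduction; it is not constant, so the other factor is, and [alpha] is the only root. *)
Lemma integral_primary_residue (G : {poly int_elt v}) : G \is monic ->
    (forall g1 g2, map_poly val G = g1 * g2 -> coprimep g1 g2 ->
       (size g1 <= 1)%N \/ (size g2 <= 1)%N) ->
  exists alpha, map_poly rho G = ('X - alpha%:P) ^+ (size G).-1.
Proof.
move=> mon_G G_prim.
have G1 : rho (lead_coef G) != 0 by rewrite (monicP mon_G) rmorph1 oner_neq0.
have szG := size_map_poly_id0 G1.
have [[|alpha rs] Drs] := closed_splits (monic_map rho mon_G).
  by exists 0; rewrite -szG Drs big_nil size_poly1 expr0.
have [g1 [g2 [Dg cop szg1]]] := hensel_factor val_inj (residue_surj res rhoE)
  (residue_simple_root_lift hens res rhoE) alpha mon_G Drs.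
exists alpha; have szG2 : size G = (size rs).+2.
  by rewrite -szG Drs size_prod_XsubC.
have [|szg2] := G_prim _ _ Dg cop; first by rewrite szg1 /= eqxx.
have cnt : count_mem alpha (alpha :: rs) = (size rs).+1.
  apply/eqP; rewrite -eqSS -szg1 -szG2 -(size_map_inj_poly val_inj) ?rmorph0 // Dg.
  have g20 : g2 != 0.
    apply: contraTneq (monic_map val mon_G) => g20.
    by rewrite Dg g20 mulr0 monicE lead_coef0 eq_sym oner_eq0.
  by rewrite (size1_polyC szg2) mulrC mul_polyC size_scale // -polyC_eq0 -size1_polyC.
rewrite Drs szG2 /=; have /all_pred1P -> : all (pred1 alpha) (alpha :: rs).
  by rewrite all_count cnt.
by rewrite big_nseq iter_mulr_1.
Qed.

Section Extension.
Variables (kappa : fieldType) (j : {rmorphism K -> kappa}) (d : nat).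
Variable M : {rmorphism kappa -> 'M[K]_d.+1}.
Hypothesis MC : forall c, M (j c) = c%:M.

Lemma det_multV z : \det (M z^-1) = (\det (M z))^-1.
Proof.
have [->|z0] := eqVneq z 0; first by rewrite invr0 rmorph0 det0 invr0.
have dz : \det (M z) != 0 by rewrite det_mult_eq0.
by apply: (mulfI dz); rewrite -det_multM !divff // rmorph1 det1.
Qed.

(** Take determinants in t - 1/(z - beta) = t (z - beta)^-1 (z - beta - 1/t). The roots undergo x ->
    1/(x - beta), so the coefficients of the shifted polynomial appear in reverse order. *)
Lemma char_poly_mult_inv z beta : (char_poly (M z)).[beta] != 0 ->
  char_poly (M (z - j beta)^-1) =
  \poly_(i < d.+2) ((char_poly (M z)).[beta]^-1 *
                    (char_poly (M z) \Po ('X + beta%:P))`_(d.+1 - i)).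
Proof.
set chi := char_poly (M z) => chib.
have zb : z - j beta != 0.
  by rewrite -oppr_eq0 opprB -(det_mult_eq0 M) -(char_poly_mult_horner MC).
apply: poly_eq_off0 => t t0; rewrite horner_reverse //; last first.
  by rewrite size_comp_poly2 ?size_XaddC // size_char_poly.
have chiE c : chi.[c] = (-1) ^+ d.+1 * \det (M (z - j c)).
  by rewrite (char_poly_mult_horner MC) -opprB rmorphN -scaleN1r detZ.
rewrite horner_comp !hornerE (char_poly_mult_horner MC).
have -> : j t - (z - j beta)^-1 = j t * (z - j beta)^-1 * (z - j (t^-1 + beta)).
  rewrite rmorphD fmorphV; field; rewrite zb andbT.
  by rewrite fmorph_eq0.
rewrite !det_multM (det_multC MC) !chiE det_multV.
have dzb : \det (M (z - j beta)) != 0 by rewrite det_mult_eq0.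
by field; rewrite dzb signr_eq0.
Qed.

(* If chi is not integral, a multiple P of chi with integral coefficients and nonzero
   reduction loses its degree in k and vanishes there at 0.  With P(beta) a unit,
   the characteristic polynomial of (z - beta)^-1 is integral, so that its reduction
   is a power of X - alpha; the first property gives alpha = 0, whereas -1/beta is a
   root by the second one. *)
Lemma char_poly_mult_integral z :
  val_ring v (\det (M z)) -> forall i, val_ring v (char_poly (M z))`_i.
Proof.
set chi := char_poly (M z) => intN i0.
have chi_mon : chi \is monic by apply: char_poly_monic.
have szchi : size chi = d.+2 by apply: size_char_poly.
have chi_top : chi`_d.+1 = 1 by move/monicP: chi_mon; rewrite lead_coefE szchi.
apply/negPn/negP => nint.
have nz0 : chi`_i0 != 0 by apply: contraNneq nint => ->; rewrite /val_ring eqxx.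
have lt_i0 : (i0 < d.+2)%N.
  by rewrite ltnNge -szchi; apply: contra nz0 => /leq_sizeP->.
have vi0 : v chi`_i0 < 0 by move: nint; rewrite /val_ring (negPf nz0) /= -ltNge.
(* A coefficient of least valuation: division by it makes all coefficients integral and one of them
   1. *)
pose i1 := [arg min_(i < Ordinal lt_i0 | chi`_i != 0) v chi`_i]%O.
have [nz1 min1] : chi`_i1 != 0 /\ forall i, chi`_i != 0 -> v chi`_i1 <= v chi`_i.
  rewrite /i1; case: Order.TotalTheory.arg_minP => //= i nzi mini.
  split=> // l nzl; have lt_l : (l < d.+2)%N.
    by rewrite ltnNge -szchi; apply: contra nzl => /leq_sizeP->.
  exact: (mini (Ordinal lt_l)).
have v1 : v chi`_i1 < 0 by apply: le_lt_trans vi0; apply: min1.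
pose c := (chi`_i1)^-1; have c0 : c != 0 by rewrite invr_eq0.
have vc : 0 < v c by rewrite dvalV // oppr_gt0.
have intP i : val_ring v (c *: chi)`_i.
  rewrite coefZ /val_ring mulf_eq0 (negPf c0) /=; case: eqVneq => //= nzi.
  by rewrite dvalM // dvalV // addrC subr_ge0 min1.
have [P DP] := lift_int_poly intP.
have r0 := residue_eq0 res rhoE.
have valP_ i : val P`_i = c * chi`_i by rewrite -coefZ -DP coef_map.
have rPtop : rho P`_d.+1 = 0.
  by apply/eqP; rewrite r0 valP_ chi_top mulr1 /val_max vc orbT.
have rP0 : rho P`_0 = 0.
  apply/eqP; rewrite r0 valP_ char_poly_det /val_max mulf_eq0 (negPf c0) mulf_eq0.
  rewrite signr_eq0 /=; move: intN; rewrite /val_ring.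
  case: eqVneq => //= N0 vN.
  rewrite !dvalM ?mulf_neq0 ?signr_eq0 // dvalX ?oppr_eq0 ?oner_eq0 //.
  by rewrite dvalN dval1 mul0rn add0r ltr_wpDr.
have rP1 : rho P`_i1 = 1.
  by rewrite -[RHS](rmorph1 rho); congr (rho _); apply: val_inj; rewrite valP_ mulVf ?rmorph1.
have Pb_root0 : root (map_poly rho P) 0.
  by rewrite rootE -[X in _.[X]](rmorph0 rho) horner_map horner_coef0 rP0.
(* The reduction has the root 0 and a coefficient 1, so it is not constant; at a root of the
   reduction plus 1, which exists in the algebraically closed [k], its value is -1. *)
have [betab Pbeta] : exists beta, (map_poly rho P).[beta] != 0.
  have szPb : (1 < size (map_poly rho P))%N.
    apply: root_size_gt1 Pb_root0; apply/eqP => /(congr1 (fun p : {poly k} => p`_i1)).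
    by rewrite coef_map /= rP1 coef0 => /eqP; rewrite oner_eq0.
  have /closed_rootP[b] : size (map_poly rho P + 1) != 1%N.
    by rewrite size_addl ?size_poly1 // gtn_eqF.
  rewrite rootE !hornerE addr_eq0 => /eqP Pb; exists b.
  by rewrite Pb oppr_eq0 oner_eq0.
have [beta Dbeta] := residue_surj res rhoE betab; rewrite -Dbeta in Pbeta.
have beta0 : rho beta != 0 by apply: contraNneq Pbeta => ->.
have uP : ~~ val_max v (val P.[beta]) by rewrite -r0 -horner_map.
have nzP : val P.[beta] != 0 by apply: contraNneq uP => ->; rewrite /val_max eqxx.
have uinvP : (val P.[beta])^-1 \in val_ring v.
  rewrite unfold_in /val_ring invr_eq0 (negPf nzP) dvalV // oppr_ge0 leNgt.
  by move: uP; rewrite /val_max (negPf nzP).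
pose u := IntElt uinvP; pose H := P \Po ('X + beta%:P).
have Pchi : val P.[beta] = c * chi.[val beta] by rewrite -horner_map DP hornerZ.
have chib : chi.[val beta] != 0.
  by apply: contraNneq nzP => chib; rewrite Pchi chib mulr0.
have DH : map_poly val H = c *: (chi \Po ('X + (val beta)%:P)).
  by rewrite /H map_comp_poly DP comp_polyZ map_XaddC.
have szH : (size H <= d.+2)%N.
  rewrite -(size_map_inj_poly val_inj) ?rmorph0 // DH size_scale //.
  by rewrite size_comp_poly2 ?size_XaddC ?szchi.
pose G : {poly int_elt v} := \poly_(i < d.+2) (u * H`_(d.+1 - i)).
have DG : map_poly val G = char_poly (M (z - j (val beta))^-1).
  rewrite char_poly_mult_inv //; apply/polyP=> i; rewrite coef_map !coef_poly -/chi.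
  case: ifP => // _; rewrite -[LHS]/(val u * val H`_(d.+1 - i)).
  rewrite -[val H`__]coef_map DH coefZ /= -[P]/P Pchi invfM.
  by rewrite mulrACA mulVf // mul1r.
have mon_G : G \is monic.
  rewrite monicE -(inj_eq val_inj) rmorph1 -lead_coef_map_inj ?rmorph0 //; last exact: val_inj.
  by rewrite DG -monicE char_poly_monic.
have szG : size G = d.+2.
  by rewrite -(size_map_inj_poly val_inj) ?rmorph0 // DG size_char_poly.
have [|alpha Dalpha] := @integral_primary_residue G mon_G.
  by rewrite DG; apply: char_poly_mult_primary.
rewrite szG /= in Dalpha.
have DrG : map_poly rho G = \poly_(i < d.+2) (rho u * (map_poly rho H)`_(d.+1 - i)).
  apply/polyP=> i; rewrite coef_map [G`_i]coef_poly [RHS]coef_poly coef_map.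
  by case: ifP => _; [apply: rmorphM | apply: rmorph0].
have DrH : map_poly rho H = map_poly rho P \Po ('X + (rho beta)%:P).
  by rewrite /H map_comp_poly map_XaddC.
have szrP : (size (map_poly rho P) <= d.+1)%N.
  apply/leq_sizeP => i; rewrite coef_map leq_eqVlt => /predU1P[<- //|lt_i].
  have szP : size P = d.+2.
    by rewrite -(size_map_inj_poly val_inj (rmorph0 _)) DP size_scale.
  by rewrite [P`_i]nth_default ?szP //; apply: rmorph0.
have alpha0 : alpha = 0.
  have := congr1 (horner^~ 0) Dalpha; rewrite /= horner_exp hornerXsubC sub0r horner_coef0.
  rewrite DrG coef_poly subn0 DrH [X in _ * X]nth_default ?size_comp_poly2 ?size_XaddC //.
  by rewrite mulr0 => /esym/eqP; rewrite expf_eq0 oppr_eq0 => /andP[_ /eqP].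
have := congr1 (horner^~ (- (rho beta)^-1)) Dalpha.
rewrite /= DrG horner_reverse ?oppr_eq0 ?invr_eq0 //; last first.
  by rewrite DrH size_comp_poly2 ?size_XaddC // leqW.
rewrite DrH horner_comp hornerD hornerC hornerX invrN invrK addNr (rootP Pb_root0) mulr0.
rewrite alpha0 horner_exp hornerXsubC subr0 => /esym/eqP.
by rewrite expf_eq0 oppr_eq0 invr_eq0 (negPf beta0) andbF.
Qed.

(** Not divided by the degree: the values stay integral, and ramification becomes divisibility of
    the degree. *)
Definition mult_val z := v (\det (M z)).

Lemma mult_valM a b : a != 0 -> b != 0 -> mult_val (a * b) = mult_val a + mult_val b.
Proof. by move=> a0 b0; rewrite /mult_val det_multM dvalM // det_mult_eq0. Qed.

Lemma mult_valC c : c != 0 -> mult_val (j c) = v c *+ d.+1.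
Proof. by move=> c0; rewrite /mult_val (det_multC MC) dvalX. Qed.

(** After division by the term of smaller value it remains to see that 1 + t has integral norm when
    t has. Up to sign this norm is the characteristic polynomial of t at -1, whose coefficients are
    integral. *)
Lemma mult_valD a b : a != 0 -> b != 0 -> a + b != 0 ->
  Num.min (mult_val a) (mult_val b) <= mult_val (a + b).
Proof.
wlog le_ab : a b / mult_val a <= mult_val b => [hwlog|] a0 b0 ab0.
  case/orP: (le_total (mult_val a) (mult_val b)) => [/hwlog|/hwlog].
    by apply.
  by move=> le_ba; rewrite addrC minC; apply: le_ba; rewrite // addrC.
rewrite (min_l le_ab); pose t := b / a.
have t0 : t != 0 by rewrite mulf_neq0 ?invr_eq0.
have Dab : a + b = a * (1 + t) by rewrite mulrDr mulr1 mulrC divfK.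
have t10 : 1 + t != 0 by apply: contraNneq ab0; rewrite Dab => ->; rewrite mulr0.
have wt : 0 <= mult_val t.
  by rewrite -(lerD2r (mult_val a)) add0r -mult_valM // divfK.
have intt : val_ring v (\det (M t)) by rewrite /val_ring [X in _ || X]wt orbT.
have int1 : (char_poly (M t)).[-1] \in val_ring v.
  rewrite rpred_horner ?rpredN1 //; apply/polyOverP => i.
  exact: char_poly_mult_integral.
rewrite Dab mult_valM // lerDl; move: int1.
rewrite (char_poly_mult_horner MC) rmorphN rmorph1 -opprD rmorphN -scaleN1r detZ.
rewrite unfold_in /val_ring mulf_eq0 signr_eq0 det_mult_eq0 (negPf t10) /=.
rewrite dvalM ?signr_eq0 ?det_mult_eq0 // dvalX ?oppr_eq0 ?oner_eq0 //.
by rewrite dvalN dval1 mul0rn add0r.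
Qed.

End Extension.
End UniqueExtension.

(** * Norms from [kappa[X]] to [K[X]] *)

Section PolyNorm.
Variables (K kappa : fieldType) (j : {rmorphism K -> kappa}) (d : nat).
Variable M : {rmorphism kappa -> 'M[K]_d.+1}.
Hypothesis MC : forall c, M (j c) = c%:M.

Fact poly_mult_comm : commr_rmorph (map_mx polyC \o M) ('X%:M : 'M[{poly K}]_d.+1).
Proof. by move=> z; apply: comm_scalar_mx. Qed.

Definition poly_mult : {rmorphism {poly kappa} -> 'M[{poly K}]_d.+1} :=
  horner_morph poly_mult_comm.

Definition poly_norm (g : {poly kappa}) : {poly K} := \det (poly_mult g).

Lemma poly_normM g h : poly_norm (g * h) = poly_norm g * poly_norm h.
Proof. by rewrite /poly_norm rmorphM det_mulmx. Qed.

Lemma poly_norm_dvd g h : g %| h -> poly_norm g %| poly_norm h.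
Proof. by case/dvdpP=> h' ->; rewrite poly_normM dvdp_mull. Qed.

Lemma poly_norm_map (P : {poly K}) : poly_norm (map_poly j P) = P ^+ d.+1.
Proof.
rewrite /poly_norm -(det_scalar d.+1); congr (\det _).
rewrite /poly_mult /= /horner_morph -map_poly_comp.
have -> : map_poly ((map_mx polyC \o M) \o j) P = map_poly (@scalar_mx _ d.+1) (map_poly polyC P).
  rewrite -map_poly_comp; apply: eq_map_poly => c /=; rewrite MC.
  by rewrite map_scalar_mx.
by rewrite horner_map /= -/(comp_poly _ _) comp_polyXr.
Qed.

Lemma poly_norm_Xn_sub q a : poly_norm ('X^q - a%:P) = char_poly (M a) \Po 'X^q.
Proof.
rewrite /char_poly -[RHS]/(comp_poly 'X^q _) -det_map_mx /poly_norm; congr (\det _).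
rewrite rmorphB rmorphXn /= /poly_mult horner_morphX horner_morphC /=.
apply/matrixP=> i l; rewrite -rmorphXn !mxE /= rmorphB rmorphMn /=.
by rewrite comp_polyX comp_polyC.
Qed.

Lemma size_poly_norm g : (size (poly_norm g) <= (size g).-1 * d.+1 + 1)%N.
Proof.
have szE i l : (size (poly_mult g i l) <= (size g).-1.+1)%N.
  rewrite /poly_mult /= /horner_morph horner_coef summxE.
  apply: (leq_trans (size_sum _ _ _)); apply/bigmax_leqP => t _.
  rewrite coef_map -rmorphXn /= -mulmxE mul_mx_scalar !mxE mulrC mul_polyC.
  apply: leq_trans (size_scale_leq _ _) _; rewrite size_polyXn.
  have lt_t : (t < size g)%N by apply: leq_trans (ltn_ord t) (size_poly _ _).
  by rewrite prednK // (leq_ltn_trans _ lt_t).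
rewrite /poly_norm /determinant (leq_trans (size_sum _ _ _)) //.
apply/bigmax_leqP => s _; rewrite -signr_odd mulr_sign.
have szP : (size (\prod_i poly_mult g i (s i))%R <= (size g).-1 * d.+1 + 1)%N.
  apply: leq_trans (size_prod_leq _ _) _; rewrite addn1 card_ord.
  rewrite leq_subLR; apply: leq_ltn_trans (_ : \sum_(i < d.+1) (size g).-1.+1 < _)%N.
    exact: leq_sum.
  by rewrite sum_nat_const card_ord mulnC mulSn addnS ltnS.
by case: (odd s); rewrite ?size_opp.
Qed.

(* If G1, G2 are coprime factors of the norm of f, then f itself splits
   accordingly, and degrees are preserved. *)
Lemma poly_norm_root q a (g1 g2 : {poly K}) : (0 < q)%N ->
    char_poly (M a) \Po 'X^q = g1 * g2 -> coprimep g1 g2 -> size g1 = d.+2 ->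
  exists eta, eta ^+ q = a.
Proof.
move=> q_gt0 Dg cop szg1; pose f := 'X^q - a%:P : {poly kappa}.
have szf : size f = q.+1 by rewrite size_XnsubC.
have f0 : f != 0 by rewrite -size_poly_gt0 szf.
have f_dvd : f %| map_poly j g1 * map_poly j g2.
  have : ('X - a%:P) %| map_poly j (char_poly (M a)).
    rewrite dvdp_XsubCl; apply/rootP/(fmorph_inj M); rewrite rmorph0.
    by rewrite -(horner_mx_mult MC) Cayley_Hamilton.
  case/dvdpP=> Q DQ; rewrite -rmorphM -Dg /= map_comp_poly DQ comp_polyM map_polyXn.
  by rewrite rmorphB /= comp_polyX comp_polyC dvdp_mull.
pose h1 := gcdp f (map_poly j g1); pose h2 := f %/ h1.
have Df : f = h2 * h1 by rewrite /h2 divpK // dvdp_gcdl.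
have h2_dvd : h2 %| map_poly j g2.
  have h10 : h1 != 0 by rewrite gcdp_eq0 negb_and f0.
  have cop2 : coprimep h2 (map_poly j g1 %/ h1).
    by apply: coprimep_div_gcd; rewrite f0.
  rewrite -(Gauss_dvdpr _ cop2) -(dvdp_mul2r _ _ h10) -Df mulrAC divpK //.
  exact: dvdp_gcdr.
have Nf : poly_norm h2 * poly_norm h1 = g1 * g2.
  by rewrite -poly_normM -Df poly_norm_Xn_sub.
have Nh1 : poly_norm h1 %| g1 ^+ d.+1.
  by rewrite -poly_norm_map poly_norm_dvd // dvdp_gcdr.
have Nh2 : poly_norm h2 %| g2 ^+ d.+1 by rewrite -poly_norm_map poly_norm_dvd.
have G0 : g1 * g2 != 0.
  by rewrite -Dg comp_poly_eq0 ?size_polyXn // -size_poly_eq0 size_char_poly.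
have szG : size (g1 * g2) = (q * d.+1).+1.
  rewrite -[LHS]prednK ?size_poly_gt0 // -Dg size_comp_poly size_char_poly.
  by rewrite size_polyXn mulnC.
have [g10 g20] : g1 != 0 /\ g2 != 0 by apply/andP; rewrite -negb_or -mulf_eq0.
have szg2 : size g2 = ((q.-1) * d.+1).+1.
  move: szG; rewrite size_mul // szg1 -{1}(prednK q_gt0) mulSn addSn /= -addnS.
  by move/addnI.
have [Nh10 Nh20] : poly_norm h1 != 0 /\ poly_norm h2 != 0.
  by move: G0; rewrite -Nf mulf_eq0 negb_or => /andP[].
(* Degree count: [g1], of degree d + 1, divides the norm of [h1], and [g2], of degree (q - 1)(d +
   1), divides that of [h2]. So [h1] has degree at least 1 and [h2] at least q - 1; hence [h1] is
   linear, and its root is the required one. *)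
have le1 : (1 < size h1)%N.
  have : g1 %| poly_norm h1.
    have cop1 : coprimep g1 (poly_norm h2).
      by rewrite (coprimep_dvdl Nh2) // coprimep_expr.
    by rewrite -(Gauss_dvdpr _ cop1) Nf dvdp_mulr.
  move/(dvdp_leq Nh10); rewrite szg1 => /leq_trans/(_ (size_poly_norm h1)).
  by case: (size h1) => [|[]] //=; rewrite mul0n.
have le2 : (q <= size h2)%N.
  have : g2 %| poly_norm h2.
    have cop2 : coprimep g2 (poly_norm h1).
      by rewrite (coprimep_dvdl Nh1) // coprimep_expr // coprimep_sym.
    by rewrite -(Gauss_dvdpl _ cop2) Nf dvdp_mull.
  move/(dvdp_leq Nh20); rewrite szg2 => /leq_trans/(_ (size_poly_norm h2)).
  rewrite addn1 ltnS leq_pmul2r // -ltnS prednK //.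
  move/leq_trans; apply; rewrite prednK // size_poly_gt0.
  by apply: contraNneq f0 => h20; rewrite Df h20 mul0r.
have h10 : h1 != 0 by rewrite -size_poly_gt0 ltnW.
have h20 : h2 != 0 by rewrite -size_poly_gt0 (leq_trans q_gt0).
have szh1 : size h1 = 2%N.
  apply/eqP; rewrite eqn_leq le1 andbT -(leq_add2l q).
  have := szf; rewrite {1}Df size_mul // => /eqP; rewrite -eqSS prednK; last first.
    by rewrite addn_gt0 (leq_trans q_gt0).
  by move/eqP; rewrite addn2 => <-; rewrite leq_add2r.
have [eta h1eta] : {eta | root h1 eta} by apply/poly2_root/eqP; rewrite szh1.
exists eta; have : root f eta by apply: root_dvdp h1eta; apply: dvdp_gcdl.
by rewrite rootE !hornerE subr_eq0 => /eqP.
Qed.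

End PolyNorm.

Lemma map_val_monic (K : fieldType) (v : discrete_valuation K) (P : {poly int_elt v}) :
  (map_poly val P \is monic) = (P \is monic).
Proof.
by rewrite !monicE (lead_coef_map_inj val_inj) ?rmorph0.
Qed.

Lemma map_Xn_sub1 (R S : nzRingType) (f : {rmorphism R -> S}) (q : nat) :
  map_poly f ('X^q - 1) = 'X^q - 1.
Proof. by rewrite rmorphB rmorphXn rmorph1 /= map_polyX. Qed.

(** * Roots of 1-units *)

Section OneUnits.
Variables (K : fieldType) (v : discrete_valuation K) (k : closedFieldType) (r : K -> k).
Hypotheses (hens : henselian v) (res : is_residue_map v r).
Variable rho : {rmorphism int_elt v -> k}.
Hypothesis rhoE : forall a, rho a = r (val a).
Variables (kappa : fieldType) (j : {rmorphism K -> kappa}) (d : nat).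
Variable M : {rmorphism kappa -> 'M[K]_d.+1}.
Hypothesis MC : forall c, M (j c) = c%:M.

(* The norm of X^q - a reduces to (X^q - 1)^(d + 1), in which the root 1 can be
   split off. *)
Lemma one_unit_root q a : (0 < q)%N -> q%:R != 0 :> k ->
  val_max v (\det (M (a - 1))) -> exists eta, eta ^+ q = a.
Proof.
move=> q_gt0 q_nz max1.
have int1 : val_ring v (\det (M (a - 1))).
  by move: max1; rewrite /val_max /val_ring => /orP[->|/ltW->]; rewrite ?orbT.
have [P DP] := lift_int_poly (char_poly_mult_integral hens res rhoE MC int1).
have mon_P : P \is monic.
  by rewrite -map_val_monic DP char_poly_monic.
have szP : size P = d.+2.
  by rewrite -(size_map_inj_poly val_inj (rmorph0 _)) DP size_char_poly.
have [|alpha Dalpha] := @integral_primary_residue _ _ _ _ hens res _ rhoE P mon_P.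
  by rewrite DP; apply: char_poly_mult_primary.
rewrite szP /= in Dalpha.
have alpha0 : alpha = 0.
  have : rho P`_0 = 0.
    apply/eqP; rewrite (residue_eq0 res rhoE) -coef_map DP char_poly_det.
    move: max1; rewrite /val_max mulf_eq0 signr_eq0 /=; case: eqVneq => //= N0.
    by rewrite dvalM ?signr_eq0 // dvalX ?oppr_eq0 ?oner_eq0 // dvalN dval1 mul0rn add0r.
  rewrite -coef_map Dalpha -horner_coef0 horner_exp hornerXsubC sub0r => /eqP.
  by rewrite expf_eq0 oppr_eq0 => /andP[_ /eqP].
(* The norm of X^q - a, written through the characteristic polynomial of a - 1, which is integral
   with reduction X^(d + 1). *)
pose G := P \Po ('X^q - 1).
have DG : map_poly val G = char_poly (M a) \Po 'X^q.
  rewrite /G map_comp_poly DP map_Xn_sub1.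
  have -> : char_poly (M a) = char_poly (M (a - 1)) \Po ('X - 1).
    apply: (poly_eq_off0 v) => t _; rewrite horner_comp !(char_poly_mult_horner MC).
    by rewrite !hornerE (rmorphB j) rmorph1 opprB addrA subrK.
  by rewrite -comp_polyA comp_polyB comp_polyX -[1]/(1%:P) comp_polyC.
have Xq1 : map_poly rho G = ('X^q - 1) ^+ d.+1.
  by rewrite /G map_comp_poly Dalpha alpha0 subr0 comp_Xn_poly map_Xn_sub1.
have mon_Xq1 : ('X^q - 1 : {poly k}) \is monic by apply: monicXnsubC.
have [S DS] : exists S : {poly k}, 'X^q - 1 = S * ('X - 1%:P).
  by apply/factor_theorem; rewrite rootE !hornerE expr1n subrr.
have S1 : ~~ root S 1.
  rewrite rootE; have := congr1 (fun p => p^`().[1]) DS.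
  rewrite derivB derivXn derivM derivXsubC -[1]/(1%:P) derivC subr0.
  by rewrite !hornerE hornerMn hornerXn expr1n subrr mulr0 add0r => <-.
have mon_S : S \is monic by rewrite -(monicMr S (monicXsubC 1)) -DS.
have [rs Drs] := closed_splits (monic_exp d.+1 mon_S).
have DrG : map_poly rho G = \prod_(x <- nseq d.+1 1 ++ rs) ('X - x%:P).
  by rewrite Xq1 DS exprMn big_cat big_nseq iter_mulr_1 -Drs mulrC.
have mon_G : G \is monic.
  rewrite -map_val_monic DG monicE lead_coef_comp ?size_polyXn // lead_coefXn expr1n mulr1.
  by rewrite -monicE char_poly_monic.
have [g1 [g2 [Dg cop szg1]]] := hensel_factor val_inj (residue_surj res rhoE)
  (residue_simple_root_lift hens res rhoE) 1 mon_G DrG.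
apply: (poly_norm_root MC q_gt0 _ cop); first by rewrite -DG.
rewrite szg1 count_cat count_nseq /= eqxx mul1n (count_memPn _) ?addn0 //.
rewrite -root_prod_XsubC -Drs; apply: contra S1.
by rewrite /root horner_exp expf_eq0.
Qed.

End OneUnits.

(** All valuation-theoretic arguments about points go through these four properties. The case
    [a = 1] is listed apart because [w 0] carries no meaning. *)
Lemma henselian_extension (K : fieldType) (v : discrete_valuation K)
    (k : closedFieldType) (r : K -> k) (kappa : fieldType) (j : {rmorphism K -> kappa}) (d : nat) :
  henselian v -> is_residue_map v r -> ext_degree j d ->
  exists w : kappa -> int,
  [/\ forall a b, a != 0 -> b != 0 -> w (a * b) = w a + w b,
      forall a b, a != 0 -> b != 0 -> a + b != 0 -> Num.min (w a) (w b) <= w (a + b),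
      forall c, c != 0 -> w (j c) = v c *+ d
    & forall q a, (0 < q)%N -> q%:R != 0 :> k -> a = 1 \/ 0 < w (a - 1) ->
        exists eta, eta ^+ q = a].
Proof.
move=> hens res /ext_degree_mx[d' [M [-> MC]]].
have [rho rhoE] := residue_morphism res.
exists (mult_val v M); split=> [a b|a b|c|q a q_gt0 q_nz wa].
- exact: mult_valM.
- exact: (mult_valD hens res rhoE MC).
- exact: mult_valC.
apply: (one_unit_root hens res rhoE MC) => //; rewrite /val_max.
by case: wa => [->|wa]; [rewrite subrr rmorph0 det0 eqxx | rewrite [X in _ || X]wa orbT].
Qed.

(** * Degrees of points of the curve *)

Lemma ext_degree_adjoin (F L : fieldType) (i : {rmorphism F -> L}) (p : {poly F}) (z : L) :
    irreducible_poly p -> root (map_poly i p) z ->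
    (forall w, exists P : {poly F}, w = (map_poly i P).[z]) ->
  ext_degree i (size p).-1.
Proof.
move=> irr_p pz0 gen; exists (fun t => z ^+ t) => w.
have p0 : p != 0 by rewrite -size_poly_gt0 ltnW //; case: irr_p.
have szp : size p = (size p).-1.+1 by rewrite prednK // size_poly_gt0.
have evalE (P : {poly F}) : (size P <= (size p).-1)%N ->
    (map_poly i P).[z] = \sum_(t < (size p).-1) i P`_t * z ^+ t.
  move=> szP; rewrite (@horner_coef_wide _ (size p).-1) ?size_map_poly //.
  by apply: eq_bigr => t _; rewrite coef_map.
have [P Dw] := gen w; exists [ffun t : 'I_(size p).-1 => (P %% p)`_t]; split.
  under eq_bigr => t _ do rewrite ffunE; rewrite -evalE; last first.
    by rewrite -ltnS -szp ltn_modp.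
  by rewrite Dw {1}(divp_eq P p) rmorphD rmorphM hornerD hornerM (rootP pz0) mulr0 add0r.
move=> c Dc; apply/ffunP=> t; rewrite ffunE.
pose Q := P %% p - \poly_(t < (size p).-1) (if insub t is Some u then c u else 0).
have szQ : (size Q <= (size p).-1)%N.
  rewrite (leq_trans (size_polyD _ _)) // size_polyN geq_max size_poly andbT.
  by rewrite -ltnS -szp ltn_modp.
have Qz : root (map_poly i Q) z.
  rewrite rootE evalE // /Q.
  under eq_bigr => u _.
    by rewrite coefB coef_poly ltn_ord valK rmorphB mulrBl; over.
  rewrite sumrB -Dc -evalE; last by rewrite -ltnS -szp ltn_modp.
  by rewrite Dw {2}(divp_eq P p) rmorphD rmorphM hornerD hornerM (rootP pz0) mulr0 add0r subrr.
have Q0 : Q = 0.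
  apply: contraTeq szQ => Q0; rewrite -ltnNge -szp.
  have [cop | ncop] := boolP (coprimep p Q).
    by have := coprimep_root (etrans (coprimep_map i p Q) cop) pz0; rewrite (rootP Qz) eqxx.
  have : p %| Q.
    have [_ /(_ (gcdp p Q) ncop (dvdp_gcdl p Q)) eq_p] := irr_p.
    by rewrite -(eqp_dvdl _ eq_p) dvdp_gcdr.
  by move/dvdp_leq; apply.
have := congr1 (fun R : {poly F} => R`_t) Q0.
rewrite coefB coef_poly ltn_ord valK coef0 => /eqP.
by rewrite subr_eq0 => /eqP.
Qed.

(** Irreducibility of [g] comes out of the argument: a root of any irreducible factor generates an
    extension of degree at most [d], and this degree is a multiple of [d] by the ramification
    hypothesis. *)
Lemma exists_ext_point (F : fieldType) (g : {poly F}) (d : nat) : size g = d.+1 -> (0 < d)%N ->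
    (forall (kappa : fieldType) (j : {rmorphism F -> kappa}) (e : nat) (x : kappa),
       (0 < e)%N -> ext_degree j e -> root (map_poly j g) x -> (d %| e)%N) ->
  exists (kappa : fieldType) (j : {rmorphism F -> kappa}) (x : kappa),
    [/\ ext_degree j d, root (map_poly j g) x
      & forall z, exists P : {poly F}, z = (map_poly j P).[x]].
Proof.
move=> szg d_gt0 ram.
have [p irr_p pg] : exists2 p, irreducible_poly p & p %| g.
  by apply: irreducible_factor; rewrite szg.
have [L [i [z [pz0 gen]]]] := adjoin_root irr_p.
have gz0 : root (map_poly i g) z by apply: root_dvdp pz0; rewrite dvdp_map.
have ext := ext_degree_adjoin irr_p pz0 gen.
have p_gt1 : (1 < size p)%N by case: irr_p.
have p_gt0 : (0 < (size p).-1)%N by case: (size p) p_gt1 => [|[]].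
exists L, i, z; split=> //; suff -> : d = (size p).-1 by [].
have p_le : ((size p).-1 <= d)%N.
  by rewrite -ltnS -szg prednK ?(ltnW p_gt1) // dvdp_leq // -size_poly_gt0 szg.
by apply/eqP; rewrite eqn_leq p_le dvdn_leq // (ram _ _ _ _ p_gt0 ext gz0).
Qed.

(** * Elementary rules for valuations *)

Section ValuationCalculus.
Variables (kappa : fieldType) (w : kappa -> int).
Hypothesis wM : forall a b, a != 0 -> b != 0 -> w (a * b) = w a + w b.
Hypothesis wD : forall a b, a != 0 -> b != 0 -> a + b != 0 -> Num.min (w a) (w b) <= w (a + b).

Lemma val1 : w 1 = 0.
Proof.
have : w 1 = w 1 + w 1 by rewrite -wM ?oner_neq0 // mulr1.
lia.
Qed.

Lemma valX a n : a != 0 -> w (a ^+ n) = w a * n%:Z.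
Proof.
move=> a0; elim: n => [|n IHn]; first by rewrite val1 mulr0.
by rewrite exprS wM ?expf_neq0 // IHn; lia.
Qed.

Lemma valV a : a != 0 -> w a^-1 = - w a.
Proof.
move=> a0; have : w 1 = w a + w a^-1 by rewrite -wM ?invr_eq0 // divff.
by rewrite val1; lia.
Qed.

Lemma valN a : w (- a) = w a.
Proof.
have [->|a0] := eqVneq a 0; first by rewrite oppr0.
have N1 : (-1 : kappa) != 0 by rewrite oppr_eq0 oner_neq0.
have : w 1 = w (-1) * 2 by rewrite -[2]/(2%N%:Z) -valX // sqrrN expr1n.
by rewrite val1 => wN1; rewrite -mulN1r wM //; lia.
Qed.

Lemma val_lt a b : a != 0 -> (b = 0 \/ w a < w b) -> a + b != 0 /\ w (a + b) = w a.
Proof.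
move=> a0 [->|lt_ab]; first by rewrite addr0.
have [->|b0] := eqVneq b 0; first by rewrite addr0.
have ab0 : a + b != 0.
  by rewrite addr_eq0; apply: contraTneq lt_ab => ->; rewrite valN ltxx.
have : Num.min (w a) (w b) <= w (a + b) by apply: wD.
have : Num.min (w (a + b)) (w b) <= w a.
  by rewrite -[w b]valN -{2}(addrK b a) wD ?oppr_eq0 ?addrK.
by split=> //; lia.
Qed.

Lemma val_prod (I : Type) (s : seq I) (E : I -> kappa) : \prod_(i <- s) E i != 0 ->
  w (\prod_(i <- s) E i) = \sum_(i <- s) w (E i).
Proof.
elim: s => [|i s IHs]; first by rewrite !big_nil val1.
by rewrite !big_cons mulf_eq0 negb_or => /andP[? ?]; rewrite wM // IHs.
Qed.

End ValuationCalculus.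

Definition root_product (F : fieldType) (c : F) (ns : seq nat) : {poly F} :=
  \prod_(n <- ns) ('X^n - c%:P).

Definition curve_poly (F : fieldType) (c : F) (q s : nat) (ns : seq nat) : {poly F} :=
  c%:P * root_product c ns ^+ q + (c ^+ (q * s))%:P.

Lemma horner_curve_poly (F E : fieldType) (j : {rmorphism F -> E}) c q s ns x :
  (map_poly j (curve_poly c q s ns)).[x] =
  j c * (\prod_(n <- ns) (x ^+ n - j c)) ^+ q + j c ^+ (q * s).
Proof.
rewrite /curve_poly rmorphD rmorphM /= rmorphXn /= !map_polyC /= rmorphXn.
rewrite !hornerE rmorph_prod horner_prod; congr (_ * _ ^+ _ + _).
by apply: eq_bigr => n _; rewrite rmorphB /= map_polyXn map_polyC !hornerE.
Qed.

(** * Valuations of coordinates and construction of points *)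

Section CurvePoints.
Variables (K : fieldType) (v : discrete_valuation K) (k : closedFieldType) (r : K -> k).
Hypotheses (hens : henselian v) (res : is_residue_map v r).
Variables (pi : K) (q s : nat) (ns : seq nat).
Hypotheses (pi0 : pi != 0) (vpi : v pi = 1) (q_pr : prime q).
Hypothesis ns_gt0 : forall n, n \in ns -> (0 < n)%N.

Lemma sum_le_size (t : seq nat) (E : nat -> int) (c : int) :
  (forall n, n \in t -> E n <= c) -> \sum_(n <- t) E n <= c * (size t)%:Z.
Proof.
elim: t => [|n t IHt] Ec; first by rewrite big_nil mulr0.
rewrite big_cons /= intS mulrDr mulr1 lerD ?Ec ?mem_head // IHt // => m mt.
by rewrite Ec // inE mt orbT.
Qed.

Lemma dvdn_of_int (m d : nat) (a : int) : a * m%:Z = d%:Z -> (m %| d)%N.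
Proof. by move=> Da; have := dvdz_mull a (dvdzz m%:Z); rewrite Da. Qed.

Lemma infinite_point_degree (kappa : fieldType) (j : {rmorphism K -> kappa}) d z :
  ext_degree j d -> z ^+ q = j pi -> (q %| d)%N.
Proof.
move=> ext Dz; have [w [wM _ wC _]] := henselian_extension hens res ext.
have z0 : z != 0.
  apply: contraNneq pi0 => z0; move/eqP: Dz.
  by rewrite z0 expr0n gtn_eqF ?prime_gt0 // eq_sym fmorph_eq0.
have := wC _ pi0; rewrite -Dz (valX wM) // vpi => Dw.
by apply: (@dvdn_of_int _ _ (w z)); rewrite Dw natz.
Qed.

Lemma affine_point_degree (kappa : fieldType) (j : {rmorphism K -> kappa}) d x y :
    (size ns < s)%N -> ext_degree j d ->
    y ^+ q = (map_poly j (curve_poly pi q s ns)).[x] ->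
  (q %| d)%N \/ exists2 n, n \in ns & (n %| d)%N.
Proof.
move=> lt_s ext; rewrite horner_curve_poly; set f := \prod_(n <- ns) _ => Dy.
have [w [wM wD wC _]] := henselian_extension hens res ext.
have jpi0 : j pi != 0 by rewrite fmorph_eq0.
have wpi : w (j pi) = d%:Z by rewrite wC // vpi natz.
have q_gt0 := prime_gt0 q_pr.
have close n : n \in ns -> x ^+ n = j pi \/ d%:Z < w (x ^+ n - j pi) -> (n %| d)%N.
  move=> /ns_gt0 n_gt0 cl; have x0 : x != 0.
    apply: contra_not_neq (negP jpi0) => x0; move: cl.
    rewrite x0 expr0n gtn_eqF // sub0r (valN wM) wpi ltxx.
    by case=> // <-; rewrite eqxx.
  apply: (@dvdn_of_int _ _ (w x)); rewrite -(valX wM) // -wpi.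
  case: cl => [-> // | lt_w]; rewrite -{1}(subrK (j pi) (x ^+ n)) addrC.
  by have [|_ ->] := @val_lt _ w wM wD (j pi) (x ^+ n - j pi) jpi0; [right; rewrite wpi|].
have [nqd | ] := boolP (q %| d)%N; [by left | move=> nqd; right].
have [f0 | f0] := eqVneq f 0.
  have /eqP := f0; rewrite /f prodf_seq_eq0 => /hasP[n nns] /=.
  by rewrite subr_eq0 => /eqP xn; exists n => //; apply: close => //; left.
have wA : w (j pi * f ^+ q) = d%:Z + w f * q%:Z.
  by rewrite wM ?expf_neq0 // (valX wM) // wpi.
have wB : w (j pi ^+ (q * s)) = d%:Z * (q * s)%:Z by rewrite (valX wM) // wpi.
(* Otherwise q divides d: equal values give d = q (d s - w(f)), and if the first term dominates then
   q w(y) = d + q w(f). *)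
have lt_wf : d%:Z * (q * s)%:Z < d%:Z + w f * q%:Z.
  rewrite ltNge le_eqVlt; apply/negP => /predU1P[eqAB | ltAB]; case/negP: nqd.
    by apply: (@dvdn_of_int _ _ (d%:Z * s%:Z - w f)); lia.
  have [||y0 wy] := @val_lt _ w wM wD (j pi * f ^+ q) (j pi ^+ (q * s)).
  - by rewrite mulf_neq0 ?expf_neq0.
  - by right; rewrite wA wB.
  move: y0 wy; rewrite -Dy wA => yq0; rewrite (valX wM); last first.
    by apply: contraNneq yq0 => ->; rewrite expr0n gtn_eqF.
  by move=> wy; apply: (@dvdn_of_int _ _ (w y - w f)); lia.
have d_gt0 : (0 < d)%N by case: (d) nqd => //; rewrite dvdn0.
apply: NNPP => nex.
have : w f <= d%:Z * (size ns)%:Z.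
  rewrite /f (val_prod wM) //; apply: sum_le_size => n nns; rewrite leNgt.
  by apply/negP => lt_w; apply: nex; exists n => //; apply: close => //; right.
move=> le_wf.
(* Here the size of [s] enters: w(f) <= d (s - 1) gives d + q w(f) <= d q s - d (q - 1), against
   [lt_wf]. *)
have h1 : 0 <= (d%:Z * (size ns)%:Z - w f) * q%:Z by rewrite mulr_ge0 // subr_ge0.
have h2 : 0 <= d%:Z * q%:Z * (s%:Z - (size ns)%:Z - 1) by rewrite !mulr_ge0 //; lia.
have h3 : 0 <= d%:Z * (q%:Z - 1) by rewrite mulr_ge0 //; lia.
lia.
Qed.

Hypotheses (q_nz : q%:R != 0 :> k) (s_gt0 : (0 < s)%N).

Definition has_curve_point (d : nat) : Prop :=
  exists (kappa : fieldType) (j : {rmorphism K -> kappa}) (x y : kappa),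
    [/\ ext_degree j d, y ^+ q = (map_poly j (curve_poly pi q s ns)).[x]
      & forall z, exists P : {poly K}, z = (map_poly j P).[x]].

(** A root x of X^(q m) - 1/pi has value -1, so each x^n - pi has the value -n of its first term;
    this is the reason for 1/pi instead of pi. Moreover pi is the q-th power of x^(-m). *)
Lemma curve_point_multiple_q m : (0 < m)%N -> has_curve_point (q * m).
Proof.
move=> m_gt0; have q_gt0 := prime_gt0 q_pr.
have d_gt0 : (0 < q * m)%N by rewrite muln_gt0 q_gt0.
have root_w (kappa : fieldType) (j : {rmorphism K -> kappa}) e x w :
    (forall a b, a != 0 -> b != 0 -> w (a * b) = w a + w b) ->
    (forall c, c != 0 -> w (j c) = v c *+ e) ->
    root (map_poly j ('X^(q * m) - (pi^-1)%:P)) x ->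
    [/\ x ^+ (q * m) = (j pi)^-1, x != 0 & w x * (q * m)%:Z = - e%:Z].
  move=> wM wC; rewrite rmorphB /= map_polyXn map_polyC /= rootE !hornerE.
  rewrite subr_eq0 fmorphV => /eqP Dx; have x0 : x != 0.
    apply: contraTneq isT => x0; move/eqP: Dx; rewrite x0 expr0n gtn_eqF //.
    by rewrite eq_sym invr_eq0 fmorph_eq0 (negPf pi0).
  split=> //; rewrite -(valX wM) // Dx (valV wM) ?fmorph_eq0 // wC // vpi.
  by rewrite natz.
have [|||kappa [j [x [ext gx gen]]]] := @exists_ext_point K ('X^(q * m) - (pi^-1)%:P) (q * m).
- by rewrite size_XnsubC.
- by [].
- move=> kappa j e x _ ext; have [w [wM _ wC _]] := henselian_extension hens res ext.
  move/(root_w _ _ _ _ _ wM wC) => [_ _ Dw].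
  by apply: (@dvdn_of_int _ _ (- w x)); lia.
have [w [wM wD wC wR]] := henselian_extension hens res ext.
have [Dx x0 wx] := root_w _ _ _ _ _ wM wC gx.
have jpi0 : j pi != 0 by rewrite fmorph_eq0.
have wpi : w (j pi) = (q * m)%:Z by rewrite wC // vpi natz.
have wx1 : w x = -1 by nia.
pose f := \prod_(n <- ns) (x ^+ n - j pi).
have wf n : n \in ns -> x ^+ n - j pi != 0 /\ w (x ^+ n - j pi) <= 0.
  move=> /ns_gt0 n_gt0; have [||nz ->] := @val_lt _ w wM wD (x ^+ n) (- j pi).
  - by rewrite expf_neq0.
  - by right; rewrite (valN wM) wpi (valX wM) // wx1; lia.
  by split=> //; rewrite (valX wM) // wx1; lia.
have f0 : f != 0.
  rewrite prodf_seq_neq0; apply/allP => n nns /=.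
  by have [-> _] := wf n nns.
have wf0 : w f <= 0.
  rewrite (val_prod wM) // -[0](mul0r (size ns)%:Z) sum_le_size // => n.
  by case/wf.
pose a := 1 + j pi ^+ (q * s) / (j pi * f ^+ q).
have [|eta Deta] := wR q a q_gt0 q_nz.
  right; rewrite /a addrC addKr wM ?expf_neq0 ?invr_eq0 ?mulf_neq0 ?expf_neq0 //.
  rewrite (valV wM) ?mulf_neq0 ?expf_neq0 // wM ?expf_neq0 // !(valX wM) // wpi.
  have h1 : 0 <= - w f * q%:Z by rewrite mulr_ge0 // oppr_ge0.
  have h2 : 0 < (q * m)%N%:Z * ((q * s)%N%:Z - 1).
    have q_gt1 := prime_gt1 q_pr.
    have qs_gt1 : (1 < q * s)%N by apply: leq_trans q_gt1 (leq_pmulr _ s_gt0).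
    by rewrite mulr_gt0 //; lia.
  lia.
exists kappa, j, x, (x^-1 ^+ m * f * eta); split=> //.
rewrite horner_curve_poly !exprMn Deta -exprM (mulnC m) exprVn Dx invrK /a -/f.
by field; rewrite jpi0 expf_neq0.
Qed.

(** Division by pi^(q s) leaves a 1-unit: even when w(f) equals e s, the factor pi adds the positive
    value e. *)
Lemma near_root_lift (kappa : fieldType) (j : {rmorphism K -> kappa}) e (w : kappa -> int) f :
    (0 < e)%N ->
    (forall a b, a != 0 -> b != 0 -> w (a * b) = w a + w b) ->
    (forall c, c != 0 -> w (j c) = v c *+ e) ->
    (forall q a, (0 < q)%N -> q%:R != 0 :> k -> a = 1 \/ 0 < w (a - 1) ->
        exists eta, eta ^+ q = a) ->
    f = 0 \/ e%:Z * s%:Z <= w f ->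
  exists y, y ^+ q = j pi * f ^+ q + j pi ^+ (q * s).
Proof.
move=> e_gt0 wM wC wR wf; have q_gt0 := prime_gt0 q_pr.
have jpi0 : j pi != 0 by rewrite fmorph_eq0.
have wpi : w (j pi) = e%:Z by rewrite wC // vpi natz.
pose a := 1 + j pi * f ^+ q / j pi ^+ (q * s).
have [|eta Deta] := wR q a q_gt0 q_nz.
  case: wf => [f0 | wf]; first by left; rewrite /a f0 expr0n gtn_eqF // mulr0 mul0r addr0.
  have [f0 | f0] := eqVneq f 0.
    by left; rewrite /a f0 expr0n gtn_eqF // mulr0 mul0r addr0.
  right; rewrite /a addrC addKr !wM ?mulf_neq0 ?invr_eq0 ?expf_neq0 //.
  rewrite (valV wM) ?expf_neq0 // !(valX wM) // wpi.
  have h1 : 0 <= (w f - e%:Z * s%:Z) * q%:Z by rewrite mulr_ge0 // subr_ge0.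
  lia.
exists (j pi ^+ s * eta); rewrite exprMn Deta -exprM mulnC /a.
by field; rewrite expf_neq0.
Qed.

Lemma curve_point_multiple n m : n \in ns -> (0 < m)%N -> has_curve_point (n * m).
Proof.
move=> nns m_gt0; have n_gt0 := ns_gt0 nns.
have d_gt0 : (0 < n * m)%N by rewrite muln_gt0 n_gt0.
have [m1 | m_neq1] := eqVneq m 1%N.
  (* For m = 1 a root of X^n - pi annihilates f, and F(x) = pi^(q s). In the other case m > 1 keeps
     the linear term of [g] below the leading one. *)
  rewrite {}m1 muln1 {d_gt0 m m_gt0}.
  have root_pi (kappa : fieldType) (j : {rmorphism K -> kappa}) x :
      root (map_poly j ('X^n - pi%:P)) x -> x ^+ n = j pi.
    by rewrite rmorphB /= map_polyXn map_polyC /= rootE !hornerE subr_eq0 => /eqP.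
  have [|||kappa [j [x [ext gx gen]]]] := @exists_ext_point K ('X^n - pi%:P) n.
  - by rewrite size_XnsubC.
  - by [].
  - move=> kappa j e x e_gt0 ext /root_pi Dx.
    have [w [wM _ wC _]] := henselian_extension hens res ext.
    have x0 : x != 0.
      by apply: contraNneq pi0 => x0; rewrite -(fmorph_eq0 j) -Dx x0 expr0n gtn_eqF.
    apply: (@dvdn_of_int _ _ (w x)); rewrite -(valX wM) // Dx wC // vpi.
    by rewrite natz.
  have [w [wM wD wC wR]] := henselian_extension hens res ext.
  have [|y Dy] := @near_root_lift _ _ _ w (\prod_(n <- ns) (x ^+ n - j pi)) n_gt0 wM wC wR.
    left; apply/eqP; rewrite prodf_seq_eq0; apply/hasP; exists n => //=.
    by rewrite (root_pi _ _ _ gx) subrr.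
  by exists kappa, j, x, y; rewrite horner_curve_poly.
have m_gt1 : (1 < m)%N by rewrite ltn_neqAle eq_sym m_neq1.
pose B := (m * s)%N; pose g : {poly K} := ('X^n - pi%:P) ^+ m - (pi ^+ B) *: 'X.
have root_g (kappa : fieldType) (j : {rmorphism K -> kappa}) e x w :
    (0 < e)%N ->
    (forall a b, a != 0 -> b != 0 -> w (a * b) = w a + w b) ->
    (forall a b, a != 0 -> b != 0 -> a + b != 0 -> Num.min (w a) (w b) <= w (a + b)) ->
    (forall c, c != 0 -> w (j c) = v c *+ e) -> root (map_poly j g) x ->
    [/\ x != 0, x ^+ n - j pi != 0, w x * n%:Z = e%:Z
      & w (x ^+ n - j pi) * m%:Z = e%:Z * B%:Z + w x].
  move=> e_gt0 wM wD wC.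
  have jpi0 : j pi != 0 by rewrite fmorph_eq0.
  have wpi : w (j pi) = e%:Z by rewrite wC // vpi natz.
  rewrite /g rmorphB /= rmorphXn /= rmorphB /= map_polyXn map_polyC /= map_polyZ map_polyX /=.
  rewrite rmorphXn rootE !hornerE subr_eq0 => /eqP Dx.
  have x0 : x != 0.
    apply: contraNneq jpi0 => x0; move/eqP: Dx; rewrite x0 mulr0 expr0n gtn_eqF // sub0r.
    by rewrite expf_eq0 m_gt0 oppr_eq0.
  have xn0 : x ^+ n - j pi != 0.
    have : j pi ^+ B * x != 0 by rewrite mulf_neq0 ?expf_neq0.
    by rewrite -Dx; apply: contraNneq => ->; rewrite expr0n gtn_eqF.
  have Dw : w (x ^+ n - j pi) * m%:Z = e%:Z * B%:Z + w x.
    by rewrite -(valX wM) // Dx wM ?expf_neq0 // (valX wM) // wpi.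
  split=> //; have le_mB : (m <= B)%N by rewrite leq_pmulr.
  have e_mB : 0 <= e%:Z * (B%:Z - m%:Z) by rewrite mulr_ge0 // subr_ge0.
  have wxn : w (x ^+ n) = w x * n%:Z by rewrite (valX wM).
  (* If n w(x) < e, the equation forces w(x) < 0 and (n m - 1) w(x) = e B > 0; if n w(x) > e, it
     forces w(x) = e (m - B) <= 0. Both are absurd. *)
  case: (ltgtP (w x * n%:Z) e%:Z) => // lt_we.
    have [||_ wE] := @val_lt _ w wM wD (x ^+ n) (- j pi).
    - by rewrite expf_neq0.
    - by right; rewrite (valN wM) wpi wxn.
    rewrite wE wxn in Dw.
    have h : 0 < (e%:Z - w x * n%:Z) * m%:Z by rewrite mulr_gt0 // subr_gt0.
    have wx_lt0 : w x < 0 by lia.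
    have h1 : 0 <= - w x * (n%:Z - 1) * m%:Z by rewrite !mulr_ge0 //; lia.
    have h2 : 0 <= - w x * (m%:Z - 1) by rewrite !mulr_ge0 //; lia.
    have : 0 < e%:Z * B%:Z by rewrite mulr_gt0 // ltz_nat muln_gt0 m_gt0.
    lia.
  have [||_ wE] := @val_lt _ w wM wD (- j pi) (x ^+ n).
  - by rewrite oppr_eq0.
  - by right; rewrite (valN wM) wpi wxn.
  rewrite addrC (valN wM) wpi in wE; rewrite wE in Dw.
  have wx_le0 : w x <= 0 by lia.
  have : w x * n%:Z <= 0 by rewrite mulr_le0_ge0.
  lia.
have szg : size g = (n * m).+1.
  have szXn : size ('X^n - pi%:P) = n.+1 by rewrite size_XnsubC.
  have szXnm : size (('X^n - pi%:P) ^+ m) = (n * m).+1.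
    rewrite -[LHS]prednK ?size_exp ?szXn // size_poly_gt0 expf_neq0 //.
    by rewrite -size_poly_gt0 szXn.
  rewrite size_polyDl szXnm // size_polyN size_scale ?expf_neq0 // size_polyX ltnS.
  by rewrite (leq_trans m_gt1) // leq_pmull.
have [|kappa [j [x [ext gx gen]]]] := @exists_ext_point K g (n * m) szg d_gt0.
  move=> kappa j e x e_gt0 ext gx.
  have [w [wM wD wC _]] := henselian_extension hens res ext.
  have [_ _ Dwx Dw] := root_g _ _ _ _ _ e_gt0 wM wD wC gx.
  (* Eliminating w(x) gives n m w(x^n - pi) = e (B n + 1), and B n + 1 is prime to n m because [B]
     is a multiple of [m]. *)
  have co : coprime (n * m) (B * n + 1).
    rewrite coprimeMl /coprime gcdnMDl gcdn1 eqxx /= /B -mulnA mulnC gcdnMDl gcdn1.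
    by [].
  rewrite -(Gauss_dvdl _ co); apply: (@dvdn_of_int _ _ (w (x ^+ n - j pi))).
  have -> : (e * (B * n + 1))%N%:Z = e%:Z * B%:Z * n%:Z + e%:Z by lia.
  by rewrite -[X in _ = _ + X]Dwx -mulrDl -Dw PoszM -mulrA (mulrC m%:Z).
have [w [wM wD wC wR]] := henselian_extension hens res ext.
have [x0 xn0 Dwx Dw] := root_g _ _ _ _ _ d_gt0 wM wD wC gx.
have jpi0 : j pi != 0 by rewrite fmorph_eq0.
have wpi : w (j pi) = (n * m)%N%:Z by rewrite wC // vpi natz.
have wx_gt0 : 0 < w x by rewrite -(pmulr_lgt0 _ (_ : 0 < n%:Z)) ?Dwx.
pose f := \prod_(l <- ns) (x ^+ l - j pi).
have [|y Dy] := @near_root_lift _ _ _ w f d_gt0 wM wC wR; last first.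
  by exists kappa, j, x, y; rewrite horner_curve_poly.
have [f0 | f0] := eqVneq f 0; [by left | right].
move: (f0); rewrite /f (big_rem n nns) /= mulf_eq0 negb_or => /andP[_ f1_0].
rewrite wM // (val_prod wM) //.
(* The factor x^n - pi alone reaches the required value; the others have value at least 0 since w(x)
   > 0. *)
have sum_ge0 : 0 <= \sum_(l <- rem n ns) w (x ^+ l - j pi).
  rewrite big_seq sumr_ge0 // => l lns.
  have : x ^+ l - j pi != 0.
    by move: f1_0; rewrite prodf_seq_neq0 => /allP/(_ l lns).
  have xl0 : x ^+ l != 0 by rewrite expf_neq0.
  have jN0 : - j pi != 0 by rewrite oppr_eq0.
  move/(wD _ _ xl0 jN0); apply: le_trans; rewrite (valN wM) wpi (valX wM) //.
  by rewrite le_min mulr_ge0 // ltW.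
have : (n * m)%N%:Z * s%:Z * m%:Z <= w (x ^+ n - j pi) * m%:Z.
  by rewrite Dw /B; lia.
by rewrite ler_pM2r // => /le_trans; apply; rewrite lerDl.
Qed.

End CurvePoints.

(** * The function field of a superelliptic curve *)

Lemma fraction_numden (R : idomainType) (z : {fraction R}) :
  exists n d : R, d != 0 /\ z = tofrac n / tofrac d.
Proof.
elim/quotW: z => x; exists \n_x, \d_x; split; first exact: denom_ratioP.
have d0 : tofrac \d_x != 0 by rewrite tofrac_eq0 denom_ratioP.
apply/(canRL (mulfK d0)); unlock tofrac; rewrite -[LHS]FracField.pi_mul.
apply/eqmodP; rewrite /= FracField.equivfE /FracField.mulf.
by rewrite !numden_Ratio ?mulf_neq0 ?oner_eq0 ?denom_ratioP // !mulr1 mulrC.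
Qed.

Lemma fraction_poly_numden (R : idomainType) (P : {poly {fraction R}}) :
  exists (Q : {poly R}) (d : R), d != 0 /\ P = (tofrac d)^-1 *: map_poly (@tofrac R) Q.
Proof.
elim/poly_ind: P => [|P c [Q [d [d0 ->]]]].
  by exists 0, 1; rewrite oner_eq0 map_poly0 scaler0.
have [n [e [e0 ->]]] := fraction_numden c.
exists (e *: Q * 'X + (n * d)%:P), (d * e); rewrite mulf_neq0 //; split=> //.
have [D0 E0] : tofrac d != 0 /\ tofrac e != 0 by rewrite !tofrac_eq0.
rewrite rmorphD (rmorphM (map_poly _)) /= map_polyZ map_polyX map_polyC /= !tofracM scalerDr.
congr (_ + _).
  by rewrite -!scalerAl scalerA invfM -mulrA mulVf // mulr1.
rewrite -mul_polyC -polyCM; congr (_%:P).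
by apply/esym; rewrite invfM mulrACA mulrC -mulrA mulVKf // mulrC.
Qed.

Lemma separable_no_power (F : fieldType) (f g h : {poly F}) (q : nat) :
  (1 < q)%N -> separable_poly f -> (1 < size g)%N -> f != g ^+ q * h.
Proof.
move=> q_gt1 /separable_polyP[sep _] szg; apply/eqP => Df.
have /sep : g * g %| f.
  by rewrite Df -(subnK q_gt1) exprD -expr2 dvdp_mulr // dvdp_mull.
by rewrite coprimepp => /eqP sz1; rewrite sz1 in szg.
Qed.

(* In q-th powers of fractions times a low power of a squarefree f, denominators
   already divide numerators. *)
Lemma dvdp_exp_separable (F : fieldType) (f P Q : {poly F}) (q i : nat) :
  (i < q)%N -> separable_poly f -> Q != 0 -> Q ^+ q %| P ^+ q * f ^+ i -> Q %| P.
Proof.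
move=> lt_iq sep Q0 dvd; have q_gt0 : (0 < q)%N by apply: leq_ltn_trans lt_iq.
pose g := gcdp P Q; have g0 : g != 0 by rewrite gcdp_eq0 negb_and Q0 orbT.
pose P' := P %/ g; pose Q' := Q %/ g.
have DP : P = P' * g by rewrite divpK // dvdp_gcdl.
have DQ : Q = Q' * g by rewrite divpK // dvdp_gcdr.
have copPQ : coprimep P' Q' by apply: coprimep_div_gcd; rewrite Q0 orbT.
have dvd1 : Q' ^+ q %| f ^+ i.
  move: dvd; rewrite DP DQ !exprMn mulrAC dvdp_mul2r ?expf_neq0 //.
  by rewrite Gauss_dvdpr // coprimep_expl // coprimep_expr // coprimep_sym.
pose e := gcdp Q' f; have f0 := separable_poly_neq0 sep.
have e0 : e != 0 by rewrite gcdp_eq0 negb_and f0 orbT.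
have Df : f = f %/ e * e by rewrite divpK // dvdp_gcdr.
have cop_e : coprimep e (f %/ e).
  by case/separable_polyP: sep => sep _; apply: sep; rewrite mulrC -Df.
have dvd2 : e ^+ (q - i) %| (f %/ e) ^+ i.
  rewrite -(dvdp_mul2r _ _ (expf_neq0 i e0)) -exprD subnK ?(ltnW lt_iq) //.
  rewrite -exprMn -Df; apply: dvdp_trans dvd1.
  by rewrite dvdp_exp2r // dvdp_gcdl.
have e1 : size e == 1%N.
  rewrite -coprimepp; have ee : e %| (f %/ e) ^+ i.
    by apply: dvdp_trans dvd2; rewrite dvdp_exp ?subn_gt0.
  by apply: (coprimep_dvdl ee); rewrite coprimep_expr.
have Q'1 : size Q' == 1%N.
  rewrite -coprimepp -(coprimep_pexpl Q' Q' q_gt0) -(coprimep_pexpr (Q' ^+ q) Q' q_gt0).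
  by apply: (coprimep_dvdl dvd1); rewrite coprimep_expr // coprimep_expl.
by rewrite DP DQ dvdp_mul2r // dvdUp // -size_poly_eq1.
Qed.

(** * Evaluation of bivariate polynomials *)

Section Evaluation.
Variables (K : fieldType) (L : comNzRingType) (io : {rmorphism K -> L}) (x y : L).

Fact evXY_key : unit. Proof. by []. Qed.

(* Here the outer variable of a bivariate polynomial is evaluated at y. *)
Definition evXY : {poly {poly K}} -> L :=
  locked_with evXY_key (fun P => (map_poly (horner_eval x \o map_poly io) P).[y]).

Lemma evXYE P : evXY P = (map_poly (horner_eval x \o map_poly io) P).[y].
Proof. by rewrite /evXY unlock. Qed.

Fact evXY_zmod_morphism : zmod_morphism evXY.
Proof. by move=> P Q; rewrite !evXYE rmorphB hornerD hornerN. Qed.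

Fact evXY_monoid_morphism : monoid_morphism evXY.
Proof. by split=> [|P Q]; rewrite !evXYE ?rmorph1 ?hornerC // rmorphM hornerM. Qed.

HB.instance Definition _ := GRing.isZmodMorphism.Build _ _ evXY evXY_zmod_morphism.
HB.instance Definition _ := GRing.isMonoidMorphism.Build _ _ evXY evXY_monoid_morphism.

Lemma evXYD P Q : evXY (P + Q) = evXY P + evXY Q. Proof. exact: raddfD. Qed.

Lemma evXYB P Q : evXY (P - Q) = evXY P - evXY Q. Proof. exact: raddfB. Qed.

Lemma evXYM P Q : evXY (P * Q) = evXY P * evXY Q. Proof. exact: rmorphM. Qed.

Lemma evXY0 : evXY 0 = 0. Proof. exact: raddf0. Qed.

Lemma evXY1 : evXY 1 = 1. Proof. exact: rmorph1. Qed.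

Lemma evXYX P n : evXY (P ^+ n) = evXY P ^+ n. Proof. exact: rmorphXn. Qed.

Lemma evXY_polyC p : evXY p%:P = (map_poly io p).[x].
Proof. by rewrite evXYE map_polyC hornerC. Qed.

Lemma evXY_const c : evXY c%:P%:P = io c.
Proof. by rewrite evXY_polyC map_polyC hornerC. Qed.

Lemma evXY_x : evXY 'X%:P = x.
Proof. by rewrite evXY_polyC map_polyX hornerX. Qed.

Lemma evXY_y : evXY 'X = y.
Proof. by rewrite evXYE map_polyX hornerX. Qed.

Lemma evXY_sum (P : {poly {poly K}}) (q : nat) : (size P <= q)%N ->
  evXY P = \sum_(i < q) (map_poly io P`_i).[x] * y ^+ i.
Proof.
move=> szP; rewrite !evXYE (@horner_coef_wide _ q); last first.
  exact: leq_trans (size_poly _ _) szP.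
by apply: eq_bigr => i _; rewrite coef_map.
Qed.

Lemma evXY_curve f q : evXY ('X^q - f%:P) = y ^+ q - (map_poly io f).[x].
Proof. by rewrite evXYB evXYX evXY_y evXY_polyC. Qed.

Lemma eval2_swap P : eval2 io x y (swapXY P) = evXY P.
Proof.
by rewrite /eval2 -swapXY_map horner_swapXY evXYE -map_poly_comp.
Qed.

Lemma eval2E P : eval2 io x y P = evXY (swapXY P).
Proof. by rewrite -[P in LHS]swapXYK eval2_swap. Qed.

End Evaluation.

Lemma evXY_comp (K : fieldType) (L T : comNzRingType) (io : {rmorphism K -> L})
    (phi : {rmorphism L -> T}) x y P :
  phi (evXY io x y P) = evXY (phi \o io) (phi x) (phi y) P.
Proof.
rewrite !evXYE -horner_map -map_poly_comp; congr (_.[_]).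
by apply: eq_map_poly => p /=; rewrite !horner_evalE -horner_map -map_poly_comp.
Qed.

(* x and y generate a copy of K[X, Y] / (Y^q - f(X)). *)
Definition plane_embedding (K L : fieldType) (io : {rmorphism K -> L}) (x y : L)
    (f : {poly K}) (q : nat) : Prop :=
  y ^+ q = (map_poly io f).[x] /\
  forall P : {poly {poly K}}, (size P <= q)%N -> evXY io x y P = 0 -> P = 0.

(** Denominators in [x] alone suffice because y is algebraic over K(x); every element becomes a
    combination of 1, ..., y^(q - 1) over K(x). *)
Definition plane_model (K L : fieldType) (io : {rmorphism K -> L}) (x y : L)
    (f : {poly K}) (q : nat) : Prop :=
  plane_embedding io x y f q /\
  forall z, exists (P : {poly {poly K}}) (Q : {poly K}),
    (map_poly io Q).[x] != 0 /\ z = evXY io x y P / (map_poly io Q).[x].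

Section PlaneEmbedding.
Variables (K L : fieldType) (io : {rmorphism K -> L}) (x y : L) (f : {poly K}) (q : nat).
Hypotheses (q_gt0 : (0 < q)%N) (emb : plane_embedding io x y f q).

Let h : {poly {poly K}} := 'X^q - f%:P.

Lemma model_mod (P : {poly {poly K}}) : exists P0 Q : {poly {poly K}},
  [/\ (size P0 <= q)%N, evXY io x y P0 = evXY io x y P & P = Q * h + P0].
Proof.
have mon_h : h \is monic by apply: monicXnsubC.
have szR : (size (Pdiv.Ring.rmodp P h) <= q)%N.
  by rewrite -ltnS -(size_XnsubC f q_gt0) Pdiv.Ring.ltn_rmodp monic_neq0.
have := Pdiv.RingMonic.rdivp_eq mon_h P.
move: (Pdiv.Ring.rmodp P h) (Pdiv.Ring.rdivp P h) szR => R Q szR DP.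
exists R, Q; split=> //; rewrite DP evXYD evXYM.
have -> : evXY io x y h = 0; last by rewrite mulr0 add0r.
by have [Dy _] := emb; rewrite evXY_curve Dy subrr.
Qed.

Lemma model_rel (P : {poly {poly K}}) :
  evXY io x y P = 0 <-> exists Q, P = Q * h.
Proof.
have [Dy free] := emb; split=> [P0 | [Q ->]]; last first.
  by rewrite evXYM evXY_curve Dy subrr mulr0.
have [R [Q [szR ER ->]]] := model_mod P.
by exists Q; rewrite (free R) ?addr0 // ER.
Qed.

Lemma model_polyx_neq0 (Q : {poly K}) : Q != 0 -> (map_poly io Q).[x] != 0.
Proof.
have [_ free] := emb => Q0; apply: contraNneq Q0 => Qx.
rewrite -polyC_eq0 (free Q%:P) // ?evXY_polyC // size_polyC.
by apply: leq_trans q_gt0; case: (Q != 0).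
Qed.

Lemma model_gen_reduced z : plane_model io x y f q -> exists (P : {poly {poly K}}) (Q : {poly K}),
  [/\ (size P <= q)%N, Q != 0 & z = evXY io x y P / (map_poly io Q).[x]].
Proof.
case=> _ /(_ z) [P [Q [Q0 Dz]]].
have [R [_ [szR ER _]]] := model_mod P.
exists R, Q; rewrite ER; split=> //.
by apply: contraNneq Q0 => ->; rewrite map_poly0 horner0.
Qed.

End PlaneEmbedding.

(** The field is K(X)[Y] / (Y^q - f). A q-th root of f in K(X) would be a polynomial, since d^q
    dividing n^q implies that d divides n; a nonconstant separable polynomial has no such root. *)
Lemma plane_model_exists (K : fieldType) (f : {poly K}) (q : nat) :
    prime q -> separable_poly f -> (1 < size f)%N ->
  exists (L : fieldType) (io : {rmorphism K -> L}) (x y : L), plane_model io x y f q.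
Proof.
move=> q_pr sep_f szf; have q_gt0 := prime_gt0 q_pr.
pose E := {fraction {poly K}}; pose t : {rmorphism {poly K} -> E} := @tofrac _.
have t_inj : injective t by move=> a b /eqP; rewrite tofrac_eq => /eqP.
have nq b : b ^+ q != t f.
  apply/eqP; have [n [d [d0 ->]]] := fraction_numden b.
  have D0 : tofrac d != 0 by rewrite tofrac_eq0.
  rewrite expr_div_n => /(canRL (divfK (expf_neq0 q D0))).
  rewrite -!tofracXn -tofracM => /eqP; rewrite tofrac_eq => /eqP Dn.
  have : d %| n by rewrite -(dvdp_pexp2r _ _ q_gt0) Dn dvdp_mull.
  case/dvdpP=> n' Dn'; have Df : f = n' ^+ q.
    by apply: (mulIf (expf_neq0 q d0)); rewrite -Dn Dn' exprMn.
  have n'_gt1 : (1 < size n')%N.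
    rewrite ltnNge; apply: contraL szf => sz1; rewrite -leqNgt Df (size1_polyC sz1).
    by rewrite -polyC_exp size_polyC leq_b1.
  have /eqP[] := separable_no_power 1 (prime_gt1 q_pr) sep_f n'_gt1.
  by rewrite mulr1.
have irr := irreducible_Xn_sub q_pr nq.
have [L [i [y [y_root gen]]]] := adjoin_root irr.
pose io : {rmorphism K -> L} := i \o (t \o polyC); pose x := i (t 'X).
have ioE p : (map_poly io p).[x] = i (t p).
  rewrite /x (map_poly_comp i) horner_map (map_poly_comp t) horner_map /=.
  by rewrite -/(comp_poly _ _) comp_polyXr.
have evE P : evXY io x y P = (map_poly i (map_poly t P)).[y].
  rewrite !evXYE -map_poly_comp; congr (_.[_]).
  by apply: eq_map_poly => p /=; rewrite horner_evalE ioE.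
exists L, io, x, y; split=> [|z]; first split=> [|P szP].
- move: y_root; rewrite rmorphB /= map_polyXn map_polyC rootE !hornerE subr_eq0 ioE.
  by move/eqP.
- rewrite evE => Py; apply: (map_inj_poly t_inj); rewrite ?tofrac0 ?map_poly0 //.
  apply: contraTeq szP => P0; rewrite -ltnNge -(size_map_inj_poly t_inj) ?tofrac0 //.
  have [cop | ncop] := boolP (coprimep ('X^q - (t f)%:P) (map_poly t P)).
    have := coprimep_root (etrans (coprimep_map i _ _) cop) y_root.
    by rewrite Py eqxx.
  have [_ /(_ _ ncop (dvdp_gcdl _ _)) eq_h] := irr.
  have : 'X^q - (t f)%:P %| map_poly t P by rewrite -(eqp_dvdl _ eq_h) dvdp_gcdr.
  by move/dvdp_leq => /(_ P0); rewrite size_XnsubC.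
have [R ->] := gen z; have [Q [d [d0 ->]]] := fraction_poly_numden R.
exists Q, d; rewrite ioE fmorph_eq0 tofrac_eq0 d0; split=> //.
by rewrite evE map_polyZ hornerZ fmorphV mulrC.
Qed.

(** * The integral closure of K[x] in the function field *)

Section ModelHom.
Variables (K L T : fieldType) (io : {rmorphism K -> L}) (j : {rmorphism K -> T}).
Variables (x y : L) (x' y' : T) (f : {poly K}) (q : nat).
Hypotheses (q_gt0 : (0 < q)%N) (model : plane_model io x y f q).
Hypothesis emb' : plane_embedding j x' y' f q.

Lemma evXY_transfer P : evXY io x y P = 0 <-> evXY j x' y' P = 0.
Proof.
have [emb _] := model.
by split; [move/(model_rel q_gt0 emb)/(model_rel q_gt0 emb')
          | move/(model_rel q_gt0 emb')/(model_rel q_gt0 emb)].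
Qed.

(** A point with exactly the relations of (x, y) receives the whole function field. This yields both
    the conjugations y -> zeta^i y and the embedding into the function field after base change. *)
Lemma model_hom : exists phi : {rmorphism L -> T},
  forall P, phi (evXY io x y P) = evXY j x' y' P.
Proof.
have [emb gen] := model.
pose graph z t := exists P Q : {poly {poly K}},
  [/\ evXY io x y Q != 0, z = evXY io x y P / evXY io x y Q
    & t = evXY j x' y' P / evXY j x' y' Q].
have den0 Q : evXY io x y Q != 0 -> evXY j x' y' Q != 0.
  by apply: contraNneq => /evXY_transfer->.
have graph_ex z : exists t, graph z t.
  have [P [Q [Q0 ->]]] := gen z; exists (evXY j x' y' P / evXY j x' y' Q%:P), P, Q%:P.
  by split=> //; rewrite evXY_polyC.
have graphU z t t' : graph z t -> graph z t' -> t = t'.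
  move=> [P [Q [Q0 -> ->]]] [P' [Q' [Q'0 /eqP Dz ->]]]; move: Dz.
  rewrite eqr_div // => /eqP E1.
  have : evXY io x y (P * Q' - P' * Q) = 0 by rewrite evXYB !evXYM E1 subrr.
  move/evXY_transfer; rewrite evXYB !evXYM => /eqP.
  by rewrite subr_eq0 => E2; apply/eqP; rewrite eqr_div ?den0.
have [phi phiP] : exists phi, forall z, graph z (phi z).
  exists (fun z => proj1_sig (constructive_indefinite_description _ (graph_ex z))) => z.
  exact: proj2_sig.
have phiE P Q z : evXY io x y Q != 0 -> z = evXY io x y P / evXY io x y Q ->
    phi z = evXY j x' y' P / evXY j x' y' Q.
  by move=> Q0 Dz; apply: graphU (phiP z) _; exists P, Q.
have phi1 : phi 1 = 1.
  by rewrite (phiE 1 1) ?evXY1 ?oner_eq0 ?divr1.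
have phiD a b : phi (a + b) = phi a + phi b.
  have [P [Q [Q0 Da ->]]] := phiP a; have [P' [Q' [Q'0 Db ->]]] := phiP b.
  rewrite addf_div ?den0 // -!evXYM -evXYD; apply: phiE.
    by rewrite evXYM mulf_neq0.
  by rewrite Da Db addf_div // evXYD !evXYM.
have phiM a b : phi (a * b) = phi a * phi b.
  have [P [Q [Q0 Da ->]]] := phiP a; have [P' [Q' [Q'0 Db ->]]] := phiP b.
  rewrite mulf_div -!evXYM; apply: phiE; first by rewrite evXYM mulf_neq0.
  by rewrite Da Db mulf_div !evXYM.
have [g gE] := rmorphism_of phi1 phiD phiM.
by exists g => P; rewrite gE (phiE P 1) ?evXY1 ?oner_eq0 ?divr1.
Qed.

End ModelHom.

Section IntegralClosure.
Variables (K L : fieldType) (io : {rmorphism K -> L}) (x y : L) (f : {poly K}) (q : nat).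
Hypotheses (q_pr : prime q) (model : plane_model io x y f q) (sep_f : separable_poly f).
Variable zeta : K.
Hypothesis zetaP : q.-primitive_root zeta.

Lemma model_conj (i : nat) : exists phi : {rmorphism L -> L},
  forall P, phi (evXY io x y P) = evXY io x (io zeta ^+ i * y) P.
Proof.
have [[Dy free] _] := model; apply: (model_hom (prime_gt0 q_pr) model); split.
  by rewrite exprMn exprAC -rmorphXn (prim_expr_order zetaP) rmorph1 expr1n mul1r.
pose c := zeta ^+ i; have c0 : c != 0.
  rewrite expf_neq0 //; apply: contraTneq (oner_neq0 K) => z0.
  by rewrite -(prim_expr_order zetaP) z0 expr0n gtn_eqF ?prime_gt0 ?eqxx.
move=> P szP P0; pose P1 : {poly {poly K}} := \poly_(l < q) (c ^+ l *: P`_l).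
have /polyP P1_0 : P1 = 0.
  apply: free; first exact: size_poly.
  rewrite -P0 (evXY_sum _ _ _ (size_poly _ _)) (evXY_sum _ _ _ szP).
  apply: eq_bigr => l _; rewrite coef_poly ltn_ord map_polyZ hornerZ exprMn.
  by rewrite rmorphXn /= /c rmorphXn mulrCA mulrA.
apply/polyP=> l; have [lt_l | le_l] := ltnP l q; last by rewrite coef0 nth_default // (leq_trans szP).
have := P1_0 l; rewrite coef_poly lt_l coef0 => /eqP.
by rewrite scaler_eq0 expf_eq0 (negPf c0) andbF => /eqP.
Qed.

Lemma evXY_scale_y (c : K) P : exists P', evXY io x (io c * y) P = evXY io x y P'.
Proof.
exists (\poly_(l < size P) (c ^+ l *: P`_l)).
rewrite (evXY_sum _ _ _ (leqnn _)) (evXY_sum _ _ _ (size_poly _ _)).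
apply: eq_bigr => l _; rewrite coef_poly ltn_ord map_polyZ hornerZ exprMn.
by rewrite rmorphXn mulrCA mulrA.
Qed.

(** Orthogonality of the powers of [zeta]; the exponent q - i + l represents l - i among natural
    numbers. *)
Lemma sum_prim_root (l i : 'I_q) :
  \sum_(t < q) zeta ^+ (t * (q - i + l)) = if l == i then q%:R else 0.
Proof.
have q_gt0 := prime_gt0 q_pr.
under eq_bigr => t _ do rewrite mulnC exprM.
set w := zeta ^+ _; have wE : (w == 1) = (l == i).
  rewrite -(expr0 zeta) (eq_prim_root_expr zetaP) mod0n -/(_ %| _)%N.
  have [-> | ne_li] := eqVneq l i; first by rewrite subnK ?dvdnn // ltnW.
  apply/negP => /dvdnP[[|[|m]]].
  - have := ltn_ord i; lia.
  - rewrite mul1n => E; case/negP: ne_li; apply/eqP/val_inj => /=.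
    have := ltn_ord i; have := ltn_ord l; lia.
  have := ltn_ord l; have := ltn_ord i; lia.
have [w1 | w1] := eqVneq w 1; rewrite -wE.
  by rewrite w1 eqxx; under eq_bigr do rewrite expr1n; rewrite sumr_const card_ord.
rewrite (negPf w1); apply: (mulfI (_ : w - 1 != 0)); first by rewrite subr_eq0.
by rewrite -subrX1 mulr0 /w exprAC (prim_expr_order zetaP) expr1n subrr.
Qed.

Lemma integral_sum (R S : comNzRingType) (g : {rmorphism R -> S}) (I : Type) (s : seq I) (E : I -> S) :
  (forall i, integralOver g (E i)) -> integralOver g (\sum_(i <- s) E i).
Proof. by move=> intE; elim/big_ind: _ => //; [apply: integral0 | apply: integral_add]. Qed.

Lemma integral_exp (R S : comNzRingType) (g : {rmorphism R -> S}) u n :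
  integralOver g u -> integralOver g (u ^+ n).
Proof.
move=> intu; elim: n => [|n IHn]; first by rewrite expr0; apply: integral1.
by rewrite exprS; apply: integral_mul.
Qed.

Lemma integral_trans_range (R S T : comNzRingType) (g : {rmorphism R -> T}) (h : {rmorphism S -> T}) z :
  (forall a, integralOver g (h a)) -> integralOver h z -> integralOver g z.
Proof.
move=> gh [p mon_p pz]; apply: (integral_root_monic (monic_map h mon_p) pz).
by apply/integral_poly => i; rewrite coef_map; apply: gh.
Qed.

(** The rational root argument: in lowest terms A'/B', the monic equation cleared of denominators
    makes B' divide A'^n, so B' is a unit. *)
Lemma poly_fraction_integral (ex : {rmorphism {poly K} -> L}) (A B : {poly K}) :
  injective ex -> B != 0 -> integralOver ex (ex A / ex B) -> B %| A.
Proof.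
move=> ex_inj B0; pose g := gcdp A B.
have g0 : g != 0 by rewrite gcdp_eq0 negb_and B0 orbT.
have DA : A = A %/ g * g by rewrite divpK // dvdp_gcdl.
have DB : B = B %/ g * g by rewrite divpK // dvdp_gcdr.
have cop : coprimep (A %/ g) (B %/ g) by apply: coprimep_div_gcd; rewrite B0 orbT.
move: (A %/ g) (B %/ g) DA DB cop => A' B' DA DB cop.
have B'0 : B' != 0 by apply: contraNneq B0; rewrite DB => ->; rewrite mul0r.
have ex0 P : (ex P == 0) = (P == 0) by rewrite -[0](rmorph0 ex) (inj_eq ex_inj).
have -> : ex A / ex B = ex A' / ex B'.
  by rewrite DA DB !rmorphM -mulf_div divff ?mulr1 ?ex0.
case=> p mon_p; rewrite rootE => /eqP root_p.
have szp : size p = (size p).-1.+1 by rewrite prednK // size_poly_gt0 monic_neq0.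
set n := (size p).-1 in szp.
have : \sum_(i < n.+1) p`_i * A' ^+ i * B' ^+ (n - i) = 0.
  apply: ex_inj; rewrite rmorph0 rmorph_sum -[RHS](mulr0 (ex B' ^+ n)) -[X in _ * X]root_p.
  rewrite (@horner_coef_wide _ n.+1); last by rewrite -szp size_poly.
  rewrite mulr_sumr.
  apply: eq_bigr => i _; rewrite coef_map !rmorphM !rmorphXn expr_div_n /=.
  have le_in : (i <= n)%N by rewrite -ltnS.
  have -> : ex B' ^+ n = ex B' ^+ (n - i) * ex B' ^+ i by rewrite -exprD subnK.
  by field; rewrite expf_neq0 ?ex0.
rewrite big_ord_recr /= subnn expr0 mulr1 -/(lead_coef p) (monicP mon_p) mul1r => /eqP.
rewrite addr_eq0 => /eqP Dsum.
have : B' %| A' ^+ n.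
  rewrite -dvdpNr -Dsum; elim/big_ind: _ => [|a b Ba Bb|i _]; first exact: dvdp0.
    exact: dvdp_add.
  rewrite dvdp_mull // -(prednK (_ : 0 < n - i)%N) ?subn_gt0 //.
  by rewrite exprS dvdp_mulIl.
rewrite -[A' ^+ n]mulr1 Gauss_dvdpr; last by rewrite coprimep_expr // coprimep_sym.
by rewrite DA DB dvdp_mul2r // => B'1; apply: dvdp_trans B'1 (dvd1p _).
Qed.

(* Averaging over the automorphisms y |-> zeta^t y isolates each term of z, whose
   q-th power is then integral over K[x]. *)
Theorem plane_ring_integrally_closed z : q%:R != 0 :> K ->
  integralOver (evXY io x y) z -> exists P, z = evXY io x y P.
Proof.
move=> q_nz int_z; have [emb _] := model; have q_gt0 := prime_gt0 q_pr.
have [P [Q [szP Q0 Dz]]] := model_gen_reduced q_gt0 emb z model.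
pose ex : {rmorphism {poly K} -> L} := horner_eval x \o map_poly io.
have exE p : ex p = (map_poly io p).[x] by [].
have ex_inj : injective ex.
  move=> a b eq_ab; apply/eqP; rewrite -subr_eq0; apply: contraT => ab0.
  by have := model_polyx_neq0 q_gt0 emb ab0; rewrite -exE rmorphB eq_ab subrr eqxx.
have Qx0 : ex Q != 0 by apply: model_polyx_neq0 emb _ Q0.
have int_y : integralOver ex y.
  exists ('X^q - f%:P); first exact: monicXnsubC.
  rewrite rmorphB /= map_polyXn map_polyC rootE !hornerE subr_eq0.
  by have [-> _] := emb.
have int_ev R : integralOver ex (evXY io x y R).
  rewrite (evXY_sum _ _ _ (leqnn _)); apply: integral_sum => i.
  apply: integral_mul; first exact: integral_id.
  exact: integral_exp.
have int_const c : integralOver (evXY io x y) (io c).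
  by rewrite -(evXY_const io x y); apply: integral_id.
have int_conj t : integralOver (evXY io x y)
    (evXY io x (io zeta ^+ t * y) P / (map_poly io Q).[x]).
  have [phi phiE] := model_conj t.
  have -> : evXY io x (io zeta ^+ t * y) P / (map_poly io Q).[x] = phi z.
    by rewrite Dz -!(evXY_polyC io x y) fmorph_div !phiE !evXY_polyC.
  apply: integral_trans_range (integral_rmorph phi int_z) => R /=.
  rewrite phiE -rmorphXn; have [R' ->] := evXY_scale_y (zeta ^+ t) R.
  exact: integral_id.
have Qdvd (i : 'I_q) : Q %| P`_i.
  have int_ti : integralOver (evXY io x y) ((map_poly io P`_i).[x] * y ^+ i / ex Q).
    have -> : (map_poly io P`_i).[x] * y ^+ i / ex Q = io q%:R^-1 *
        \sum_(t < q) io (zeta ^+ (t * (q - i))) *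
          (evXY io x (io zeta ^+ t * y) P / (map_poly io Q).[x]).
      rewrite fmorphV; apply/(canRL (mulKf _)); first by rewrite fmorph_eq0.
      under eq_bigr => t _ do rewrite (evXY_sum _ _ _ szP) mulrA mulr_sumr mulr_suml.
      rewrite exchange_big (bigD1 i) //= [X in _ + X]big1 => [|l ne_li].
        rewrite addr0; transitivity (io (\sum_(t < q) zeta ^+ (t * (q - i + i))) *
           ((map_poly io P`_i).[x] * y ^+ i / ex Q)).
          by rewrite sum_prim_root eqxx.
        rewrite rmorph_sum mulr_suml; apply: eq_bigr => t _.
        rewrite mulnDr exprD rmorphM !rmorphXn /= exprMn -exprM.
        by rewrite -!exE; field.
      transitivity (io (\sum_(t < q) zeta ^+ (t * (q - i + l))) *
           ((map_poly io P`_l).[x] * y ^+ l / ex Q)).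
        rewrite rmorph_sum mulr_suml; apply: eq_bigr => t _.
        rewrite mulnDr exprD rmorphM !rmorphXn /= exprMn -exprM.
        by rewrite -!exE; field.
      by rewrite sum_prim_root (negPf ne_li) rmorph0 mul0r.
    by apply: integral_mul => //; apply: integral_sum => t; apply: integral_mul.
  (* The q-th power replaces y^(i q) by f^i and brings the term into K(x), where K[x] is integrally
     closed. *)
  have int_tiq : integralOver ex (ex (P`_i ^+ q * f ^+ i) / ex (Q ^+ q)).
    have -> : ex (P`_i ^+ q * f ^+ i) / ex (Q ^+ q) =
              ((map_poly io P`_i).[x] * y ^+ i / ex Q) ^+ q.
      have [Dy _] := emb.
      rewrite expr_div_n exprMn -exprM (mulnC i) exprM Dy -!exE.
      by rewrite rmorphM !rmorphXn.
    apply: (integral_trans_range int_ev).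
    exact: integral_exp.
  apply: (dvdp_exp_separable (ltn_ord i) sep_f Q0).
  by apply: poly_fraction_integral int_tiq; rewrite ?expf_neq0.
exists (\poly_(i < q) (P`_i %/ Q)); rewrite Dz.
rewrite (evXY_sum _ _ _ szP) (evXY_sum _ _ _ (size_poly _ _)) mulr_suml.
apply: eq_bigr => i _; rewrite coef_poly ltn_ord mulrAC; congr (_ * _).
apply/(canLR (mulfK Qx0)); rewrite -!exE -rmorphM divpK //.
Qed.

End IntegralClosure.

(** * Geometric integrality *)

(** Independence over [K] is freeness of the rows of a coefficient matrix, and rank does not change
    under field extension. *)
Lemma independent_map (K E : fieldType) (s : {rmorphism K -> E}) (n : nat)
    (P : 'I_n -> {poly {poly K}}) :
    (forall a : 'I_n -> K, \sum_(m < n) (a m)%:P *: P m = 0 -> forall m, a m = 0) ->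
  forall b : 'I_n -> E, \sum_(m < n) (b m)%:P *: map_poly (map_poly s) (P m) = 0 ->
    forall m, b m = 0.
Proof.
move=> indep b Db m0.
have [D [D_gt0 szD]] : exists D, (0 < D)%N /\
    forall m l i, (D <= l)%N || (D <= i)%N -> (P m)`_l`_i = 0.
  pose cz m (l : nat) := size (P m)`_l.
  pose sz m := (size (P m) + \max_(l < size (P m)) cz m l)%N.
  exists (\max_(m < n) sz m).+1; split=> // m l i.
  have le_m : (sz m <= \max_(m < n) sz m)%N by apply: leq_bigmax.
  have [lt_l | le_l] := ltnP l (size (P m)); last first.
    by rewrite [(P m)`_l]nth_default // coef0.
  have szl := leq_bigmax (Ordinal lt_l) (F := fun l : 'I__ => cz m l).
  have le1 : (size (P m) <= sz m)%N by apply: leq_addr.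
  have le2 : (cz m l <= sz m)%N by apply: leq_trans szl (leq_addl _ _).
  move=> /orP[] le_D; first by move: (leq_trans le1 le_m); lia.
  by rewrite nth_default //; apply: leq_trans le_D; rewrite -/(cz m l); lia.
(* Column t = l D + i stores the coefficient of Y^l X^i. *)
pose A : 'M[K]_(n, D * D) := \matrix_(m, t) (P m)`_(t %/ D)`_(t %% D).
have coefA (F : fieldType) (g : {rmorphism K -> F}) (a : 'I_n -> F) l i :
    (\sum_(m < n) (a m)%:P *: map_poly (map_poly g) (P m))`_l`_i =
    \sum_(m < n) a m * g (P m)`_l`_i.
  rewrite !coef_sum; apply: eq_bigr => m _.
  by rewrite coefZ coefCM !coef_map.
have Afree : row_free A.
  apply: inj_row_free => a aA; apply/rowP => m; rewrite mxE.
  apply: (indep (fun m => a 0 m)) => {m}; apply/polyP=> l; apply/polyP=> i.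
  have -> : \sum_(m < n) (a 0 m)%:P *: P m =
            \sum_(m < n) (a 0 m)%:P *: map_poly (map_poly (idfun : {rmorphism K -> K})) (P m).
    apply: eq_bigr => m _; congr (_ *: _); rewrite map_poly_id // => p _.
    by rewrite map_poly_id.
  rewrite coefA !coef0 /=.
  have [|] := boolP ((D <= l)%N || (D <= i)%N).
    by move=> le_D; rewrite big1 // => m _; rewrite szD ?mulr0.
  rewrite negb_or -!ltnNge => /andP[lt_l lt_i].
  have lt_t : (l * D + i < D * D)%N by nia.
  have /rowP/(_ (Ordinal lt_t)) := aA; rewrite !mxE => aA0; rewrite -[RHS]aA0.
  apply: eq_bigr => m _; rewrite !mxE /= divnMDl // divn_small // addn0.
  by rewrite modnMDl modn_small.
have bA : (\row_m b m) *m map_mx s A = 0.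
  apply/rowP=> t; rewrite !mxE; under eq_bigr => m _ do rewrite !mxE.
  by rewrite -coefA Db !coef0.
move: bA => /eqP; rewrite mulmx_free_eq0; last by rewrite /row_free mxrank_map.
by move/eqP/rowP/(_ m0); rewrite !mxE.
Qed.

Lemma common_denominator (K L : fieldType) (io : {rmorphism K -> L}) (x y : L) (f : {poly K})
    (q n : nat) (u : 'I_n -> L) : (0 < q)%N -> plane_model io x y f q ->
  exists (Q : {poly K}) (P : 'I_n -> {poly {poly K}}), Q != 0 /\
    forall m, (size (P m) <= q)%N /\ u m = evXY io x y (P m) / (map_poly io Q).[x].
Proof.
move=> q_gt0 model; have [emb _] := model.
have /fin_all_exists[P0 /fin_all_exists[Q0 PQ]] := fun m => model_gen_reduced q_gt0 emb (u m) model.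
pose R m := \prod_(l < n | l != m) Q0 l.
exists (\prod_(m < n) Q0 m), (fun m => R m *: P0 m); split=> [|m].
  by apply/prodf_neq0 => m _; have [] := PQ m.
have [szP Q0m ->] := PQ m; split; first exact: leq_trans (size_scale_leq _ _) szP.
have Rm : (map_poly io (R m)).[x] != 0.
  apply: (model_polyx_neq0 q_gt0 emb); apply/prodf_neq0 => l _.
  by have [] := PQ l.
rewrite (bigD1 m) //= -/(R m) rmorphM hornerM -mul_polyC rmorphM /= evXY_polyC.
by field; rewrite Rm; apply: (model_polyx_neq0 q_gt0 emb).
Qed.

Lemma evXY_map_coef (K E T : fieldType) (s : {rmorphism K -> E}) (j : {rmorphism E -> T}) x y P :
  evXY (j \o s) x y P = evXY j x y (map_poly (map_poly s) P).
Proof.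
rewrite !evXYE -map_poly_comp; congr (_.[_]).
by apply: eq_map_poly => p /=; rewrite !horner_evalE -map_poly_comp.
Qed.

(** [T] is the function field of the same equation over [E], still irreducible because f stays
    separable. Independence is then transported on numerators over a common denominator. *)
Lemma plane_model_linearly_disjoint (K L E : fieldType) (io : {rmorphism K -> L}) (x y : L)
    (f : {poly K}) (q : nat) (s : {rmorphism K -> E}) :
    prime q -> separable_poly f -> (1 < size f)%N -> plane_model io x y f q ->
  exists (T : fieldType) (i : {rmorphism L -> T}) (j : {rmorphism E -> T}),
    (forall c, i (io c) = j (s c)) /\
    forall (n : nat) (u : 'I_n -> L),
      (forall a : 'I_n -> K, \sum_(m < n) io (a m) * u m = 0 -> forall m, a m = 0) ->
      forall b : 'I_n -> E, \sum_(m < n) i (u m) * j (b m) = 0 -> forall m, b m = 0.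
Proof.
move=> q_pr sep_f szf model; have q_gt0 := prime_gt0 q_pr.
have [||T [j [x' [y' [emb' _]]]]] := @plane_model_exists E (map_poly s f) q q_pr.
- by rewrite separable_map.
- by rewrite size_map_poly.
have s_inj : injective (map_poly s) by apply: map_poly_inj.
have embK : plane_embedding (j \o s) x' y' f q.
  have [Dy free] := emb'; split; first by rewrite Dy -map_poly_comp.
  move=> P szP; rewrite evXY_map_coef => /free.
  rewrite (size_map_inj_poly s_inj) ?rmorph0 // => /(_ szP) P0.
  by apply: (map_inj_poly s_inj); rewrite ?rmorph0 ?map_poly0.
have [i iE] := model_hom q_gt0 model embK.
exists T, i, j; split=> [c|n u indep b Db].
  by rewrite -(evXY_const io x y) iE evXY_const.
have [Q [P [Q0 PQ]]] := common_denominator u q_gt0 model; have [emb _] := model.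
have Qx0 := model_polyx_neq0 q_gt0 emb Q0.
apply: (@independent_map _ _ s _ P).
  move=> a Da; apply: indep; under eq_bigr => m _.
    have [_ ->] := PQ m; rewrite -(evXY_const io x y) mulrA -rmorphM; over.
  rewrite -mulr_suml -rmorph_sum; under eq_bigr => m _ do rewrite mul_polyC.
  by rewrite Da rmorph0 mul0r.
have [_ free] := emb'; apply: free.
  rewrite (leq_trans (size_sum _ _ _)) //; apply/bigmax_leqP => m _.
  rewrite (leq_trans (size_scale_leq _ _)) // (size_map_inj_poly s_inj) ?rmorph0 //.
  by have [] := PQ m.
have iQ0 : i (map_poly io Q).[x] != 0 by rewrite fmorph_eq0.
apply: (mulIf (invr_neq0 iQ0)); rewrite mul0r -[RHS]Db rmorph_sum mulr_suml.
apply: eq_bigr => m _; have [_ ->] := PQ m.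
by rewrite /= -mul_polyC evXYM evXY_const -evXY_map_coef -iE fmorph_div -mulrA mulrC.
Qed.

(** * Localizations and derivations *)

Definition subring_on (L : nzRingType) (A : L -> Prop) : Prop :=
  [/\ A 1, forall a, A a -> A (- a), forall a b, A a -> A b -> A (a + b)
    & forall a b, A a -> A b -> A (a * b)].

Definition derivation_on (L kappa : nzRingType) (A : L -> Prop) (ev D : L -> kappa) : Prop :=
  (forall a b, A a -> A b -> D (a + b) = D a + D b) /\
  (forall a b, A a -> A b -> D (a * b) = ev a * D b + ev b * D a).

Section Localization.
Variables (L kappa : fieldType) (A : L -> Prop) (ev : L -> kappa).
Hypotheses (subA : subring_on A) (evA : ring_hom_on A ev).

(** The local ring at the kernel of [ev], kept as a subset of [L] so that no equivalence classes of
    fractions occur. *)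
Definition loc (z : L) : Prop := exists b, [/\ A b, ev b != 0 & A (b * z)].

Lemma loc_incl a : A a -> loc a.
Proof.
have [A1 _ _ _] := subA; have [ev1 _ _] := evA.
by move=> Aa; exists 1; rewrite ev1 oner_eq0 mul1r.
Qed.

Lemma loc_subring : subring_on loc.
Proof.
have [A1 AN AD AM] := subA; have [ev1 evD evM] := evA.
split=> [|a [b [Ab b0 Aba]]|a a' [b [Ab b0 Aba]] [b' [Ab' b'0 Aba']]
  |a a' [b [Ab b0 Aba]] [b' [Ab' b'0 Aba']]].
- exact: loc_incl.
- by exists b; rewrite mulrN; split=> //; apply: AN.
- exists (b * b'); rewrite evM // mulf_neq0 //; split=> //; first exact: AM.
  rewrite mulrDr; apply: AD; last by rewrite -mulrA; apply: AM.
  by rewrite (mulrC b) -mulrA; apply: AM.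
exists (b * b'); rewrite evM // mulf_neq0 //; split=> //; first exact: AM.
by rewrite mulrACA; apply: AM.
Qed.

Lemma loc_denom : exists B : L -> L, forall z, loc z -> [/\ A (B z), ev (B z) != 0 & A (B z * z)].
Proof.
exists (fun z => epsilon (inhabits 0) (fun b => [/\ A b, ev b != 0 & A (b * z)])) => z.
exact: epsilon_spec.
Qed.

Lemma loc_eval : exists ev' : L -> kappa, ring_hom_on loc ev' /\ forall a, A a -> ev' a = ev a.
Proof.
have [A1 AN AD AM] := subA; have [ev1 evD evM] := evA; have [B BP] := loc_denom.
pose ev' z := ev (B z * z) / ev (B z).
have ev'E b z : loc z -> A b -> ev b != 0 -> A (b * z) -> ev' z = ev (b * z) / ev b.
  move=> /BP[AB B0 ABz] Ab b0 Abz; apply/eqP; rewrite /ev' eqr_div // -!evM //.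
  by apply/eqP; congr ev; ring.
have [l1 _ lD lM] := loc_subring.
have ev'A a : A a -> ev' a = ev a.
  move=> Aa; rewrite (ev'E 1) ?ev1 ?oner_eq0 ?mul1r ?divr1 //; exact: loc_incl.
exists ev'; split=> //; split=> [|a a' la la'|a a' la la'].
- by rewrite ev'A.
- have [AB B0 ABa] := BP _ la; have [AB' B'0 ABa'] := BP _ la'.
  have E : B a * B a' * (a + a') = B a' * (B a * a) + B a * (B a' * a') by ring.
  have Ab : A (B a' * (B a * a)) by apply: AM.
  have Ab' : A (B a * (B a' * a')) by apply: AM.
  rewrite (ev'E (B a * B a')) ?E //; first last.
  + exact: AD.
  + by rewrite evM ?mulf_neq0.
  + exact: AM.
  + exact: lD.
  rewrite evD // (evM (B a') (B a * a)) // (evM (B a) (B a' * a')) // (evM (B a) (B a')) //.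
  by rewrite /ev'; field; rewrite B0 B'0.
have [AB B0 ABa] := BP _ la; have [AB' B'0 ABa'] := BP _ la'.
have E : B a * B a' * (a * a') = (B a * a) * (B a' * a') by ring.
rewrite (ev'E (B a * B a')) ?E //; first last.
- exact: AM.
- by rewrite evM ?mulf_neq0.
- exact: AM.
- exact: lM.
by rewrite (evM (B a * a)) // (evM (B a) (B a')) // mulf_div.
Qed.

Lemma loc_derivation ev' D : ring_hom_on loc ev' -> (forall a, A a -> ev' a = ev a) ->
    derivation_on A ev D ->
  exists D', derivation_on loc ev' D' /\ forall a, A a -> D' a = D a.
Proof.
move=> [ev'1 ev'D ev'M] ev'A [DD DM]; have [A1 AN AD AM] := subA.
have [_ _ evM] := evA.
have [B BP] := loc_denom; have [l1 _ lD lM] := loc_subring.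
(* The quotient rule for the chosen denominator; [D'E] extends the product rule to every other
   one. *)
pose D' z := (D (B z * z) - ev' z * D (B z)) / ev (B z).
have ev'Ml b z : A b -> loc z -> A (b * z) -> ev (b * z) = ev b * ev' z.
  move=> Ab lz Abz; rewrite -(ev'A _ Abz) ev'M ?(ev'A _ Ab) //.
  exact: loc_incl.
have D'E b z : loc z -> A b -> A (b * z) -> D (b * z) = ev b * D' z + ev' z * D b.
  move=> lz Ab Abz; have [AB B0 ABz] := BP z lz.
  have : D (B z * (b * z)) = D (b * (B z * z)) by congr D; ring.
  rewrite (DM (B z) (b * z)) // (DM b (B z * z)) // (ev'Ml b z) // (ev'Ml (B z) z) // => E.
  have -> : D (b * z) = (ev (B z) * D (b * z)) / ev (B z) by field.
  rewrite (_ : ev (B z) * D (b * z) =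
     ev b * D (B z * z) + ev (B z) * ev' z * D b - ev b * ev' z * D (B z)); last first.
    by rewrite -E; ring.
  by rewrite /D'; field.
have [D'D D'M] : derivation_on loc ev' D'; last first.
  exists D'; split=> // a Aa; have la := loc_incl Aa; have D1 : D 1 = 0.
    have := DM 1 1 A1 A1; rewrite mulr1 -[ev 1]ev'A // ev'1 !mul1r => E.
    by apply: (addrI (D 1)); rewrite addr0 -E.
  by have := D'E 1 a la A1; rewrite mul1r -[ev 1]ev'A // ev'1 D1 mul1r mulr0 addr0 => ->.
split=> a a' la la'; have [AB B0 ABa] := BP _ la; have [AB' B'0 ABa'] := BP _ la'.
  have AC : A (B a * B a') by apply: AM.
  have C0 : ev (B a * B a') != 0 by rewrite evM ?mulf_neq0.
  have ACa : A (B a * B a' * a) by rewrite (mulrC (B a)) -mulrA; apply: AM.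
  have ACa' : A (B a * B a' * a') by rewrite -mulrA; apply: AM.
  have := D'E _ (a + a') (lD _ _ la la') AC; rewrite mulrDr => /(_ (AD _ _ ACa ACa')).
  rewrite DD // (D'E _ a) // (D'E _ a') // ev'D // => E.
  apply: (mulfI C0); apply: (addIr ((ev' a + ev' a') * D (B a * B a'))).
  by rewrite -E; ring.
have AC : A (B a * B a') by apply: AM.
have C0 : ev (B a * B a') != 0 by rewrite evM ?mulf_neq0.
have := D'E _ (a * a') (lM _ _ la la') AC; rewrite mulrACA => /(_ (AM _ _ ABa ABa')).
rewrite (DM (B a * a)) // (ev'Ml (B a) a) // (ev'Ml (B a') a') // (D'E (B a) a) // (D'E (B a') a') //.
rewrite ev'M // (DM (B a) (B a')) // => E.
have CE : ev (B a * B a') = ev (B a) * ev (B a').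
  by rewrite evM.
apply: (mulfI C0); apply: (addIr (ev' a * ev' a' * D (B a * B a'))).
by rewrite (DM (B a) (B a')) // -E CE; ring.
Qed.

End Localization.

Lemma bipoly_ind (K : fieldType) (Pr : {poly {poly K}} -> Prop) :
    (forall c, Pr c%:P%:P) -> Pr 'X%:P -> Pr 'X ->
    (forall P Q, Pr P -> Pr Q -> Pr (P + Q)) ->
    (forall P Q, Pr P -> Pr Q -> Pr (P * Q)) ->
  forall P, Pr P.
Proof.
move=> PrC PrX PrY PrD PrM; have PrP p : Pr p%:P.
  elim/poly_ind: p => [|p c IHp]; first exact: PrC.
  by rewrite polyCD polyCM; apply: (PrD); [apply: PrM | apply: PrC].
elim/poly_ind=> [|P p IHP]; first by rewrite -polyC0; apply: PrP.
by apply: (PrD); [apply: PrM | apply: PrP].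
Qed.

Section HomOnPlane.
Variables (K L kappa : fieldType) (io : {rmorphism K -> L}) (j : {rmorphism K -> kappa}).
Variables (O : L -> Prop) (ev : L -> kappa) (x y : L).
Hypotheses (subO : subring_on O) (evO : ring_hom_on O ev).
Hypotheses (O_K : forall c, O (io c)) (ev_K : forall c, ev (io c) = j c) (Ox : O x) (Oy : O y).

Lemma evXY_on P : O (evXY io x y P) /\ ev (evXY io x y P) = evXY j (ev x) (ev y) P.
Proof.
have [O1 ON OD OM] := subO; have [ev1 evD evM] := evO.
elim/bipoly_ind: P => [c|||P Q [OP EP] [OQ EQ]|P Q [OP EP] [OQ EQ]].
- by rewrite !evXY_const.
- by rewrite !evXY_x.
- by rewrite !evXY_y.
- by rewrite !evXYD evD // EP EQ; split=> //; apply: OD.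
by rewrite !evXYM evM // EP EQ; split=> //; apply: OM.
Qed.

End HomOnPlane.

(* The derivative of P at (x0, y0) in the direction (a, b), computed on the line
   through (x0, y0) instead of with partial derivatives. *)
Definition tangent (K kappa : fieldType) (j : {rmorphism K -> kappa}) (x0 y0 a b : kappa)
    (P : {poly {poly K}}) : kappa :=
  (evXY (polyC \o j : {rmorphism K -> {poly kappa}})
        (x0%:P + a *: 'X) (y0%:P + b *: 'X) P)`_1.

Section Tangent.
Variables (K kappa : fieldType) (j : {rmorphism K -> kappa}) (x0 y0 a b : kappa).
Local Notation T := (evXY (polyC \o j : {rmorphism K -> {poly kappa}})
        (x0%:P + a *: 'X) (y0%:P + b *: 'X)).
Local Notation D := (tangent j x0 y0 a b).

Lemma tangent_coef0 P : (T P)`_0 = evXY j x0 y0 P.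
Proof.
rewrite -horner_coef0 -[LHS]/(horner_eval 0 (T P)) evXY_comp.
rewrite /= !horner_evalE !hornerE.
rewrite !evXYE; congr (_.[_]); apply: eq_map_poly => p /=.
rewrite !horner_evalE; congr (_.[_]); apply: eq_map_poly => c /=.
by rewrite horner_evalE hornerC.
Qed.

Lemma tangentD P Q : D (P + Q) = D P + D Q.
Proof. by rewrite /tangent evXYD coefD. Qed.

Lemma tangentM P Q : D (P * Q) = evXY j x0 y0 P * D Q + evXY j x0 y0 Q * D P.
Proof.
rewrite /tangent evXYM coefM big_ord_recr big_ord1 /= subn0 subnn !tangent_coef0.
by congr (_ + _); rewrite mulrC.
Qed.

Lemma tangent_const c : D c%:P%:P = 0.
Proof. by rewrite /tangent evXY_const coefC. Qed.

Lemma tangent_x : D 'X%:P = a.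
Proof. by rewrite /tangent evXY_x coefD coefC coefZ coefX add0r mulr1. Qed.

Lemma tangent_y : D 'X = b.
Proof. by rewrite /tangent evXY_y coefD coefC coefZ coefX add0r mulr1. Qed.

Lemma tangent_polyx p : D p%:P = (map_poly j p)^`().[x0] * a.
Proof.
elim/poly_ind: p => [|p c IHp]; first by rewrite tangent_const map_poly0 deriv0 horner0 mul0r.
rewrite polyCD polyCM tangentD tangentM tangent_const tangent_x IHp evXY_x evXY_polyC.
rewrite rmorphD rmorphM /= map_polyX map_polyC derivD derivM derivX derivC /=.
by rewrite !hornerE /=; ring.
Qed.

Lemma tangent_yn n : D ('X ^+ n.+1) = y0 ^+ n * b *+ n.+1.
Proof.
elim: n => [|n IHn]; first by rewrite expr1 tangent_y expr0 mul1r.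
rewrite exprS tangentM IHn tangent_y evXYX evXY_y exprS -[RHS]mulr_natr -mulr_natr.
by rewrite -[n.+2]addn1 natrD; ring.
Qed.

Lemma tangent_curve (q : nat) (f : {poly K}) : (0 < q)%N ->
  D (('X^q : {poly {poly K}}) - f%:P) = y0 ^+ q.-1 * b *+ q - (map_poly j f)^`().[x0] * a.
Proof.
case: q => // q _; rewrite tangentD tangent_yn; congr (_ + _).
have -> : - f%:P = (-1)%:P%:P * f%:P :> {poly {poly K}} by rewrite !polyCN mulN1r.
by rewrite tangentM tangent_const mulr0 addr0 evXY_const rmorphN1 tangent_polyx mulN1r.
Qed.

End Tangent.

(** * Local rings of a plane curve and the Jacobian criterion *)

Section LocalRing.
Variables (K L kappa : fieldType) (io : {rmorphism K -> L}) (j : {rmorphism K -> kappa}).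
Variables (A : L -> Prop) (ev : L -> kappa).
Hypotheses (subA : subring_on A) (evA : ring_hom_on A ev).
Hypotheses (A_K : forall c, A (io c)) (ev_K : forall c, ev (io c) = j c).
Variables (x y : L) (f : {poly K}) (q : nat) (x0 y0 : kappa).
Hypotheses (q_gt0 : (0 < q)%N) (emb : plane_embedding io x y f q).

(** Half of an identification of the local ring of [A] at [ev] with that of the plane curve at (x0,
    y0): K[x, y] maps into the former. The other half is [local_cover]. *)
Definition local_coord : Prop := exists h,
  [/\ A h, ev h != 0, A (h * x), A (h * y) & ev (h * x) = ev h * x0 /\ ev (h * y) = ev h * y0].

Definition local_cover : Prop := forall z, A z -> exists P H : {poly {poly K}},
  evXY j x0 y0 H != 0 /\ z * evXY io x y H = evXY io x y P.

Hypothesis coord : local_coord.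

Lemma local_hom : exists ev',
  [/\ ring_hom_on (loc A ev) ev', forall a, A a -> ev' a = ev a,
      [/\ loc A ev x, loc A ev y, ev' x = x0 & ev' y = y0]
    & forall P, loc A ev (evXY io x y P) /\ ev' (evXY io x y P) = evXY j x0 y0 P].
Proof.
have [h [Ah h0 Ahx Ahy [Ex Ey]]] := coord.
have [ev' [ev'H ev'A]] := loc_eval subA evA; have [_ _ ev'M] := ev'H.
have lx : loc A ev x by exists h.
have ly : loc A ev y by exists h.
have lh : loc A ev h by apply: loc_incl.
have x0E : ev' x = x0.
  by apply: (mulfI h0); rewrite -Ex -[ev h]ev'A // -ev'M // ev'A.
have y0E : ev' y = y0.
  by apply: (mulfI h0); rewrite -Ey -[ev h]ev'A // -ev'M // ev'A.
exists ev'; split=> // P; rewrite -x0E -y0E.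
apply: (evXY_on (loc_subring subA evA) ev'H) => // c; first exact: loc_incl.
by rewrite ev'A.
Qed.

Lemma local_curve : y0 ^+ q = (map_poly j f).[x0].
Proof.
have [ev' [ev'H ev'A _ evE]] := local_hom; have [Dy _] := emb.
have [_ E] := evE ('X^q - f%:P); move: E; rewrite !evXY_curve Dy subrr => E.
apply/eqP; rewrite -subr_eq0 -E ev'A; last first.
  by have := A_K 0; rewrite rmorph0.
by rewrite -(rmorph0 io) ev_K rmorph0.
Qed.

Hypotheses (sep_f : separable_poly f) (q_nz : q%:R != 0 :> kappa) (cover : local_cover).

(** The vector (al, be) lies in the kernel of the differential q y0^(q - 1) dy - f'(x0) dx of the
    equation, and spans it by [tangent_neq0]. *)
Let al := q%:R * y0 ^+ q.-1.
Let be := (map_poly j f)^`().[x0].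

(** If y0 = 0 then f(x0) = 0, and separability gives f'(x0) != 0; otherwise q y0^(q - 1) is
    invertible. *)
Lemma tangent_neq0 : al != 0 \/ be != 0.
Proof.
have [y00 | y00] := eqVneq y0 0; last by left; rewrite mulf_neq0 ?expf_neq0.
right; have := local_curve; rewrite y00 expr0n gtn_eqF // => /esym/eqP fx0.
have := separable_map j f; rewrite sep_f separable_poly.unlock.
by move/coprimep_root => /(_ x0 fx0).
Qed.

(* The regular functions P / H at the point, with the tangent derivation. *)
Lemma tangent_derivation : exists (O : L -> Prop) (ev0 D0 : L -> kappa),
  [/\ [/\ subring_on O, ring_hom_on O ev0, derivation_on O ev0 D0
        & forall a, A a -> O a /\ ev0 a = ev a],
      forall P, O (evXY io x y P),
      forall P, ev0 (evXY io x y P) = evXY j x0 y0 P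
    & forall P, D0 (evXY io x y P) = tangent j x0 y0 al be P].
Proof.
pose R z := exists P, z = evXY io x y P.
have subR : subring_on R.
  split=> [|a [P ->]|a b [P ->] [Q ->]|a b [P ->] [Q ->]].
  - by exists 1; rewrite evXY1.
  - by exists (0 - P); rewrite evXYB evXY0 sub0r.
  - by exists (P + Q); rewrite evXYD.
  by exists (P * Q); rewrite evXYM.
have RP P : R (evXY io x y P) by exists P.
have [num numP] : exists num : L -> {poly {poly K}}, forall z, R z -> z = evXY io x y (num z).
  exists (fun z => epsilon (inhabits 0) (fun P => z = evXY io x y P)) => z.
  exact: epsilon_spec.
have rel P : evXY io x y P = 0 -> exists Q, P = Q * ('X^q - f%:P).
  by move/(model_rel q_gt0 emb).
(* An additive function that vanishes on the multiples of the equation does not depend on the chosen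
   representative. *)
have wd (E : {poly {poly K}} -> kappa) : (forall P Q, E (P + Q) = E P + E Q) ->
    (forall Q, E (Q * ('X^q - f%:P)) = 0) ->
    forall P, E (num (evXY io x y P)) = E P.
  move=> ED Eh P; have [|Q DQ] := rel (num (evXY io x y P) - P).
    by rewrite evXYB -numP ?subrr.
  by rewrite -(subrK P (num _)) DQ ED Eh add0r.
have hom_h : evXY j x0 y0 ('X^q - f%:P) = 0 by rewrite evXY_curve local_curve subrr.
have tan_h : tangent j x0 y0 al be ('X^q - f%:P) = 0.
  rewrite tangent_curve // -mulr_natl /al /be; ring.
pose evR z := evXY j x0 y0 (num z); pose DR z := tangent j x0 y0 al be (num z).
have evRE P : evR (evXY io x y P) = evXY j x0 y0 P.
  by rewrite /evR wd // => [P' Q|Q]; rewrite ?evXYD // evXYM hom_h mulr0.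
have DRE P : DR (evXY io x y P) = tangent j x0 y0 al be P.
  by rewrite /DR wd // => [P' Q|Q]; rewrite ?tangentD // tangentM tan_h hom_h mulr0 mul0r addr0.
have evRH : ring_hom_on R evR.
  split=> [|a b [P ->] [Q ->]|a b [P ->] [Q ->]].
  - by rewrite -(evXY1 io x y) evRE evXY1.
  - by rewrite -evXYD !evRE evXYD.
  by rewrite -evXYM !evRE evXYM.
have DRD : derivation_on R evR DR.
  split=> a b [P ->] [Q ->].
    by rewrite -evXYD !DRE tangentD.
  by rewrite -evXYM !DRE !evRE tangentM.
have [ev0 [ev0H ev0R]] := loc_eval subR evRH.
have [D0 [D0H D0R]] := loc_derivation subR evRH ev0H ev0R DRD.
have ev0E P : ev0 (evXY io x y P) = evXY j x0 y0 P by rewrite ev0R ?evRE.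
exists (loc R evR), ev0, D0; split=> [|P|//|P].
- split=> //; first exact: loc_subring.
  move=> a Aa; have [P [H [H0 DzH]]] := cover Aa.
  have la : loc R evR a.
    by exists (evXY io x y H); rewrite evRE mulrC DzH.
  split=> //; apply: (mulIf H0).
  have [ev' [[_ _ ev'M] ev'A _ evE]] := local_hom.
  have [lH EH] := evE H; have [lP EP] := evE P.
  have [_ _ ev0M] := ev0H.
  rewrite -{1}ev0E -ev0M //; last exact: loc_incl.
  rewrite DzH ev0E -EP -DzH ev'M ?(ev'A _ Aa) ?EH //.
  exact: loc_incl.
- exact: loc_incl.
by rewrite D0R ?DRE.
Qed.

(** A derivation of [A] extends to the local ring and is determined by its values at x and y;
    differentiating the equation confines these to the line spanned by (al, be). *)
Theorem smooth_at_point : exists D0 : L -> kappa,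
  [/\ derivation_on A ev D0 /\ (forall c, D0 (io c) = 0),
      exists2 a, A a & D0 a != 0
    & forall D, derivation_on A ev D -> (forall c, D (io c) = 0) ->
        exists c, forall a, A a -> D a = c * D0 a].
Proof.
have [O [ev0 [D0 [[subO ev0H [D0D D0M] AO] OP ev0E D0E]]]] := tangent_derivation.
have [h [Ah h0 Ahx Ahy _]] := coord.
have ev0x : ev0 x = x0 by rewrite -(evXY_x io x y) ev0E evXY_x.
have ev0y : ev0 y = y0 by rewrite -(evXY_y io x y) ev0E evXY_y.
have Ox : O x by rewrite -(evXY_x io x y).
have Oy : O y by rewrite -(evXY_y io x y).
have D0x : D0 x = al by rewrite -(evXY_x io x y) D0E tangent_x.
have D0y : D0 y = be by rewrite -(evXY_y io x y) D0E tangent_y.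
exists D0; split.
- split; last by move=> c; rewrite -(evXY_const io x y) D0E tangent_const.
  split=> a b Aa Ab; have [Oa Ea] := AO a Aa; have [Ob Eb] := AO b Ab.
    exact: D0D.
  by rewrite D0M // Ea Eb.
(* x and y are quotients of elements of [A], so a [D0] vanishing on [A] would make both [al] and
   [be] zero. *)
- apply: NNPP => none; have D0A a : A a -> D0 a = 0.
    by move=> Aa; apply/eqP/negPn/negP => Da; apply: none; exists a.
  have [Oh Eh] := AO h Ah.
  have zero t : O t -> A (h * t) -> D0 t = 0.
    move=> Ot Aht; have := D0M h t Oh Ot; rewrite (D0A (h * t)) // (D0A h) //.
    rewrite mulr0 addr0 Eh => /esym/eqP.
    by rewrite mulf_eq0 (negPf h0) => /eqP.
  by case: tangent_neq0 => /eqP[]; [rewrite -D0x zero | rewrite -D0y zero].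
move=> D DA DK; have [ev' [ev'H ev'A [lx ly ex ey] evE]] := local_hom.
have [D' [[D'D D'M] D'A]] := loc_derivation subA evA ev'H ev'A DA.
have lK c : loc A ev (io c) by apply: loc_incl.
have D'E a b : D' x = a -> D' y = b -> forall P, D' (evXY io x y P) = tangent j x0 y0 a b P.
  move=> Dx Dy; elim/bipoly_ind=> [c|||P Q IP IQ|P Q IP IQ].
  - by rewrite evXY_const tangent_const D'A.
  - by rewrite evXY_x tangent_x.
  - by rewrite evXY_y tangent_y.
  - by rewrite evXYD tangentD D'D ?IP ?IQ //; case: (evE P); case: (evE Q).
  have [lP EP] := evE P; have [lQ EQ] := evE Q.
  by rewrite evXYM tangentM D'M // IP IQ EP EQ.
have rel : q%:R * y0 ^+ q.-1 * D' y = be * D' x.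
  have := D'E _ _ erefl erefl ('X^q - f%:P); have [Dy _] := emb.
  rewrite evXY_curve Dy subrr tangent_curve // -mulr_natl.
  have -> : D' 0 = 0 by rewrite -(rmorph0 io) D'A ?DK.
  by move=> /eqP; rewrite eq_sym subr_eq0 mulrA => /eqP.
have [c [cx cy]] : exists c, D' x = c * al /\ D' y = c * be.
  have [al0 | al0] := eqVneq al 0.
    have be0 : be != 0 by case: tangent_neq0 => //; rewrite al0 eqxx.
    exists (D' y / be); split; last by rewrite divfK.
    rewrite al0 mulr0; apply: (mulfI be0); rewrite -rel -/al al0 mul0r mulr0 //.
  exists (D' x / al); rewrite divfK //; split=> //.
  by apply: (mulfI al0); rewrite rel; field.
exists c => z Az; have [P [H [H0 DzH]]] := cover Az.
have [Oz Ez] := AO z Az; have lz := loc_incl subA evA Az.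
have cE Q : D' (evXY io x y Q) = c * D0 (evXY io x y Q).
  rewrite D0E (D'E _ _ cx cy); elim/bipoly_ind: Q => [c'|||Q Q' IQ IQ'|Q Q' IQ IQ'].
  - by rewrite !tangent_const mulr0.
  - by rewrite !tangent_x.
  - by rewrite !tangent_y.
  - by rewrite !tangentD IQ IQ' mulrDr.
  by rewrite !tangentM IQ IQ'; ring.
have [lH EH] := evE H.
have := cE P; rewrite -DzH D'M // D0M // cE ev'A // Ez ev0E EH D'A // => E.
apply: (mulfI H0); apply: (addrI (ev z * (c * D0 (evXY io x y H)))).
by rewrite E; ring.
Qed.

End LocalRing.

(** * Charts at infinity *)

Definition reverse_poly (F : fieldType) (n : nat) (f : {poly F}) : {poly F} :=
  \poly_(i < n.+1) f`_(n - i).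

Lemma map_reverse_poly (F E : fieldType) (j : {rmorphism F -> E}) n f :
  map_poly j (reverse_poly n f) = reverse_poly n (map_poly j f).
Proof.
apply/polyP=> i; rewrite coef_map /= [X in j X]coef_poly [RHS]coef_poly coef_map.
by case: ifP => // _; apply: rmorph0.
Qed.

Lemma horner_reverse_poly (F : fieldType) n (f : {poly F}) t : (size f <= n.+1)%N -> t != 0 ->
  (reverse_poly n f).[t] = t ^+ n * f.[t^-1].
Proof.
move=> szf t0; rewrite -[t ^+ n]mul1r -horner_reverse //; congr (_.[_]).
by apply/polyP=> i; rewrite !coef_poly mul1r.
Qed.

Lemma reverse_poly0 (F : fieldType) n (f : {poly F}) : (reverse_poly n f).[0] = f`_n.
Proof. by rewrite horner_coef0 coef_poly subn0. Qed.

(** The derivative of X^n f(1/X), multiplied by X to avoid negative exponents. *)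
Lemma deriv_reverse_poly (F : fieldType) n (f : {poly F}) : (size f <= n.+1)%N ->
  'X * (reverse_poly n f)^`() + reverse_poly n.-1 f^`() = n%:R *: reverse_poly n f.
Proof.
move=> szf; apply/polyP=> i; rewrite coefD coefXM coef_deriv coefZ.
rewrite [(reverse_poly n.-1 _)`_i]coef_poly coef_deriv.
case: n szf => [|n] szf /=.
  rewrite mul0r ltnS leqn0 sub0n [f`_1]nth_default // mul0rn.
  case: i => [|i] /=; rewrite ?addr0 //.
  by rewrite coef_poly mul0rn.
rewrite [(reverse_poly n.+1 f)`_i]coef_poly; case: i => [|i] /=.
  by rewrite add0r !subn0 mulr_natl.
rewrite coef_poly !ltnS; case: ltngtP => [lt_in | lt_ni | ->].
- by rewrite subSS subnSK // -mulrnDr mulr_natl addSn subnKC // ltnW.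
- by rewrite mul0rn mulr0 addr0.
by rewrite addr0 mulr_natl.
Qed.

Lemma reverse_poly_eq0 (F : fieldType) n (f : {poly F}) :
  (size f <= n.+1)%N -> reverse_poly n f = 0 -> f = 0.
Proof.
move=> szf f0; apply/polyP=> i; rewrite coef0.
have [le_in | lt_ni] := leqP i n; last by rewrite nth_default // (leq_trans szf).
have := congr1 (fun p : {poly F} => p`_(n - i)) f0.
by rewrite coef_poly coef0 ltnS leq_subr subKn.
Qed.

(** A multiple root t of the reversed polynomial is nonzero, the value at 0 being the leading
    coefficient of f; then 1/t is a multiple root of f. *)
Lemma separable_reverse (F : fieldType) n (f : {poly F}) : size f = n.+1 ->
  separable_poly f -> separable_poly (reverse_poly n f).
Proof.
move=> szf; rewrite !separable_poly.unlock => cop; apply/negPn/negP => ncop.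
set g := reverse_poly n f in ncop.
have g0 : g != 0.
  apply/eqP => g0; have := reverse_poly_eq0 _ g0; rewrite szf => /(_ (leqnn _)) f0.
  by move: szf; rewrite f0 size_poly0.
have gcd_gt1 : (1 < size (gcdp g g^`()))%N.
  by rewrite ltn_neqAle eq_sym ncop size_poly_gt0 gcdp_eq0 negb_and g0.
have [p irr_p p_dvd] := irreducible_factor gcd_gt1.
have [L [i [t [pt0 _]]]] := adjoin_root irr_p.
have root_dvd h : gcdp g g^`() %| h -> (map_poly i h).[t] = 0.
  by move=> dvd; apply/rootP/(root_dvdp _ pt0); rewrite dvdp_map (dvdp_trans p_dvd).
have gt0 := root_dvd _ (dvdp_gcdl _ _); have dgt0 := root_dvd _ (dvdp_gcdr _ _).
have szif : (size (map_poly i f) <= n.+1)%N by rewrite size_map_poly szf.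
have t0 : t != 0.
  apply: contraTneq isT => t0; move/eqP: gt0; rewrite t0 map_reverse_poly reverse_poly0.
  rewrite coef_map fmorph_eq0 -[n]/n.+1.-1 -szf -lead_coefE lead_coef_eq0.
  by rewrite -size_poly_eq0 szf.
have fs0 : (map_poly i f).[t^-1] = 0.
  apply/eqP; move/eqP: gt0; rewrite map_reverse_poly horner_reverse_poly // mulf_eq0.
  by rewrite expf_eq0 (negPf t0) andbF.
have dfs0 : (map_poly i f)^`().[t^-1] = 0.
  have szdf : (size (map_poly i f)^`() <= n.-1.+1)%N.
    by rewrite (leq_trans (size_poly _ _)) // size_map_poly szf; case: (n).
  have := congr1 (fun h => (map_poly i h).[t]) (deriv_reverse_poly (eq_leq szf)).
  rewrite rmorphD rmorphM hornerD hornerM /= dgt0 mulr0 add0r map_polyZ hornerZ gt0 mulr0.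
  rewrite map_reverse_poly -deriv_map horner_reverse_poly // => /eqP.
  by rewrite mulf_eq0 expf_eq0 (negPf t0) andbF => /eqP.
have := coprimep_root (etrans (coprimep_map i f f^`()) cop) (introT rootP fs0).
by rewrite -deriv_map dfs0 eqxx.
Qed.

Section ModelSwap.
Variables (K L : fieldType) (io : {rmorphism K -> L}) (x y : L) (f : {poly K}) (q m : nat).
Hypotheses (q_gt0 : (0 < q)%N) (szf : (size f <= (q * m).+1)%N).
Hypothesis model : plane_model io x y f q.

Lemma model_x_neq0 : x != 0.
Proof.
have [emb _] := model; have := model_polyx_neq0 q_gt0 emb (negbT (polyX_eq0 K)).
by rewrite map_polyX hornerX.
Qed.

(* P(1/x, y/x^m), cleared of denominators. *)
Definition swap_bipoly (B : nat) (P : {poly {poly K}}) : {poly {poly K}} :=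
  \poly_(i < q) (reverse_poly B P`_i * 'X^(m * (q - i))).

Lemma evXY_swap B (P : {poly {poly K}}) (x1 y1 : L) : x1 != 0 ->
  (size P <= q)%N -> (forall i, (size (P`_i)%R <= B.+1)%N) ->
  evXY io x1 y1 (swap_bipoly B P) =
  x1 ^+ B * x1 ^+ (m * q) * evXY io x1^-1 (y1 / x1 ^+ m) P.
Proof.
move=> x10 szP szB; rewrite (evXY_sum _ _ _ (size_poly _ _)) (evXY_sum _ _ _ szP) mulr_sumr.
apply: eq_bigr => i _; rewrite coef_poly ltn_ord rmorphM hornerM /= map_reverse_poly.
rewrite horner_reverse_poly ?size_map_poly // map_polyXn hornerXn.
have -> : (m * q = m * (q - i) + m * i)%N.
  by rewrite -mulnDr subnK // ltnW.
rewrite exprD expr_div_n -exprM; field.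
by rewrite expf_neq0.
Qed.

Lemma size_swap_bipoly (B : nat) (P : {poly {poly K}}) : (size (swap_bipoly B P) <= q)%N.
Proof. exact: size_poly. Qed.

Lemma coef_bound (P : {poly {poly K}}) (Q : {poly K}) :
  exists B, (forall i, (size (P`_i)%R <= B.+1)%N) /\ (size Q <= B.+1)%N.
Proof.
exists (size Q + \max_(i < size P) size (P`_i)%R)%N; split=> [i|]; last by rewrite leqW ?leq_addr.
have [lt_i | le_i] := ltnP i (size P); last by rewrite [P`_i]nth_default ?size_poly0.
rewrite leqW // (leq_trans _ (leq_addl _ _)) //.
exact: (leq_bigmax (Ordinal lt_i) (F := fun i : 'I__ => size (P`_i)%R)).
Qed.

(** Divide y^q = f(x) by x^(q m). A relation between 1/x and y/x^m, cleared of denominators by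
    [swap_bipoly], becomes one between x and y. *)
Lemma model_swap : plane_model io x^-1 (y / x ^+ m) (reverse_poly (q * m) f) q.
Proof.
have [[Dy free] gen] := model; have x0 := model_x_neq0.
have xV0 : x^-1 != 0 by rewrite invr_eq0.
have yE : y = (y / x ^+ m) / x^-1 ^+ m by rewrite exprVn invrK divfK // expf_neq0.
split; first split=> [|P szP P0].
- rewrite map_reverse_poly horner_reverse_poly ?size_map_poly // invrK -Dy.
  by rewrite expr_div_n -exprM mulrC exprVn (mulnC m).
- have [B [szB _]] := coef_bound P 0.
  have sw0 : swap_bipoly B P = 0.
    by apply: free (size_swap_bipoly _ _) _; rewrite evXY_swap // P0 mulr0.
  apply/polyP=> i; rewrite coef0; have [lt_i | le_i] := ltnP i q; last first.
    by rewrite nth_default // (leq_trans szP).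
  have := congr1 (fun R : {poly {poly K}} => R`_i) sw0; rewrite coef_poly lt_i coef0 => /eqP.
  rewrite mulf_eq0 expf_eq0 polyX_eq0 andbF orbF => /eqP.
  exact: reverse_poly_eq0.
move=> z; have [emb _] := model.
have [P [Q [szP Q0 Dz]]] := model_gen_reduced q_gt0 emb z model.
have [B [szB szQ]] := coef_bound P Q.
exists (swap_bipoly B P), (reverse_poly B Q * 'X^(m * q)).
have Qx0 := model_polyx_neq0 q_gt0 emb Q0.
rewrite evXY_swap // invrK -yE rmorphM hornerM /= map_polyXn hornerXn.
rewrite map_reverse_poly horner_reverse_poly ?size_map_poly // invrK.
split; first by rewrite !mulf_neq0 ?expf_neq0.
by rewrite Dz; field; rewrite Qx0 !expf_neq0.
Qed.

End ModelSwap.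

Section ChartRing.
Variables (K L : fieldType) (io : {rmorphism K -> L}) (a b : L).

Fact chart_ring_key : unit. Proof. by []. Qed.

Definition chart_ring : L -> Prop := locked_with chart_ring_key (integralOver (evXY io a b)).

Lemma chart_ringE z : chart_ring z <-> integralOver (evXY io a b) z.
Proof. by rewrite /chart_ring unlock. Qed.

Lemma chart_ring_ev P : chart_ring (evXY io a b P).
Proof. by apply/chart_ringE; apply: integral_id. Qed.

Lemma chart_ring_subring : subring_on chart_ring.
Proof.
split=> [|c /chart_ringE cA|c c' /chart_ringE cA /chart_ringE c'A|c c' /chart_ringE cA /chart_ringE c'A].
- by apply/chart_ringE; apply: integral1.
- by apply/chart_ringE; apply: integral_opp.
- by apply/chart_ringE; apply: integral_add.
by apply/chart_ringE; apply: integral_mul.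
Qed.

Lemma chart_ring_root (p : {poly L}) c : p \is monic -> root p c ->
  (forall i, chart_ring p`_i) -> chart_ring c.
Proof.
move=> mon_p pc pA; apply/chart_ringE; apply: (integral_root_monic mon_p pc).
by apply/integral_poly => i; apply/chart_ringE.
Qed.

End ChartRing.

(** * Charts of the plane closure and the two affine models *)

Section Cover.
Variables (K L kappa : fieldType) (io : {rmorphism K -> L}) (j : {rmorphism K -> kappa}).
Variables (x y a b : L) (f : {poly K}) (q : nat) (zeta : K) (x0 y0 : kappa).
Hypotheses (q_pr : prime q) (model : plane_model io x y f q) (sep_f : separable_poly f).
Hypotheses (zetaP : q.-primitive_root zeta) (q_nz : q%:R != 0 :> K).

(* The chart of a and b becomes a subring of K[x, y] after inverting H. *)
Lemma local_cover_of_gens (H Pa Pb : {poly {poly K}}) : evXY j x0 y0 H != 0 ->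
    evXY io x y H * a = evXY io x y Pa -> evXY io x y H * b = evXY io x y Pb ->
  local_cover io j (chart_ring io a b) x y x0 y0.
Proof.
move=> H0 Da Db z /chart_ringE[p mon_p pz]; set h := evXY io x y H in Da Db.
(* Stated for all large [e], since sums require a common exponent. *)
have clear P : exists D, forall e, (D <= e)%N -> exists R, h ^+ e * evXY io a b P = evXY io x y R.
  elim/bipoly_ind: P => [c|||P Q [D DP] [D' DQ]|P Q [D DP] [D' DQ]].
  - exists 0%N => e _; exists (H ^+ e * c%:P%:P).
    by rewrite evXYM evXYX !evXY_const.
  - exists 1%N => -[//|e] _; exists (H ^+ e * Pa).
    by rewrite evXY_x evXYM evXYX -Da exprSr mulrA.
  - exists 1%N => -[//|e] _; exists (H ^+ e * Pb).
    by rewrite evXY_y evXYM evXYX -Db exprSr mulrA.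
  - exists (D + D')%N => e le_e; have [|R DR] := DP e; first by lia.
    have [|R' DR'] := DQ e; first by lia.
    by exists (R + R'); rewrite !evXYD mulrDr DR DR'.
  exists (D + D')%N => e le_e; have [R DR] := DP D (leqnn D).
  have [|R' DR'] := DQ (e - D)%N; first by lia.
  exists (R * R'); rewrite !evXYM -DR -DR' -{1}(subnKC (_ : D <= e)%N) ?exprD; last by lia.
  ring.
have [D DD] : exists D, forall i, exists R, h ^+ D * evXY io a b p`_i = evXY io x y R.
  have /fin_all_exists[D DP] := fun i : 'I_(size p) => clear p`_i.
  exists (\sum_i D i)%N => i; have [lt_i | le_i] := ltnP i (size p); last first.
    by exists 0; rewrite nth_default // !evXY0 mulr0.
  have [|R ->] := DP (Ordinal lt_i) (\sum_i D i)%N; last by exists R.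
  by rewrite (bigD1 (Ordinal lt_i)) //= leq_addr.
have szp : size p = (size p).-1.+1 by rewrite prednK // size_poly_gt0 monic_neq0.
set n := (size p).-1 in szp; pose g := h ^+ D.
(* The monic equation of g z: each lower coefficient carries g^(n - i) with n - i > 0, enough to
   clear its denominator. *)
pose p' := 'X^n + \poly_(i < n) (g ^+ (n - i) * evXY io a b p`_i).
have mon_p' : p' \is monic.
  rewrite monicE lead_coefDl ?lead_coefXn // size_polyXn ltnS.
  exact: size_poly.
have p'z : root p' (g * z).
  rewrite rootE hornerD hornerXn horner_poly.
  have /rootP := pz; rewrite (@horner_coef_wide _ n.+1); last by rewrite -szp size_poly.
  rewrite big_ord_recr /= coef_map /= -/(lead_coef p) (monicP mon_p) evXY1 mul1r.
  move=> /(congr1 ( *%R (g ^+ n))); rewrite mulr0 mulrDr => pz0; apply/eqP.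
  rewrite exprMn addrC -[RHS]pz0.
  congr (_ + _); rewrite mulr_sumr; apply: eq_bigr => i _; rewrite coef_map exprMn.
  have -> : g ^+ n = g ^+ (n - i) * g ^+ i by rewrite -exprD subnK // ltnW.
  by rewrite mulrACA.
have int_gz : integralOver (evXY io x y) (g * z).
  apply: (integral_root_monic mon_p' p'z); apply/integral_poly => i.
  rewrite coefD coefXn coef_poly; apply: integral_add.
    by case: eqP => _; [apply: integral1 | apply: integral0].
  case: ltnP => [lt_i | _]; last exact: integral0.
  have [R DR] := DD i; rewrite -(prednK (_ : 0 < n - i)%N) ?subn_gt0 // exprSr -mulrA.
  rewrite -/g in DR; rewrite DR; apply: integral_mul; last exact: integral_id.
  by apply/integral_exp/integral_exp/integral_id.
have [R DR] := plane_ring_integrally_closed q_pr model sep_f zetaP q_nz int_gz.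
exists R, (H ^+ D); rewrite !evXYX expf_neq0 //; split=> //.
by rewrite mulrC -DR.
Qed.

End Cover.

Section Charts.
Variables (K L kappa : fieldType) (io : {rmorphism K -> L}) (j : {rmorphism K -> kappa}).
Variables (x y : L) (f : {poly K}) (q m : nat) (zeta : K).
Hypotheses (q_pr : prime q) (m_gt0 : (0 < m)%N).
Hypotheses (model : plane_model io x y f q) (sep_f : separable_poly f).
Hypotheses (zetaP : q.-primitive_root zeta) (q_nz : q%:R != 0 :> K).
Hypothesis szf : size f = (q * m).+1.

Local Notation u := x^-1.
Local Notation z := (y / x ^+ m).
Local Notation fr := (reverse_poly (q * m) f).

Let q_gt0 : (0 < q)%N := prime_gt0 q_pr.
Let modelr : plane_model io u z fr q := model_swap q_gt0 (eq_leq szf) model.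
Let sep_fr : separable_poly fr := separable_reverse szf sep_f.
Let x0 : x != 0 := model_x_neq0 q_gt0 model.

Lemma model_y_neq0 : y != 0.
Proof.
have [[_ free] _] := model; apply/eqP => y0.
have := free 'X; rewrite size_polyX evXY_y => /(_ (prime_gt1 q_pr) y0) /eqP.
by rewrite polyX_eq0.
Qed.

Lemma reverse_at0 : (map_poly j fr).[0] != 0.
Proof.
rewrite map_reverse_poly reverse_poly0 coef_map fmorph_eq0.
by rewrite -[X in f`_X]/(q * m).+1.-1 -szf -lead_coefE lead_coef_eq0 -size_poly_eq0 szf.
Qed.

Section Chart.
Variables (a b : L) (ev : L -> kappa).
Local Notation A := (chart_ring io a b).
Hypothesis evA : ring_hom_on A ev.
Hypothesis ev_K : forall c, ev (io c) = j c.

Lemma chart_const c : A (io c).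
Proof. by rewrite -(evXY_const io a b); apply: chart_ring_ev. Qed.

Lemma chart_a : A a.
Proof. by rewrite -[X in chart_ring _ _ _ X](evXY_x io a b); apply: chart_ring_ev. Qed.

Lemma chart_b : A b.
Proof. by rewrite -[X in chart_ring _ _ _ X](evXY_y io a b); apply: chart_ring_ev. Qed.

Lemma chart_ev P : ev (evXY io a b P) = evXY j (ev a) (ev b) P.
Proof. by case: (evXY_on (chart_ring_subring io a b) evA chart_const ev_K chart_a chart_b P). Qed.

Lemma chart_exp c n : A c -> A (c ^+ n).
Proof.
have [A1 _ _ AM] := chart_ring_subring io a b => Ac.
by elim: n => [|n IHn]; rewrite ?expr0 ?exprS //; apply: AM.
Qed.

Lemma chart_X c n : A c -> ev (c ^+ n) = ev c ^+ n.
Proof.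
have [ev1 _ evM] := evA => Ac; elim: n => [|n IHn]; first by rewrite !expr0.
by rewrite !exprS evM ?IHn //; apply: chart_exp.
Qed.

Lemma chart_monic_root n (c : L) (e : nat -> L) : (forall l, A (e l)) ->
  c ^+ n = \sum_(l < n) e l * c ^+ l -> A c.
Proof.
have [A1 AN AD _] := chart_ring_subring io a b => Ae Dc.
have A0 : A 0 by rewrite -(subrr 1); apply: AD => //; apply: AN.
apply: (@chart_ring_root _ _ _ _ _ ('X^n - \poly_(l < n) e l)).
- by rewrite monicE lead_coefDl ?lead_coefXn // size_polyN size_polyXn ltnS size_poly.
- by rewrite rootE hornerD hornerN hornerXn horner_poly Dc subrr.
move=> i; rewrite coefB coefXn coef_poly; apply: AD; first by case: eqP.
by apply: AN; case: ifP.
Qed.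

Lemma chart_root c n : (0 < n)%N -> A (c ^+ n) -> A c.
Proof.
have [A1 AN AD _] := chart_ring_subring io a b => n_gt0 Ac.
have A0 : A 0 by rewrite -(subrr 1); apply: AD => //; apply: AN.
apply: (@chart_monic_root n c (fun l => if l == 0%N then c ^+ n else 0)) => [l|].
  by case: eqP.
case: n n_gt0 {Ac} => // n _; rewrite big_ord_recl /= expr0 mulr1 big1 ?addr0 // => l _.
by rewrite mul0r.
Qed.

(** The alternatives are the smooth models y^q = f(x) and z^q = fr(u). The plane closure itself can
    be singular at infinity, so its charts are compared with these after normalization. *)
Definition chart_data : Prop :=
  (exists x1 y1, local_coord A ev x y x1 y1 /\ local_cover io j A x y x1 y1) \/
  (exists x1 y1, local_coord A ev u z x1 y1 /\ local_cover io j A u z x1 y1).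

End Chart.

Lemma chart1_data ev : ring_hom_on (chart_ring io x y) ev ->
  (forall c, ev (io c) = j c) -> chart_data x y ev.
Proof.
move=> evA ev_K; left; exists (ev x), (ev y); have [ev1 _ _] := evA; split.
  exists 1; rewrite !mul1r ev1 oner_eq0 !mul1r; split=> //; first by case: (chart_ring_subring io x y).
    exact: chart_a.
  exact: chart_b.
apply: (@local_cover_of_gens _ _ _ io j x y x y f q zeta _ _ q_pr model sep_f zetaP q_nz 1 'X%:P 'X).
- by rewrite evXY1 oner_eq0.
- by rewrite evXY1 mul1r evXY_x.
by rewrite evXY1 mul1r evXY_y.
Qed.

(** The inverse of z = u^(m - 1) (y/x) has denominator u^(m - 1). This is nonzero at the point:
    otherwise u and z would both vanish there, whereas z^q = fr(0) != 0 at u = 0. *)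
Lemma chart2_data ev : ring_hom_on (chart_ring io u (y / x)) ev ->
  (forall c, ev (io c) = j c) -> chart_data u (y / x) ev.
Proof.
move=> evA ev_K; right; have [ev1 _ evM] := evA.
have Au := chart_a u (y / x).
have zE : z = u ^+ m.-1 * (y / x).
  by rewrite -{1}(prednK m_gt0) exprVn exprS; field; rewrite x0 expf_neq0.
have zev : z = evXY io u (y / x) ('X%:P ^+ m.-1 * 'X).
  by rewrite evXYM evXYX evXY_x evXY_y.
have Az : chart_ring io u (y / x) z by rewrite zev; apply: chart_ring_ev.
have coord : local_coord (chart_ring io u (y / x)) ev u z (ev u) (ev z).
  exists 1; rewrite !mul1r ev1 oner_eq0 !mul1r; split=> //; by case: (chart_ring_subring io u (y / x)).
exists (ev u), (ev z); split=> //.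
have [emb _] := modelr.
have crv := local_curve (chart_ring_subring io u (y / x)) evA (chart_const u (y / x)) ev_K emb coord.
have H0 : ev u ^+ m.-1 != 0.
  have [u0 | u0] := eqVneq (ev u) 0; last by rewrite expf_neq0.
  have z0 : ev z != 0.
    by apply: contraNneq reverse_at0 => z0; rewrite -[X in _.[X]]u0 -crv z0 expr0n gtn_eqF.
  by apply: contraNneq z0; rewrite zev chart_ev // evXYM evXYX evXY_x evXY_y => ->; rewrite mul0r.
apply: (@local_cover_of_gens _ _ _ io j u z u (y / x) fr q zeta _ _ q_pr modelr sep_fr zetaP q_nz
  ('X%:P ^+ m.-1) ('X%:P ^+ m) 'X).
- by rewrite evXYX evXY_x.
- by rewrite !evXYX evXY_x -exprSr prednK.
by rewrite evXYX evXY_x evXY_y zE.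
Qed.

Lemma chart3_data ev : ring_hom_on (chart_ring io (x / y) y^-1) ev ->
  (forall c, ev (io c) = j c) -> chart_data (x / y) y^-1 ev.
Proof.
move=> evA ev_K; have [ev1 evD evM] := evA; have y0 := model_y_neq0.
have [[Dy _] _] := model.
set A := chart_ring io (x / y) y^-1 in evA ev1 evD evM *.
have subA : subring_on A by apply: chart_ring_subring.
have [A1 AN AD AM] := subA.
have Aa : A (x / y) by apply: chart_a.
have Ab : A y^-1 by apply: chart_b.
(* Where 1/y does not vanish, the point already lies on the affine curve, and y itself serves as
   denominator. *)
have [b0 | b0] := eqVneq (ev y^-1) 0; last first.
  left; exists (ev (x / y) / ev y^-1), (1 / ev y^-1); split.
    exists y^-1; rewrite mulVf // [y^-1 * x]mulrC ev1 mulrCA divff // mulr1.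
    by split=> //; split=> //; field.
  apply: (@local_cover_of_gens _ _ _ io j x y (x / y) y^-1 f q zeta _ _ q_pr model sep_f zetaP q_nz
    'X 'X%:P 1).
  - by rewrite evXY_y mulf_neq0 ?oner_eq0 ?invr_eq0.
  - by rewrite evXY_y evXY_x mulrC divfK.
  by rewrite evXY_y evXY1 divff.
(* Where 1/y vanishes, s takes the value 1, and s/x is integral over the chart. *)
right; pose s := 1 - io f`_0 * y^-1 ^+ q.
have sE : s = evXY io (x / y) y^-1 (1 - (f`_0)%:P%:P * 'X^q).
  by rewrite evXYB evXYM evXYX evXY1 evXY_const evXY_y.
have As : A s by rewrite sE; apply: chart_ring_ev.
have evs : ev s = 1.
  rewrite sE chart_ev // evXYB evXYM evXYX evXY1 evXY_const evXY_y b0.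
  by rewrite expr0n gtn_eqF // mulr0 subr0.
pose N := (q * m)%N.
have fu : \sum_(l < N.+1) io f`_(N - l) * u ^+ l = u ^+ N * y ^+ q.
  have := horner_reverse_poly (eq_leq _) (invr_neq0 x0) (f := map_poly io f) (n := N).
  rewrite size_map_poly => /(_ szf); rewrite invrK -Dy => <-.
  rewrite (@horner_coef_wide _ N.+1) ?size_poly //; apply: eq_bigr => l _.
  by rewrite coef_poly ltn_ord coef_map.
have N_gt0 : (0 < N)%N by rewrite muln_gt0 q_gt0.
(* Dividing [fu] by y^q and moving its last term to the left expresses s u^N through lower powers of
   u; multiplication by s^(N - 1) turns this into a monic equation for s u. *)
have Asu : A (s * u).
  pose c l := io f`_(N - l) * y^-1 ^+ q * s ^+ (N - l.+1).
  have Ac l : A (c l).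
    apply: (AM); last exact: chart_exp.
    by apply: (AM); [apply: chart_const | apply: chart_exp].
  apply: (@chart_monic_root _ _ N _ c) => //.
    have suN : s * u ^+ N = \sum_(l < N) io f`_(N - l) * y^-1 ^+ q * u ^+ l.
      have := congr1 ( *%R (y^-1 ^+ q)) fu.
      rewrite big_ord_recr /= subnn mulrDr mulr_sumr => E.
      have -> : s * u ^+ N = y^-1 ^+ q * (u ^+ N * y ^+ q) - y^-1 ^+ q * (io f`_0 * u ^+ N).
        by rewrite /s exprVn; field; rewrite !expf_neq0.
      rewrite -E addrK; apply: eq_bigr => l _.
      by rewrite mulrCA mulrA.
    rewrite exprMn -{1}(prednK N_gt0) exprSr -mulrA suN mulr_sumr; apply: eq_bigr => l _.
    rewrite /c exprMn.
    have -> : s ^+ N.-1 = s ^+ (N - l.+1) * s ^+ l.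
      by rewrite -exprD; congr (_ ^+ _); have := ltn_ord l; lia.
    by ring.
have Asz : A (s ^+ m * z).
  apply: (@chart_root _ _ _ q) => //.
  have -> : (s ^+ m * z) ^+ q = \sum_(l < N.+1) io f`_(N - l) * s ^+ (N - l) * (s * u) ^+ l.
    rewrite exprMn expr_div_n -!exprM (mulnC m) -/N.
    have -> : y ^+ q / x ^+ N = u ^+ N * y ^+ q by rewrite mulrC exprVn.
    rewrite -fu mulr_sumr; apply: eq_bigr => l _; rewrite exprMn.
    have -> : s ^+ N = s ^+ (N - l) * s ^+ l by rewrite -exprD subnK // -ltnS.
    by ring.
  have A0 : A 0 by rewrite -(subrr 1); apply: AD => //; apply: AN.
  elim/big_ind: _ => // l _; apply: (AM); last exact: chart_exp.
  by apply: (AM); [apply: chart_const | apply: chart_exp].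
have Asu' : A (s ^+ m * u).
  rewrite -(prednK m_gt0) exprSr -mulrA; apply: (AM) => //; exact: chart_exp.
have evsn n : ev (s ^+ n) = 1 by rewrite (chart_X evA) // evs expr1n.
have coord : local_coord A ev u z (ev (s ^+ m * u)) (ev (s ^+ m * z)).
  exists (s ^+ m); rewrite evsn oner_eq0 !mul1r; split=> //; exact: chart_exp.
exists (ev (s ^+ m * u)), (ev (s ^+ m * z)); split=> //.
have [emb _] := modelr.
have crv := local_curve subA evA (chart_const (x / y) y^-1) ev_K emb coord.
(* As u^m = z/y, the function u vanishes at the point together with 1/y; the equation then makes z
   nonzero, and z can serve as denominator. *)
have su0 : ev (s * u) = 0.
  have : ev ((s * u) ^+ m) = ev (s ^+ m * z * y^-1).
    by congr ev; rewrite exprMn exprVn; field; rewrite y0 expf_neq0.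
  rewrite (chart_X evA) // (evM (s ^+ m * z) y^-1) // b0 mulr0 => /eqP.
  by rewrite expf_eq0 => /andP[_ /eqP].
have x10 : ev (s ^+ m * u) = 0.
  rewrite -(prednK m_gt0) exprSr -mulrA evM ?su0 ?mulr0 //; exact: chart_exp.
have z10 : ev (s ^+ m * z) != 0.
  by apply: contraNneq reverse_at0 => z0; rewrite -[X in _.[X]]x10 -crv z0 expr0n gtn_eqF.
apply: (@local_cover_of_gens _ _ _ io j u z (x / y) y^-1 fr q zeta _ _ q_pr modelr sep_fr zetaP q_nz
  'X ('X%:P ^+ m.-1) ('X%:P ^+ m)).
- by rewrite evXY_y.
- rewrite evXY_y evXYX evXY_x exprVn -{1}(prednK m_gt0) exprS.
  by field; rewrite y0 x0 expf_neq0.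
by rewrite evXY_y evXYX evXY_x exprVn; field; rewrite y0 expf_neq0.
Qed.

End Charts.

(** * Choice of the curve *)

Section CurveChoice.
Variables (K : fieldType) (v : discrete_valuation K) (k : closedFieldType) (r : K -> k).
Hypotheses (hens : henselian v) (res : is_residue_map v r).

Lemma residue_natr_neq0 q : q%:R != 0 :> k -> q%:R != 0 :> K.
Proof.
have [rho _] := residue_morphism res.
apply: contraNneq => q0; have -> : q%:R = rho q%:R by rewrite rmorph_nat.
suff -> : q%:R = 0 :> int_elt v by rewrite rmorph0.
by apply: val_inj; rewrite rmorph_nat rmorph0 q0.
Qed.

(** In [k] there is a root of X^q - 1 other than 1, and it is simple because q is nonzero there; its
    lift is not 1 and has order dividing the prime q. *)
Lemma henselian_prim_root q : prime q -> q%:R != 0 :> k -> exists zeta : K, q.-primitive_root zeta.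
Proof.
move=> q_pr q_nz; have [q_gt1 q_gt0] := (prime_gt1 q_pr, prime_gt0 q_pr).
have [rho rhoE] := residue_morphism res.
have [S DS] : exists S : {poly k}, 'X^q - 1 = S * ('X - 1%:P).
  by apply/factor_theorem; rewrite rootE !hornerE expr1n subrr.
have S1 : ~~ root S 1.
  rewrite rootE; have := congr1 (fun p => p^`().[1]) DS.
  rewrite derivB derivXn derivM derivXsubC -[1]/(1%:P) derivC subr0.
  by rewrite !hornerE hornerMn hornerXn expr1n subrr mulr0 add0r => <-.
have szS : size S = q.
  have := congr1 (fun p : {poly k} => size p) DS; rewrite size_XnsubC // size_Mmonic ?monicXsubC //.
    by rewrite size_XsubC addn2 => -[].
  by apply: contraNneq S1 => ->; rewrite root0.
have [z Sz] : exists z, root S z by apply/closed_rootP; rewrite szS gtn_eqF.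
have z1 : z != 1 by apply: contraNneq S1 => <-.
have zq : z ^+ q = 1.
  by apply/eqP; rewrite -subr_eq0; have := congr1 (horner^~ z) DS;
     rewrite !hornerE (rootP Sz) mul0r => ->.
have [a Da] := residue_surj res rhoE z.
have [||| b fb Db] := residue_simple_root_lift hens res rhoE (f := 'X^q - 1%:P) (a := a).
- exact: monicXnsubC.
- by rewrite !hornerE rmorphB rmorphXn rmorph1 Da zq subrr.
- rewrite derivB derivC subr0 derivXn hornerMn hornerXn rmorphMn rmorphXn /= Da -mulr_natl.
  rewrite mulf_neq0 // expf_neq0 //; apply: contra_eqN zq => /eqP ->.
  by rewrite expr0n gtn_eqF // eq_sym oner_eq0.
exists (val b); have bq : val b ^+ q = 1.
  have /eqP := fb; rewrite !hornerE => /eqP; rewrite subr_eq0 => /eqP/(congr1 val).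
  by rewrite rmorphXn rmorph1.
have [m m_dvd prim_m] := prim_order_exists q_gt0 bq.
have /primeP[_ /(_ m prim_m)/orP[/eqP m1 | /eqP <- //]] := q_pr.
have := prim_expr_order m_dvd; rewrite m1 expr1 => b1.
by case/eqP: z1; rewrite -Da -Db (_ : b = 1) ?rmorph1 //; apply: val_inj.
Qed.

Lemma root_product_monic (c : K) ns : (forall n, n \in ns -> (0 < n)%N) ->
  root_product c ns \is monic /\ size (root_product c ns) = (sumn ns).+1.
Proof.
elim: ns => [|n ns IHns] ns_gt0; first by rewrite /root_product big_nil monic1 size_poly1.
have [|mon_r sz_r] := IHns; first by move=> i i_ns; rewrite ns_gt0 // inE i_ns orbT.
have n_gt0 : (0 < n)%N by rewrite ns_gt0 ?mem_head.
have mon_n : 'X^n - c%:P \is monic by apply: monicXnsubC.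
rewrite /root_product big_cons -/(root_product c ns); split; first by rewrite monicMl.
by rewrite size_Mmonic ?monic_neq0 // size_XnsubC // sz_r /= addnS.
Qed.

Lemma size_curve_poly (c : K) q s ns : (0 < q)%N -> c != 0 -> (forall n, n \in ns -> (0 < n)%N) ->
    (0 < sumn ns)%N ->
  size (curve_poly c q s ns) = (q * sumn ns).+1 /\ lead_coef (curve_poly c q s ns) = c.
Proof.
move=> q_gt0 c0 ns_gt0 m_gt0; have [mon_r sz_r] := root_product_monic c ns_gt0.
have mon_rq := monic_exp q mon_r.
have sz_rq : size (c%:P * root_product c ns ^+ q) = (q * sumn ns).+1.
  rewrite mul_polyC size_scale // -[LHS]prednK ?size_poly_gt0 ?monic_neq0 // size_exp sz_r.
  by rewrite mulnC.
have sz_lt : (size (c ^+ (q * s))%:P < size (c%:P * root_product c ns ^+ q)%R)%N.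
  by apply: leq_ltn_trans (size_polyC_leq1 _) _; rewrite sz_rq ltnS muln_gt0 q_gt0.
rewrite /curve_poly size_polyDl ?lead_coefDl //; split=> //.
by rewrite mul_polyC lead_coefZ (monicP mon_rq) mulr1.
Qed.

(** A shift fails only when c(s) = -g(t) for a root t of f, so among more values than there are
    roots one is suitable. *)
Lemma coprimep_shift (F : fieldType) (f g : {poly F}) (c : nat -> F) B :
    f != 0 -> (forall i i', c i = c i' -> i = i') ->
  exists2 s, (B < s)%N & coprimep f (g + (c s)%:P).
Proof.
move=> f0 c_inj; pose f1 := (lead_coef f)^-1 *: f.
have lc0 : (lead_coef f)^-1 != 0 by rewrite invr_eq0 lead_coef_eq0.
have mon_f1 : f1 \is monic by rewrite monicE lead_coefZ mulVf // lead_coef_eq0.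
have [E [i [rs Df1]]] := splitting_field_exists mon_f1.
pose bad := [seq - (map_poly i g).[t] | t <- rs].
have [s s_gt s_ok] : exists2 s, s \in seq.iota B.+1 (size rs).+1 & i (c s) \notin bad.
  apply/hasP; apply: contraT; rewrite -all_predC => /allP all_bad.
  have uniq_c : uniq [seq i (c s) | s <- seq.iota B.+1 (size rs).+1].
    by rewrite map_inj_uniq ?iota_uniq // => a b /fmorph_inj/c_inj.
  have := uniq_leq_size uniq_c (s2 := bad); rewrite !size_map size_iota ltnn; apply.
  by move=> _ /mapP[a a_in ->]; have := all_bad a a_in; rewrite /= negbK.
exists s; first by move: s_gt; rewrite mem_iota => /andP[].
rewrite -(coprimepZl _ _ lc0) -/f1 -(coprimep_map i) Df1 rmorphD /= map_polyC /=.
rewrite coprimep_sym; have: {subset rs <= rs} by [].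
elim: {1 3}rs => [|t ts IHts] ts_rs; first by rewrite big_nil coprimep1.
rewrite big_cons coprimepMr IHts ?andbT => [|a a_ts]; last by rewrite ts_rs // inE a_ts orbT.
rewrite coprimep_XsubC rootE !hornerE; apply: contra s_ok => /eqP D.
apply/mapP; exists t; first by rewrite ts_rs ?mem_head.
by apply/eqP; rewrite -addr_eq0 addrC D.
Qed.

(** F' = q pi f^(q - 1) f'. Modulo f, F is the nonzero constant pi^(q s), and s is chosen to make F
    prime to f', which is nonzero because the degree of f is nonzero in [K]. *)
Lemma separable_curve_poly (pi : K) q ns : pi != 0 -> v pi = 1 -> (0 < q)%N -> q%:R != 0 :> K ->
    (forall n, n \in ns -> (0 < n)%N) -> (sumn ns)%:R != 0 :> K ->
  exists2 s, (size ns < s)%N & separable_poly (curve_poly pi q s ns).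
Proof.
move=> pi0 vpi q_gt0 q_nz ns_gt0 m_nz; have [mon_f sz_f] := root_product_monic pi ns_gt0.
set f := root_product pi ns in mon_f sz_f.
have df0 : f^`() != 0.
  apply: contraNneq m_nz => df0; have := coef_deriv f (sumn ns).-1.
  case: (sumn ns) sz_f => [|m] sz_f; first by rewrite mulr0n.
  by rewrite df0 coef0 /= -[m.+1]/(m.+2.-1) -sz_f -lead_coefE (monicP mon_f) sz_f => <-.
have pi_inj i i' : pi ^+ (q * i) = pi ^+ (q * i') -> i = i'.
  move/(congr1 v); rewrite !dvalX // vpi !natz => -[] /eqP.
  by rewrite eqn_pmul2l // => /eqP.
have [s s_gt cop] :=
  @coprimep_shift _ f^`() (pi%:P * f ^+ q) (fun s => pi ^+ (q * s)) (size ns) df0 pi_inj.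
exists s => //; rewrite separable_poly.unlock; set F := curve_poly _ _ _ _.
have DF : F = pi%:P * f ^+ q + (pi ^+ (q * s))%:P by [].
have -> : F^`() = (pi * q%:R) *: (f ^+ q.-1 * f^`()).
  rewrite DF derivD derivC addr0 derivM derivC mul0r add0r deriv_exp mul_polyC.
  by rewrite -scaler_nat scalerA [f^`() * _]mulrC.
rewrite coprimepZr ?mulf_neq0 // coprimepMr [X in _ && X]coprimep_sym DF cop andbT.
apply: coprimep_expr; rewrite coprimep_sym -(prednK q_gt0) exprS mulrCA mulrC.
rewrite coprimep_addl_mul -alg_polyC coprimepZr ?expf_neq0 //.
exact: coprimep1.
Qed.

End CurveChoice.

(** * The superelliptic model *)

Section CurveModel.
Variables (K L : fieldType) (io : {rmorphism K -> L}) (x y : L) (f : {poly K}) (q m : nat) (zeta : K).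
Hypotheses (q_pr : prime q) (m_gt0 : (0 < m)%N) (szf : size f = (q * m).+1).
Hypotheses (model : plane_model io x y f q) (sep_f : separable_poly f).
Hypotheses (zetaP : q.-primitive_root zeta) (q_nz : q%:R != 0 :> K).

Let q_gt0 : (0 < q)%N := prime_gt0 q_pr.

Lemma superelliptic_nonconst : (1 < size f)%N.
Proof. by rewrite szf ltnS muln_gt0 q_gt0. Qed.

Lemma superelliptic_powfree (g h : {poly K}) : (1 < size g)%N -> f != g ^+ q * h.
Proof. exact: separable_no_power (prime_gt1 q_pr) sep_f. Qed.

Lemma superelliptic_rel (P : {poly {poly K}}) :
  eval2 io x y P = 0 <-> exists Q : {poly {poly K}}, P = Q * ('Y ^+ q - f^:P).
Proof.
have swapE : swapXY ('X^q - f%:P) = 'Y ^+ q - f^:P.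
  rewrite raddfB -swapXY_polyC; congr (_ - _).
  by apply: etrans (rmorphXn swapXY q 'X) (congr1 (fun t => t ^+ q) (swapXY_X _)).
have [emb _] := model; rewrite eval2E (model_rel q_gt0 emb); split=> -[Q DQ].
  by exists (swapXY Q); rewrite -swapE -rmorphM -DQ /= swapXYK.
by exists (swapXY Q); rewrite DQ rmorphM /= -swapE swapXYK.
Qed.

Lemma superelliptic_gen z : exists P Q : {poly {poly K}},
  eval2 io x y Q != 0 /\ z = eval2 io x y P / eval2 io x y Q.
Proof.
have [_ /(_ z)[P [Q [Q0 ->]]]] := model.
by exists (swapXY P), (swapXY Q%:P); rewrite !eval2_swap evXY_polyC.
Qed.

Definition superelliptic_model : affine_model K q :=
  AffineModel superelliptic_nonconst superelliptic_powfree superelliptic_rel superelliptic_gen.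

Local Notation C := superelliptic_model.

Lemma normal_chartE ab z : normal_chart (C := C) ab z <-> chart_ring io ab.1 ab.2 z.
Proof.
rewrite chart_ringE /normal_chart; split=> -[p mon_p pz].
  exists (map_poly swapXY p); first exact: monic_map.
  rewrite -map_poly_comp_id0 ?evXY0 //.
  by rewrite (eq_map_poly (g := eval2 io ab.1 ab.2)) // => P /=; rewrite eval2E.
exists (map_poly swapXY p); first exact: monic_map.
rewrite -map_poly_comp_id0; last by rewrite eval2E rmorph0 evXY0.
by rewrite (eq_map_poly (g := evXY io ab.1 ab.2)) // => P /=; rewrite eval2_swap.
Qed.

Lemma local_data_of_chart ab (kappa : fieldType) (j : {rmorphism K -> kappa}) (ev : L -> kappa) :
    ab \in charts C -> ring_hom_on (chart_ring io ab.1 ab.2) ev -> (forall c, ev (io c) = j c) ->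
  chart_data io j x y m ab.1 ab.2 ev.
Proof.
rewrite !inE => /or3P[] /eqP-> /= evA ev_K.
- exact: (chart1_data m q_pr model sep_f zetaP q_nz evA ev_K).
- exact: (chart2_data q_pr m_gt0 model sep_f zetaP q_nz szf evA ev_K).
exact: (chart3_data q_pr m_gt0 model sep_f zetaP q_nz szf evA ev_K).
Qed.

Lemma chart_residue ab (kappa : fieldType) (ev : L -> kappa) :
    ring_hom_on (chart_ring io ab.1 ab.2) ev ->
  exists j : {rmorphism K -> kappa}, forall c, ev (io c) = j c.
Proof.
move=> [ev1 evD evM]; have Ac c : chart_ring io ab.1 ab.2 (io c) by apply: chart_const.
have [|c c'|c c'|j jE] := @rmorphism_of K kappa (ev \o io).
- by rewrite /= rmorph1.
- by rewrite /= rmorphD evD.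
- by rewrite /= rmorphM evM.
by exists j => c; rewrite jE.
Qed.

Lemma normal_chart_hom ab (kappa : fieldType) (ev : L -> kappa) :
  ring_hom_on (normal_chart (C := C) ab) ev <-> ring_hom_on (chart_ring io ab.1 ab.2) ev.
Proof.
split=> -[ev1 evD evM].
  by split=> // a b /normal_chartE Aa /normal_chartE Ab; [apply: evD | apply: evM].
by split=> // a b /normal_chartE Aa /normal_chartE Ab; [apply: evD | apply: evM].
Qed.

Local Notation u := x^-1.
Local Notation z := (y / x ^+ m).
Local Notation fr := (reverse_poly (q * m) f).
Let modelr : plane_model io u z fr q := model_swap q_gt0 (eq_leq szf) model.
Let sep_fr : separable_poly fr := separable_reverse szf sep_f.

Lemma superelliptic_smooth : smooth_curve C.
Proof.
move=> ab abC kappa ev [/normal_chart_hom evA _].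
have [j ev_K] := chart_residue evA.
have qk : q%:R != 0 :> kappa by rewrite -(rmorph_nat j) fmorph_eq0.
have [[emb _] [embr _]] := (model, modelr).
have subA := chart_ring_subring io ab.1 ab.2.
have A_K : forall c, chart_ring io ab.1 ab.2 (io c) by exact: chart_const.
have [D0 [[D0D D0K] [a Aa Da] uniqD]] : exists D0 : L -> kappa,
  [/\ derivation_on (chart_ring io ab.1 ab.2) ev D0 /\ (forall c : K, D0 (io c) = 0),
      exists2 a : L, chart_ring io ab.1 ab.2 a & D0 a != 0
    & forall D : L -> kappa, derivation_on (chart_ring io ab.1 ab.2) ev D ->
        (forall c : K, D (io c) = 0) ->
        exists c : kappa, forall a : L, chart_ring io ab.1 ab.2 a -> D a = c * D0 a].
  have [[x1 [y1 [co cov]]] | [x1 [y1 [co cov]]]] := local_data_of_chart abC evA ev_K.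
    exact (smooth_at_point subA evA A_K ev_K q_gt0 emb co sep_f qk cov).
  exact: (smooth_at_point subA evA A_K ev_K q_gt0 embr co sep_fr qk cov).
exists D0; split.
- have [DD DM] := D0D; split=> // b c /normal_chartE Ab /normal_chartE Ac.
    exact: DD.
  exact: DM.
- by exists a => //; apply/normal_chartE.
move=> D [DD DM DK]; have [||c Dc] := uniqD D => //.
  by split=> b c Ab Ac; [apply: DD | apply: DM]; apply/normal_chartE.
by exists c => b /normal_chartE; apply: Dc.
Qed.

Lemma superelliptic_geometrically_integral : geometrically_integral C.
Proof.
move=> E s.
have [T [i [j ld]]] := plane_model_linearly_disjoint s q_pr sep_f superelliptic_nonconst model.
by exists T, i, j.
Qed.

Lemma degree_set_point d : degree_set C d -> exists (kappa : fieldType) (j : {rmorphism K -> kappa}),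
  ext_degree j d /\ ((exists x1 y1, y1 ^+ q = (map_poly j f).[x1]) \/
                     exists t, t ^+ q = j (lead_coef f)).
Proof.
move=> [ab abC [kappa [ev [[/normal_chart_hom evA _] [e e_basis]]]]].
have [j ev_K] := chart_residue evA; exists kappa, j; split.
  exists e => t; have [c [Dc cU]] := e_basis t; exists c; split.
    by rewrite Dc; apply: eq_bigr => i _; rewrite -ev_K.
  move=> c' Dc'; apply: cU; rewrite Dc'; apply: eq_bigr => i _.
  by rewrite /= ev_K.
have [[emb _] [embr _]] := (model, modelr).
have subA := chart_ring_subring io ab.1 ab.2.
have A_K : forall c, chart_ring io ab.1 ab.2 (io c) by exact: chart_const.
have [[x1 [y1 [co _]]] | [x1 [y1 [co _]]]] := local_data_of_chart abC evA ev_K.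
  by left; exists x1, y1; exact (local_curve subA evA A_K ev_K emb co).
have := local_curve subA evA A_K ev_K embr co; rewrite map_reverse_poly.
(* Here [x1] is the value of 1/x: if it vanishes the point is at infinity, otherwise (1/x1, y1/x1^m)
   lies on the affine curve. *)
have [-> | x1_neq0] := eqVneq x1 0.
  rewrite reverse_poly0 coef_map => Dy; right; exists y1; rewrite Dy lead_coefE szf //.
rewrite horner_reverse_poly ?size_map_poly ?szf // => Dy; left; exists x1^-1, (y1 / x1 ^+ m).
by rewrite expr_div_n Dy -exprM mulnC mulrC mulKf ?expf_neq0.
Qed.

(** Being integrally closed, K[x, y] is the whole first chart, so evaluation at (x0, y0) is defined
    on it; it is onto because [x0] generates [kappa]. *)
Lemma point_degree_set (kappa : fieldType) (j : {rmorphism K -> kappa}) (x0 y0 : kappa) d :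
    ext_degree j d -> y0 ^+ q = (map_poly j f).[x0] ->
    (forall t, exists P : {poly K}, t = (map_poly j P).[x0]) ->
  degree_set C d.
Proof.
move=> [e e_basis] Dy0 gen; have [emb _] := model.
exists (x, y); first by rewrite inE eqxx.
pose ev t := evXY j x0 y0 (epsilon (inhabits 0) (fun P => t = evXY io x y P)).
have evE P : ev (evXY io x y P) = evXY j x0 y0 P.
  rewrite /ev; set P' := epsilon _ _.
  have DP' : evXY io x y P = evXY io x y P'.
    exact: (epsilon_spec (inhabits 0) _ (ex_intro (fun P1 => evXY io x y P = evXY io x y P1) P erefl)).
  have [|Q DQ] := (model_rel q_gt0 emb (P' - P)).1; first by rewrite evXYB DP' subrr.
  by rewrite -(subrK P P') DQ evXYD evXYM evXY_curve Dy0 subrr mulr0 add0r.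
have A_ev t : chart_ring io x y t -> exists P, t = evXY io x y P.
  by move/chart_ringE; apply: plane_ring_integrally_closed q_pr model sep_f _ zetaP _ q_nz.
have ev_K c : ev (io c) = j c by rewrite -(evXY_const io x y) evE evXY_const.
exists kappa, ev; split; last first.
  exists e => t; have [c [Dc cU]] := e_basis t; exists c; split.
    by rewrite Dc; apply: eq_bigr => i _; rewrite /= ev_K.
  move=> c' Dc'; apply: cU; rewrite Dc'; apply: eq_bigr => i _.
  by rewrite /= ev_K.
split=> [|t].
  apply/normal_chart_hom; split=> [|a b /A_ev[P ->] /A_ev[Q ->]|a b /A_ev[P ->] /A_ev[Q ->]].
  - by rewrite -(evXY1 io x y) evE evXY1.
  - by rewrite -evXYD !evE evXYD.
  by rewrite -evXYM !evE evXYM.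
have [P ->] := gen t; exists (evXY io x y P%:P); last by rewrite evE evXY_polyC.
by apply/normal_chartE; apply: chart_ring_ev.
Qed.

End CurveModel.

Theorem theorem1p2 (K : fieldType) (v : discrete_valuation K)
    (k : closedFieldType) (r : K -> k) (p q l : nat) (n : 'I_l -> nat) :
  henselian v ->
  is_residue_map v r ->
  has_characteristic k p ->
  prime q ->
  q <> p ->
  (forall i, (0 < n i)%N) ->
  exists C : superelliptic_curve K q,
    forall d : nat,
      degree_set C d <->
      (pos_multiple q d \/ exists i : 'I_l, pos_multiple (n i) d).
Proof.
move=> hens res char_k q_pr q_p n_gt0; have q_gt0 := prime_gt0 q_pr.
have qk : q%:R != 0 :> k.
  rewrite char_k; apply/negP => p_q; have /primeP[_ /(_ p p_q)/orP[/eqP p1|/eqP pq]] := q_pr.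
    by have := char_k 1%N; rewrite p1 dvd1n oner_eq0.
  by case: q_p.
have qK := residue_natr_neq0 res qk.
have [pi pi0 vpi] := dval_onto v 1.
have [zeta zetaP] := henselian_prim_root hens res q_pr qk.
(* t = 1 or 2 keeps the degree of root_product prime to the characteristic, so
   that its derivative does not vanish. *)
have [ns [[t t_gt0 Dns] m_nz]] : exists ns,
    (exists2 t, (0 < t)%N & ns = (q * t)%N :: codom n) /\ (sumn ns)%:R != 0 :> K.
  pose N := sumn (codom n).
  have [N1 | N1] := eqVneq ((q * 1 + N)%:R : K) 0; last first.
    by exists ((q * 1)%N :: codom n); split; first exists 1%N.
  exists ((q * 2)%N :: codom n); split; first by exists 2%N.
  by rewrite /= -/N muln2 -addnn -addnA natrD -[q in (q + N)%N]muln1 N1 addr0.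
have ns_gt0 i : i \in ns -> (0 < i)%N.
  by rewrite Dns inE => /orP[/eqP-> | /codomP[a ->]]; rewrite ?muln_gt0 ?q_gt0 ?n_gt0.
have m_gt0 : (0 < sumn ns)%N by rewrite lt0n; apply: contraNneq m_nz => ->.
have [s s_gt sep] := separable_curve_poly pi0 vpi q_gt0 qK ns_gt0 m_nz.
have [szf lcf] := size_curve_poly s q_gt0 pi0 ns_gt0 m_gt0.
have s_gt0 : (0 < s)%N by apply: leq_ltn_trans s_gt.
have szf1 : (1 < size (curve_poly pi q s ns))%N by rewrite szf ltnS muln_gt0 q_gt0.
have [L [io [x [y model]]]] := plane_model_exists q_pr sep szf1.
pose smooth := @superelliptic_smooth _ _ _ _ _ _ _ _ _ q_pr m_gt0 szf model sep zetaP qK.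
exists (SuperellipticCurve smooth
  (superelliptic_geometrically_integral q_pr m_gt0 szf model sep)) => d /=.
split=> [/(degree_set_point zetaP qK)[kappa [j [deg_d pts]]] | d_mult].
  have [d' [_ [Dd _]]] := ext_degree_mx deg_d.
  have d_gt0 : (0 < d)%N by rewrite Dd.
  have multiple a : (a %| d)%N -> pos_multiple a d.
    case/dvdnP=> b Db; exists b; last by rewrite mulnC.
    by move: d_gt0; rewrite Db muln_gt0 => /andP[].
  have [[x1 [y1 Dy]] | [z Dz]] := pts; last first.
    rewrite lcf in Dz; left; apply: multiple.
    exact: (infinite_point_degree hens res pi0 vpi q_pr deg_d Dz).
  have [q_d | [a]] := affine_point_degree hens res pi0 vpi q_pr ns_gt0 s_gt deg_d Dy.
    by left; apply: multiple.
  rewrite Dns inE => /orP[/eqP-> | /codomP[i ->]] a_d.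
    by left; apply: multiple; apply: dvdn_trans a_d; apply: dvdn_mulr.
  by right; exists i; apply: multiple.
have [kappa [j [x0 [y0 [deg_d Dy0 gen]]]]] : has_curve_point pi q s ns d.
  case: d_mult => [[a a_gt0 ->] | [i [a a_gt0 ->]]].
    exact: (curve_point_multiple_q hens res pi0 vpi q_pr ns_gt0 qk s_gt0 a_gt0).
  apply: (curve_point_multiple hens res pi0 vpi q_pr ns_gt0 qk s_gt0 _ a_gt0).
  by rewrite Dns inE codom_f orbT.
exact: (point_degree_set _ _ _ _ _ zetaP qK deg_d Dy0 gen).
Qed.
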